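(* Let $d\geq 1$, let $R$ be a commutative Noetherian domain of Krull dimension $d-1$, and let $I$ be an ideal of $R$. Let $A$ denote either the Rees algebra $R[It]$ or the extended Rees algebra $R[It,t^{-1}]$. Then every finitely generated projective $A$-module of rank $d$ is cancellative.
   Context: For an ideal $I$ of $R$ and an indeterminate $t$, the Rees algebra is $R[It]=\bigoplus_{n\geq 0} I^n t^n\subset R[t]$, and the extended Rees algebra is $R[It,t^{-1}]=\bigoplus_{n\in\mathbb{Z}} I^n t^n\subset R[t,t^{-1}]$, where $I^n=R$ for $n\leq 0$. A finitely generated projective $A$-module $P$ is called cancellative if for all finitely generated projective $A$-modules $P'$ and $Q$, $P\oplus Q\cong P'\oplus Q$ implies $P\cong P'$. *)

(* Defs.v *)
From HB Require Import structures.
From mathcomp Require Import all_boot all_order all_algebra.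
Set Implicit Arguments. Unset Strict Implicit. Unset Printing Implicit Defensive.
Import Order.TTheory GRing.Theory Num.Theory.
Local Open Scope ring_scope.

Definition is_ideal (R : comNzRingType) (J : R -> Prop) : Prop :=
  [/\ J 0, (forall x y, J x -> J y -> J (x + y)) & (forall a x, J x -> J (a * x))].

Definition is_prime_ideal (R : comNzRingType) (J : R -> Prop) : Prop :=
  [/\ is_ideal J, ~ J 1 & forall x y, J (x * y) -> J x \/ J y].

Definition noetherian (R : comNzRingType) : Prop :=
  forall J : nat -> R -> Prop,
    (forall n, is_ideal (J n)) -> (forall n x, J n x -> J n.+1 x) ->
    exists N, forall n x, (N <= n)%N -> J n x -> J N x.

Definition prime_chain (R : comNzRingType) (n : nat) (P : nat -> R -> Prop) : Prop :=
  (forall i, (i <= n)%N -> is_prime_ideal (P i)) /\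
  (forall i, (i < n)%N ->
     (forall x, P i x -> P i.+1 x) /\ exists x, P i.+1 x /\ ~ P i x).

Definition krull_dim_eq (R : comNzRingType) (n : nat) : Prop :=
  (exists P : nat -> R -> Prop, prime_chain n P) /\ ~ (exists P : nat -> R -> Prop, prime_chain n.+1 P).

Fixpoint ideal_pow (R : comNzRingType) (I : R -> Prop) (n : nat) : R -> Prop :=
  match n with
  | 0 => fun _ => True
  | n'.+1 => fun x => exists s : seq (R * R),
      (forall ab, ab \in s -> I ab.1 /\ ideal_pow I n' ab.2) /\
      x = \sum_(ab <- s) ab.1 * ab.2
  end.

Definition in_rees (R : comNzRingType) (I : R -> Prop) (p : {poly R}) : Prop :=
  forall i, ideal_pow I i p`_i.

Definition is_rees_algebra (R : comNzRingType) (I : R -> Prop) (A : comNzRingType) : Prop :=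
  exists phi : {rmorphism A -> {poly R}},
    injective phi /\ forall p, in_rees I p <-> exists a, phi a = p.

Definition is_laurent (R : comNzRingType) (L : comNzRingType)
  (iota : {rmorphism {poly R} -> L}) (u : L) : Prop :=
  [/\ injective iota, u * iota 'X = 1 & forall x, exists p n, x = iota p * u ^+ n].

(* A is (isomorphic to) the extended Rees algebra R[It,t^-1] inside R[t,t^-1]:
   elements sum_{n>=0} a_n t^n (a_n in I^n) + sum_{n>=1} b_n t^-n. *)
Definition is_ext_rees_algebra (R : comNzRingType) (I : R -> Prop) (A : comNzRingType) : Prop :=
  exists (L : comNzRingType) (iota : {rmorphism {poly R} -> L}) (u : L)
         (psi : {rmorphism A -> L}),
    [/\ is_laurent iota u, injective psi &
     forall x, (exists a, psi a = x) <->
       exists p q : {poly R}, in_rees I p /\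
         x = iota p + u * (map_poly (fun c => iota c%:P) q).[u]].

Definition fg_projective (A : comNzRingType) (P : lmodType A) : Prop :=
  exists n (i : {linear P -> 'rV[A]_n}) (p : {linear 'rV[A]_n -> P}), cancel i p.

Definition lin_indep (A : comNzRingType) (P : lmodType A) (s : seq P) : Prop :=
  forall c : 'I_(size s) -> A,
    \sum_(i < size s) c i *: s`_i = 0 -> forall i, c i = 0.

(* Rank of a module over a domain: maximal number of linearly independent elements. *)
Definition module_rank_eq (A : comNzRingType) (P : lmodType A) (d : nat) : Prop :=
  (exists s : seq P, size s = d /\ lin_indep s) /\
  ~ (exists s : seq P, size s = d.+1 /\ lin_indep s).

Definition mod_iso (A : comNzRingType) (M N : lmodType A) : Prop :=
  exists f : {linear M -> N}, bijective f.

Definition cancellative (A : comNzRingType) (P : lmodType A) : Prop :=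
  forall P' Q : lmodType A, fg_projective P' -> fg_projective Q ->
    mod_iso (P * Q)%type (P' * Q)%type -> mod_iso P P'.

(* Main.v *)
(* Write A_s for localization at s in R and A_{1+sR} for localization at 1 + sR.
   It suffices to cancel a free summand of rank one, that is to show that an
   idempotent matrix e of rank at least d over A is determined up to isomorphism
   by e + (1).  An isomorphism of e + (1) with e' + (1) gives a unimodular row v,
   to be moved to (0, 1) by automorphisms of the image of e + (1).  Two such
   motions exist, each made of transvections, hence isotopic to the identity:
   - over A_s for a suitable s, since generically A has dimension at most 1, so
     that Coquand's boundary argument (a constructive form of Plumstead's
     generalized dimension) applies when d > 1;
   - over A_{1+sR}, since both A/sA and A_{s(1+sR)} have dimension less than d.
   They differ over A_{s(1+sR)} by a path of matrices which ends at a stably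
   trivial one.  For a good choice of s this ring is S^-1 R[X] or S^-1 R[X, 1/X]
   with S^-1 R[T] of dimension less than d, and such an endpoint is isotopic to
   the identity: contracting X to 0 reduces to S^-1 R, where transvections over
   S^-1 R[T] straighten the path; the Laurent case is first split along X != 0 and
   a neighbourhood of X = 0.  Quillen's splitting then writes the isotopic matrix
   as a product of matrices over A_s and over A_g with g in 1 + sR, and correcting
   the two motions by these factors glues them to an isomorphism of e with e'
   over A.  If R is a field there is no such s, but then projectives over A are
   free.
   The dimension bounds rest on Krull's principal ideal theorem (by Caruth's
   length argument) and on the strong S-property of Noetherian rings, from which
   heights do not grow in algebraic extensions of R[X] and ht P <= ht (P cap R) + 1. *)

Require Import Defs.
From HB Require Import structures.
From mathcomp Require Import all_boot all_order all_algebra.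
From mathcomp Require Import perm generic_quotient boolp ring zify.
From mathcomp Require classical_sets.
Set Implicit Arguments. Unset Strict Implicit. Unset Printing Implicit Defensive.
Import GRing.Theory.
Local Open Scope ring_scope.

(** * Ideals and prime separation *)

(** [A] can have dimension [d], so general position alone cancels only in rank above [d]; the
    missing unit comes from localizing at s(1+sR), which lowers the dimension of [R] by one.
    Straightening a path takes place over polynomials in the path variable T, and S^-1 R[X][T] may
    still have dimension [d], one too many in rank [d]: hence the contraction of X, and, where X is
    invertible, the extra localization near X = 0. All rings sit inside the field [F] of fractions
    of R[X], and localizations are predicates on [F]: intersecting A_s with A_{1+sR} is then
    literal. X stands for t in the Rees algebra and for 1/t in the extended one. If s is a multiple
    of a nonzero element of [I], then A_s is R_s[X] or R_s[X, 1/X]. For I = 0 the Rees algebra is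
    [R] itself and is treated as a retract of R[X]; the extended one is R[X]. The rank is kept at
    least [d], not equal to [d], because free summands are removed one at a time, through larger
    ranks. A domain [R] that is not a field forces [d] to be at least 2, as the generic motion
    requires. *)

Section Ideals.
Variable U : comNzRingType.
Implicit Types (J L Q S : U -> Prop) (x y z u : U).

Definition is_monoid S := S 1 /\ forall x y, S x -> S y -> S (x * y).

Definition le J L := forall x, J x -> L x.

Definition idadd J x : U -> Prop := fun y => exists j c, J j /\ y = j + c * x.

Lemma ideal0 J : is_ideal J -> J 0. Proof. by case. Qed.
Lemma idealD J x y : is_ideal J -> J x -> J y -> J (x + y).
Proof. by case=> _ h _; apply: h. Qed.
Lemma idealM J a x : is_ideal J -> J x -> J (a * x).
Proof. by case=> _ _; apply. Qed.
Lemma idealMr J a x : is_ideal J -> J x -> J (x * a).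
Proof. by move=> *; rewrite mulrC; apply: idealM. Qed.
Lemma idealN J x : is_ideal J -> J x -> J (- x).
Proof. by move=> *; rewrite -mulN1r; apply: idealM. Qed.
Lemma idealB J x y : is_ideal J -> J x -> J y -> J (x - y).
Proof. by move=> iJ *; apply: (idealD iJ) => //; apply: idealN. Qed.
Lemma ideal_sum J (I : Type) (r : seq I) (P : pred I) (F : I -> U) :
  is_ideal J -> (forall i, P i -> J (F i)) -> J (\sum_(i <- r | P i) F i).
Proof.
move=> iJ h; elim/big_ind: _ => //; first exact: ideal0.
by move=> *; apply: idealD.
Qed.

Lemma idadd_ideal J x : is_ideal J -> is_ideal (idadd J x).
Proof.
move=> iJ; split.
- by exists 0, 0; split; [exact: ideal0 | ring].
- move=> _ _ [j [c [Jj ->]]] [k [d [Jk ->]]]; exists (j + k), (c + d).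
  by split; [exact: idealD | ring].
- move=> a _ [j [c [Jj ->]]]; exists (a * j), (a * c).
  by split; [exact: idealM | ring].
Qed.
Lemma le_idadd J x : le J (idadd J x).
Proof. by move=> y Jy; exists y, 0; split=> //; ring. Qed.
Lemma idadd_in J x : is_ideal J -> idadd J x x.
Proof. by move=> iJ; exists 0, 1; split; [exact: ideal0 | ring]. Qed.
Lemma idadd_min J L x : is_ideal L -> le J L -> L x -> le (idadd J x) L.
Proof.
by move=> iL JL Lx _ [j [c [Jj ->]]]; apply: idealD => //; [apply: JL|apply: idealM].
Qed.
Lemma zero_ideal : is_ideal (fun x : U => x = 0).
Proof. by split=> [|x y -> ->|a x ->]; rewrite ?addr0 ?mulr0. Qed.

Lemma colon_ideal J a : is_ideal J -> is_ideal (fun x => J (a * x)).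
Proof.
move=> iJ; split; first by rewrite mulr0; apply: ideal0.
  by move=> x y ? ?; rewrite mulrDr; apply: idealD.
by move=> c x ?; rewrite mulrCA; apply: idealM.
Qed.

Definition idsum J L : U -> Prop := fun x => exists y z, [/\ J y, L z & x = y + z].

Lemma idsum_ideal J L : is_ideal J -> is_ideal L -> is_ideal (idsum J L).
Proof.
move=> iJ iL; split.
- by exists 0, 0; split; rewrite ?addr0 //; apply: ideal0.
- move=> _ _ [y [z [? ? ->]]] [y' [z' [? ? ->]]]; exists (y + y'), (z + z').
  by split; [apply: idealD|apply: idealD|ring].
- move=> a _ [y [z [? ? ->]]]; exists (a * y), (a * z).
  by split; [apply: idealM|apply: idealM|ring].
Qed.
Lemma idsuml J L : is_ideal L -> le J (idsum J L).
Proof. by move=> iL x Jx; exists x, 0; split; rewrite ?addr0 //; apply: ideal0. Qed.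
Lemma idsumr J L : is_ideal J -> le L (idsum J L).
Proof. by move=> iL x Jx; exists 0, x; split; rewrite ?add0r //; apply: ideal0. Qed.
Lemma idsum_min J L N : is_ideal N -> le J N -> le L N -> le (idsum J L) N.
Proof. by move=> iN h k _ [y [z [/h ? /k ? ->]]]; apply: idealD. Qed.

Lemma prime_idealW Q : is_prime_ideal Q -> is_ideal Q. Proof. by case. Qed.
Lemma prime1 Q : is_prime_ideal Q -> ~ Q 1. Proof. by case. Qed.
Lemma primeM Q x y : is_prime_ideal Q -> Q (x * y) -> Q x \/ Q y.
Proof. by case=> _ _; apply. Qed.
Lemma primeMl Q x y : is_prime_ideal Q -> ~ Q x -> Q (x * y) -> Q y.
Proof. by move=> pQ nx /(primeM pQ) []. Qed.
Lemma primeX Q x n : is_prime_ideal Q -> Q (x ^+ n) -> Q x.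
Proof.
move=> pQ; elim: n => [|n IH]; first by rewrite expr0 => /(prime1 pQ).
by rewrite exprS => /(primeM pQ) [].
Qed.
Lemma monoidX S x n : is_monoid S -> S x -> S (x ^+ n).
Proof.
by case=> S1 SM Sx; elim: n => [|n IH]; rewrite ?expr0 // exprS; apply: SM.
Qed.

Lemma prime_sep J S : is_ideal J -> is_monoid S -> (forall x, J x -> ~ S x) ->
  exists Q, [/\ is_prime_ideal Q, le J Q & forall x, Q x -> ~ S x].
Proof.
move=> iJ [S1 SM] JS.
pose good L := [/\ is_ideal L, le J L & forall x, L x -> ~ S x].
have [F Ftot Fch|Q [PQ Qmax]] :=
  @classical_sets.Zorn_bigcup U (fun L => (forall x, ~ L x) \/ good L).
  have [[L [FL gL]]|none] := EM (exists L, F L /\ good L); last first.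
    left=> x [L FL Lx]; have [/(_ x)//|gL] := Ftot _ FL.
    by apply: none; exists L.
  right; case: gL => iL JL LS.
  have pick K x : F K -> K x -> exists K', [/\ F K', good K' & K' x].
    by move=> FK Kx; exists K; split=> //; case: (Ftot _ FK) => // /(_ x).
  split.
  - split.
    + by exists L => //; apply: ideal0.
    + move=> x y [K1 F1 Kx] [K2 F2 Ky].
      have [M1 [FM1 [i1 _ _] M1x]] := pick _ _ F1 Kx.
      have [M2 [FM2 [i2 _ _] M2y]] := pick _ _ F2 Ky.
      have [le12|le21] := Fch _ _ FM1 FM2.
        by exists M2 => //; apply: idealD => //; apply: le12.
      by exists M1 => //; apply: idealD => //; apply: le21.
    + move=> a x [K FK Kx]; have [M [FM [iM _ _] Mx]] := pick _ _ FK Kx.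
      by exists M => //; apply: idealM.
  - by move=> x Jx; exists L => //; apply: JL.
  - by move=> x [K FK Kx]; have [M [FM [_ _ MS] Mx]] := pick _ _ FK Kx; apply: MS.
have gQ : good Q.
  case: PQ => // Q0; exfalso; apply: (Qmax J); last by right; split.
  by split=> [x /Q0//|E]; apply: (Q0 0); apply: E; apply: ideal0.
have {PQ} [iQ JQ QS] := gQ.
have maxQ x : ~ Q x -> exists s, S s /\ idadd Q x s.
  move=> nQx; apply: contrapT => H; apply: (Qmax (idadd Q x)).
    split; first exact: le_idadd.
    by move=> E; apply: nQx; apply: E; apply: idadd_in.
  right; split; first exact: idadd_ideal.
    by move=> y /JQ; apply: le_idadd.
  by move=> y Qy Sy; apply: H; exists y.
exists Q; split=> //; split=> //; first by move/QS.
move=> x y Qxy; apply: contrapT => /not_orP [/maxQ [s [Ss [q [c [Qq Es]]]]]].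
move=> /maxQ [t [St [q' [c' [Qq' Et]]]]].
apply: (QS (s * t)); last exact: SM.
rewrite {}Es {}Et.
have -> : (q + c * x) * (q' + c' * y) = q * (q' + c' * y) + (c * x) * q' + c * c' * (x * y).
  by ring.
apply: idealD => //; last exact: idealM.
by apply: idealD => //; [apply: idealMr | apply: idealM].
Qed.

Lemma noeth_max (Phi : (U -> Prop) -> Prop) J :
  noetherian U -> Phi J -> (forall L, Phi L -> is_ideal L) ->
  exists L, Phi L /\ forall L', Phi L' -> le L L' -> le L' L.
Proof.
move=> nU PJ Pid; apply: contrapT => H.
have next L : exists L', Phi L -> Phi L' /\ le L L' /\ ~ le L' L.
  have [PL|nPL] := EM (Phi L); last by exists L.
  apply: contrapT => nE; apply: H; exists L; split=> // L' PL' LL'.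
  by apply: contrapT => nle; apply: nE; exists L'.
have {next} [f fP] := choice next.
pose c n := iter n f J.
have cP n : Phi (c n) by elim: n => //= n IH; have [] := fP _ IH.
have [N NP] : exists N, forall n x, (N <= n)%N -> c n x -> c N x.
  apply: nU => [n|n x]; first exact: Pid.
  by have [_ [le1 _]] := fP _ (cP n); apply: le1.
have [_ [_]] := fP _ (cP N); apply=> x; exact: (NP N.+1).
Qed.

(** [n] counts strict inclusions, and the top member is an index so that chains grow upwards. The
    same type serves for lengths ([K] the saturated ideals) and for heights ([K] the primes). *)
Inductive chain (K : (U -> Prop) -> Prop) X : nat -> (U -> Prop) -> Prop :=
| chain0 N : K N -> le X N -> chain K X 0 N
| chainS n N N' : chain K X n N -> K N' -> le N N' -> ~ le N' N -> chain K X n.+1 N'.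

Lemma chain_top K X n N : chain K X n N -> K N. Proof. by case. Qed.
Lemma chain_le K X n N : chain K X n N -> le X N.
Proof. by elim=> // k N1 N2 _ XN1 _ N12 _ x /XN1; apply: N12. Qed.
Lemma chain_low K X X' n Q : (forall N, K N -> le X N -> le X' N) ->
  chain K X n Q -> chain K X' n Q.
Proof.
move=> h; elim=> [Q' pQ' ZQ'|k Q' Q'' _ c pQ'' le1 nle1].
  by apply: chain0 => //; apply: h.
exact: chainS c _ _ _.
Qed.
Lemma chain_raise K X n N N' : chain K X n N -> K N' -> le N N' -> chain K X n N'.
Proof.
move=> cN; case: cN N' => [M sM XM|k M M' cM sM' MM' nM'] N' sN' NN'.
  by apply: chain0 => // x /XM; apply: NN'.
apply: (chainS cM) => //; first by move=> x /MM'; apply: NN'.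
by move=> h; apply: nM' => x /NN'; apply: h.
Qed.

End Ideals.

(** * The Hilbert basis theorem *)

Section HilbertBasis.
Variable R : comNzRingType.

Definition lead_ideal (J : {poly R} -> Prop) d : R -> Prop :=
  fun c => exists f, [/\ J f, (size f <= d.+1)%N & f`_d = c].

Lemma lead_ideal_ideal J d : is_ideal J -> is_ideal (lead_ideal J d).
Proof.
move=> iJ; split.
- by exists 0; split; rewrite ?size_poly0 ?coef0 //; apply: ideal0.
- move=> _ _ [f [Jf sf <-]] [g [Jg sg <-]]; exists (f + g).
  split; rewrite ?coefD //; first exact: idealD.
  by apply: leq_trans (size_polyD _ _) _; rewrite geq_max sf.
- move=> a _ [f [Jf sf <-]]; exists (a%:P * f).
  split; rewrite ?coefCM //; first exact: idealM.
  by rewrite mul_polyC; apply: leq_trans (size_scale_leq _ _) sf.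
Qed.

(** The ideals of leading coefficients grow with the index and with the degree. Stability of the
    diagonal settles all degrees from [N0] on; the finitely many smaller degrees are stabilized
    separately, by [M]. *)
Lemma hilbert_basis : noetherian R -> noetherian {poly R}.
Proof.
move=> nR J iJ incJ.
have mono n m : (n <= m)%N -> le (J n) (J m).
  move=> /subnK <-; elim: (m - n)%N => [|k IH] x; rewrite ?add0n // addSn => /IH.
  exact: incJ.
have Lid n d : is_ideal (lead_ideal (J n) d) by apply: lead_ideal_ideal.
have Lmono n m d : (n <= m)%N -> le (lead_ideal (J n) d) (lead_ideal (J m) d).
  by move=> nm c [f [Jf sf E]]; exists f; split=> //; apply: (mono n).
have LS n d : le (lead_ideal (J n) d) (lead_ideal (J n) d.+1).
  move=> c [f [Jf sf E]]; exists (f * 'X); split; first exact: (idealMr _ (iJ n) Jf).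
    by apply: leq_trans (size_polyMleq _ _) _; rewrite size_polyX addnS /= addn1.
  by rewrite coefMX.
have LD n d e : (d <= e)%N -> le (lead_ideal (J n) d) (lead_ideal (J n) e).
  move=> /subnK <-; elim: (e - d)%N => [|k IH] x; rewrite ?add0n // addSn => /IH.
  exact: LS.
have [N0 N0P] : exists N, forall n x,
    (N <= n)%N -> lead_ideal (J n) n x -> lead_ideal (J N) N x.
  by apply: nR => // n x /(LD _ _ _ (leqnSn n)); apply: Lmono.
have [M MP] : exists M, forall d, (d < N0)%N -> forall n x,
    (M <= n)%N -> lead_ideal (J n) d x -> lead_ideal (J M) d x.
  move: (N0) => N1; elim: N1 => [|k [M MP]]; first by exists 0%N.
  have [M' M'P] := nR _ (Lid^~ k) (fun n x => @Lmono _ _ k (leqnSn n) x).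
  exists (maxn M M') => d; rewrite ltnS leq_eqVlt => /orP[/eqP->|dk] n x.
    rewrite geq_max => /andP[_ h] /(M'P _ _ h); apply: Lmono.
    exact: leq_maxr.
  rewrite geq_max => /andP[h _] /(MP _ dk _ _ h); apply: Lmono.
  exact: leq_maxl.
exists (maxn N0 M) => n f0; rewrite geq_max => /andP[N0n Mn] Jf0.
have key d : le (lead_ideal (J n) d) (lead_ideal (J (maxn N0 M)) d).
  move=> c Lc; have [dN|Nd] := ltnP d N0.
    by apply: (Lmono M); [exact: leq_maxr | apply: (MP d dN n)].
  apply: (Lmono N0); first exact: leq_maxl.
  apply: (LD _ N0) => //; apply: (N0P (maxn n d)).
    by apply: leq_trans N0n _; apply: leq_maxl.
  apply: (LD _ d); first exact: leq_maxr.
  by apply: (Lmono n) => //; apply: leq_maxl.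
elim: {f0}(size f0) {-2}f0 (leqnn (size f0)) Jf0 => [|d IH] f sf Jf.
  by move: sf; rewrite leqn0 size_poly_eq0 => /eqP->; apply: ideal0.
have [g [Jg sg Eg]] : lead_ideal (J (maxn N0 M)) d f`_d.
  by apply: key; exists f.
rewrite -(subrK g f); apply: idealD => //; apply: IH; last first.
  by apply: idealB => //; apply: (mono (maxn N0 M)); rewrite ?geq_max ?N0n.
apply/leq_sizeP => j; rewrite leq_eqVlt => /orP[/eqP<-|dj].
  by rewrite coefB Eg subrr.
by rewrite coefB !nth_default ?subrr //; apply: leq_trans dj.
Qed.

End HilbertBasis.

(** * Krull's principal ideal theorem *)

Section PrincipalIdeal.
Variable U : comNzRingType.
Variables p q : U -> Prop.
Hypothesis nU : noetherian U.
Hypotheses (pp : is_prime_ideal p) (pq : is_prime_ideal q).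

Implicit Types (J L N X Y : U -> Prop).

(* Ideals of the local ring of U/p at q, as ideals of U. *)
Definition sid N :=
  [/\ is_ideal N, le p N & forall u x, ~ q u -> N (u * x) -> N x].

Definition sat J : U -> Prop :=
  fun x => exists u, ~ q u /\ exists y z, [/\ J y, p z & u * x = y + z].

Lemma sat_ideal J : is_ideal J -> is_ideal (sat J).
Proof.
have ip := prime_idealW pp.
move=> iJ; split.
- exists 1; split; first exact: prime1.
  by exists 0, 0; split; rewrite ?mulr0 ?addr0 //; apply: ideal0.
- move=> x x' [u [qu [y [z [Jy pz E]]]]] [u' [qu' [y' [z' [Jy' pz' E']]]]].
  exists (u * u'); split; first by move/(primeM pq) => [].
  exists (u' * y + u * y'), (u' * z + u * z'); split.
  + by apply: idealD => //; apply: idealM.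
  + by apply: idealD => //; apply: idealM.
  by transitivity (u' * (u * x) + u * (u' * x')); [ring | rewrite E E'; ring].
- move=> a x [u [qu [y [z [Jy pz E]]]]]; exists u; split=> //.
  exists (a * y), (a * z); split; [exact: idealM|exact: idealM|].
  by rewrite mulrCA E; ring.
Qed.

Lemma le_sat J : le J (sat J).
Proof.
move=> x Jx; exists 1; split; first exact: prime1.
exists x, 0; split; rewrite ?mul1r ?addr0 //.
by apply: ideal0; apply: prime_idealW.
Qed.

Lemma sat_sid J : is_ideal J -> sid (sat J).
Proof.
move=> iJ; split; first exact: sat_ideal.
  move=> x px; exists 1; split; first exact: prime1.
  by exists 0, x; split; rewrite ?mul1r ?add0r //; apply: ideal0.
move=> u x qu [v [qv [y [z [Jy pz E]]]]]; exists (v * u).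
split; first by move/(primeM pq) => [].
by exists y, z; split=> //; rewrite -mulrA.
Qed.

Lemma sat_min J N : sid N -> le J N -> le (sat J) N.
Proof.
move=> [iN pN sN] JN x [u [qu [y [z [Jy pz E]]]]]; apply: (sN u) => //.
by rewrite E; apply: idealD; [ | apply: JN | apply: pN].
Qed.

Lemma sid_capI N L : sid N -> sid L -> sid (fun x => N x /\ L x).
Proof.
move=> [[N0 ND NM] pN sN] [[L0 LD LM] pL sL]; split.
- split=> // [x y [? ?] [? ?]|a x [? ?]]; split; by [apply: ND|apply: LD|apply: NM|apply: LM].
- by move=> x px; split; [apply: pN | apply: pL].
- by move=> u x qu [? ?]; split; [apply: (sN u) | apply: (sL u)].
Qed.

Local Notation chn := (chain sid).

(** Read: in the local ring of U/p at q, the length of [Y] over [X] is at least [n]. Lengths enter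
    only through such bounds and their negations, so no length function is defined. *)
Definition ch X Y n := exists N, chn X n N /\ le N Y.

Lemma ch_pred X Y n : ch X Y n.+1 -> ch X Y n.
Proof.
move=> [N [cN NY]]; inversion cN as [|k M M' cM sM MN nNM]; subst.
by exists M; split=> // x /MN; apply: NY.
Qed.
Lemma ch_leq X Y n m : (m <= n)%N -> ch X Y n -> ch X Y m.
Proof.
move=> /subnK <-; elim: (n - m)%N => [|k IH] //; rewrite addSn => /ch_pred; exact: IH.
Qed.

(** Each member [N] of the chain is replaced by its intersection with [L] and by its saturated sum
    with [L]. By the modular law a strict step stays strict in one of the two, so the two new chains
    together have at least as many steps: length is subadditive along [L]. *)
Lemma chn_split X L n N : is_ideal X -> sid L -> le X L -> chn X n N ->
  exists m k M1 M2, [/\ (n <= m + k)%N, chn X m M1, le M1 (fun x => N x /\ L x),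
    chn L k M2 & le M2 (sat (idsum N L))].
Proof.
move=> iX sL XL; have [iL pL sL'] := sL.
elim=> [N' sN' XN'|k N' N'' cN' [m [j [M1 [M2 [nmj c1 M1N c2 M2N]]]]] sN'' N12 nN21].
  exists 0%N, 0%N, (fun x => N' x /\ L x), L; split=> //.
  - apply: chain0; first exact: sid_capI.
    by move=> x Xx; split; [apply: XN'|apply: XL].
  - by apply: chain0.
  - move=> x Lx; apply: le_sat; apply: idsumr => //.
    by case: sN'.
have sN' := chain_top cN'.
have iN' : is_ideal N' by case: sN'.
have iN'' : is_ideal N'' by case: sN''.
have sub1 : le M1 (fun x => N'' x /\ L x).
  by move=> x /M1N [/N12].
have sub2 : le (sat (idsum N' L)) (sat (idsum N'' L)).
  apply: sat_min; first by apply: sat_sid; apply: idsum_ideal.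
  move=> x h; apply: le_sat; case: h => y [z [/N12 ? ? ->]].
  by exists y, z.
have [E|nE] := EM (le (fun x => N'' x /\ L x) (fun x => N' x /\ L x)); last first.
  exists m.+1, j, (fun x => N'' x /\ L x), M2; split=> //.
  - apply: (chainS c1) => //; first exact: sid_capI.
    by move=> h; apply: nE => x /h /M1N.
  - by move=> x /M2N /sub2.
exists m, j.+1, M1, (sat (idsum N'' L)); split=> //; first by rewrite addnS.
apply: (chainS c2); first by apply: sat_sid; apply: idsum_ideal.
  by move=> x /M2N /sub2.
move=> h; apply: nN21 => x N''x.
have [u [qu [y [z [[n1 [l [N'n Ll ->]] pz Eu]]]]]] : sat (idsum N' L) x.
  by apply/M2N/h/le_sat/idsuml.
have [_ pN' satN'] := sN'; apply: (satN' u) => //.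
rewrite Eu; have : N' (l + z).
  apply: (proj1 (E _ _)); split; last by apply: idealD => //; apply: pL.
  have -> : l + z = u * x - n1 by rewrite Eu; ring.
  by apply: idealB => //; [apply: idealM | apply: N12].
by rewrite -addrA; apply: idealD.
Qed.

Lemma ch_split X L Y n : is_ideal X -> sid L -> le X L -> sid Y -> le L Y ->
  ch X Y n -> exists m k, [/\ (n <= m + k)%N, ch X L m & ch L Y k].
Proof.
move=> iX sL XL sY LY [N [cN NY]].
have [m [k [M1 [M2 [nmk c1 h1 c2 h2]]]]] := chn_split iX sL XL cN.
exists m, k; split=> //; first by exists M1; split=> // x /h1 [].
exists M2; split=> // x /h2; apply: (sat_min sY).
by apply: idsum_min => //; case: sY.
Qed.

Lemma ch_concat X L Y m k : ch X L m -> ch L Y k -> ch X Y (m + k).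
Proof.
move=> [M [cM ML]] [N [cN NY]]; exists N; split=> //.
elim: cN {NY} => [N' sN' LN'|n N1 N2 _ c sN2 N12 nN21].
  by rewrite addn0; apply: chain_raise cM _ _ => // x /ML; apply: LN'.
by rewrite addnS; apply: chainS c _ _ _.
Qed.

Lemma ch_max X Y l : ch X Y 0 -> ~ ch X Y l ->
  exists h, ch X Y h /\ ~ ch X Y h.+1.
Proof.
move=> c0; elim: l => // l IH nl; have [cl|] := EM (ch X Y l); last exact: IH.
by exists l.
Qed.

Definition top : U -> Prop := fun _ => True.
Lemma top_sid : sid top. Proof. by split. Qed.

Variable a : U.
Hypotheses (qa : q a).
Hypothesis mini : forall Q, is_prime_ideal Q -> le p Q -> Q a -> le Q q -> le q Q.

(** A maximal one among the ideals ([L] : y) with y outside [L] is prime. It contains p and a and,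
    [L] being saturated, lies in q; by minimality it is q. *)
Lemma socle L : sid L -> L a -> ~ L 1 -> exists y, ~ L y /\ forall x, q x -> L (y * x).
Proof.
move=> sL La nL; have [iL pL satL] := sL.
pose Phi K := exists y, ~ L y /\ K = (fun x => L (y * x)).
have [||K [[y [nLy ->]] Kmax]] := @noeth_max U Phi L nU.
- exists 1; split=> //; apply/predeqP => x; by rewrite mul1r.
- by move=> _ [y [_ ->]]; apply: colon_ideal.
exists y; split=> //; apply: mini.
- split; [exact: colon_ideal | by rewrite mulr1 |].
  move=> u v Luv; have [|nu] := EM (L (y * u)); [by left|right].
  apply: (Kmax (fun x => L (y * u * x))); first by exists (y * u).
    by move=> x; rewrite mulrAC; apply: idealMr.
  by rewrite -mulrA.
- by move=> x px; apply: idealM => //; apply: pL.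
- exact: idealM.
- by move=> x; rewrite mulrC => Lxy; apply: contrapT => qx; apply: nLy; apply: (satL x).
Qed.

(** Take [L] maximal among the saturated ideals of finite length over [X]. Were it proper, a socle
    element would enlarge it by a simple quotient, which keeps the length finite. *)
Lemma finite_length X : is_ideal X -> X a -> exists l, ~ ch X top l.
Proof.
move=> iX Xa.
pose Phi L := [/\ sid L, le X L & exists l, ~ ch X L l].
have [||L [[sL XL [l Hl]] Lmax]] := @noeth_max U Phi (sat X) nU.
- split; [exact: sat_sid | exact: le_sat |].
  exists 1%N => -[N [cN NX]]; inversion cN as [|k M M' cM sM MN nNM]; subst.
  apply: nNM => x /NX; apply: sat_min; first exact: chain_top cM.
  exact: chain_le cM.
- by move=> L [[]].
have [L1|nL1] := EM (L 1).
  exists l => c; apply: Hl; case: c => N [cN _]; exists N; split=> // x _.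
  by rewrite -[x]mulr1; apply: idealM => //; case: sL.
exfalso; have [iL pL satL] := sL.
have [y [nLy Hy]] := socle sL (XL _ Xa) nL1.
apply: nLy; pose L' := sat (idadd L y).
have iL' := idadd_ideal y iL.
have sL' : sid L' by apply: sat_sid.
have LL' : le L L' by move=> x Lx; apply: le_sat; apply: le_idadd.
apply: (Lmax L') => //; last by apply: le_sat; apply: idadd_in.
split=> //; first by move=> x /XL /LL'.
exists (l + 2)%N => c.
have [m [k [lmk c1 c2]]] := ch_split iX sL XL sL' LL' c.
(* Simplicity of the enlargement: an element of [N1] outside [N0] is, up to a factor outside q,
   congruent to c'y with c' outside q. So [N1] contains y, hence all of [L'], and [N2] cannot be
   strictly larger. *)
have k2 : ~ (2 <= k)%N.
  move=> k2; case: (ch_leq k2 c2) => N2 [cN2 N2L'].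
  inversion cN2 as [|? N1 ? cN1 sN2 N12 nN21]; subst.
  inversion cN1 as [|? N0 ? cN0 sN1 N01 nN10]; subst.
  have sN0 := chain_top cN0; have LN0 := chain_le cN0.
  have [iN0 pN0 satN0] := sN0; have [iN1 pN1 satN1] := sN1.
  apply: nN10 => x N1x; apply: contrapT => nN0x; apply: nN21.
  have [u [qu [t [z [[j [c' [Lj Et]]] pz Eu]]]]] := N2L' _ (N12 _ N1x).
  have N1y : N1 y.
    apply: (satN1 c').
      move=> qc'; apply: nN0x; apply: (satN0 u) => //; rewrite Eu Et.
      apply: idealD => //; last exact: pN0.
      by apply: idealD => //; apply: LN0 => //; rewrite mulrC; apply: Hy.
    have -> : c' * y = u * x - j - z by rewrite Eu Et; ring.
    apply: idealB => //; last exact: pN1.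
    by apply: idealB => //; [apply: idealM | apply: N01; apply: LN0].
  move=> w /N2L'; apply: sat_min => //; apply: idadd_min => //.
  by move=> v /LN0 /N01.
apply: Hl; apply: ch_leq c1.
move: lmk k2; case: k {c2} => [|[|k]] //; rewrite ?addn0 ?addn1 ?addn2 //.
- by move=> h _; apply: leq_trans h; apply: leqW.
- by rewrite ltnS => h _; apply: ltnW.
Qed.

(** Passing from [N] to ([N] : a) keeps inclusions strict below (p, a), since up to a factor outside
    q every element there is a multiple of a modulo p. So [Y] over [X] is no longer than the whole
    ring over [L]. *)
Lemma ch_colon X Y L m : is_ideal L -> (forall x, L x -> X (a * x)) -> (forall x, Y x -> sat (idadd p a) x) ->
  ch X Y m -> ch L top m.
Proof.
move=> iL LX YA [N [cN NY]]; pose col N := fun x : U => N (a * x) : Prop.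
have colS N' : sid N' -> sid (col N').
  move=> [iN pN sN]; split; first exact: colon_ideal.
  - by move=> x px; apply: idealM => //; apply: pN.
  - by move=> u x qu; rewrite /col mulrCA; apply: sN.
exists (col N); split=> //.
elim: cN NY => [N' sN' XN'|n N1 N2 c IH sN2 N12 nN21] NY.
  by apply: chain0; [apply: colS | move=> x /LX /XN'].
apply: chainS (IH _) (colS _ sN2) _ _; first by move=> x /N12 /NY.
  by move=> x; apply: N12.
have [iN1 pN1 sN1] := chain_top c; have [iN2 pN2 _] := sN2.
move=> h; apply: nN21 => y N2y.
have [u [qu [y1 [z [[j [c' [pj ->]]] pz E]]]]] := YA _ (NY _ N2y).
apply: (sN1 u) => //; rewrite E; apply: idealD => //; last exact: pN1.
apply: idealD => //; first exact: pN1.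
rewrite mulrC; apply: h; rewrite /col.
have -> : a * c' = u * y - j - z by rewrite E; ring.
apply: idealB => //; last exact: pN2.
by apply: idealB => //; [apply: idealM | apply: pN2].
Qed.

Lemma ch_low X X' Y n : (forall N, sid N -> le X N -> le X' N) -> ch X Y n -> ch X' Y n.
Proof. by move=> h [N [cN NY]]; exists N; split=> //; apply: chain_low cN. Qed.

Variable b : U.
Hypothesis npb : ~ p b.
Hypothesis stab : forall s, sat (idadd p b) (a * a * s) -> sat (idadd p b) (a * s).

Let ip := prime_idealW pp.
Let pa := idadd p a.
Let pab := idadd pa b.
Let aJ := idadd (idadd p (a * a)) (a * b).
Let pa2b := idadd (idadd p (a * a)) b.
Let ipa : is_ideal pa. Proof. exact: idadd_ideal. Qed.
Let ipab : is_ideal pab. Proof. exact: idadd_ideal. Qed.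
Let iaJ : is_ideal aJ. Proof. by do 2 apply: idadd_ideal. Qed.
Let ipa2b : is_ideal pa2b. Proof. by do 2 apply: idadd_ideal. Qed.

(** The length of the ring over a(a, b) is computed through (a, b) and through (a). Multiplication
    by a bounds the length of (a) over a(a, b) by that of the ring over (a, b); after subtracting,
    (a, b) over a(a, b) is no longer than the ring over (a). *)
Lemma length_ab l m : ~ ch pa top l.+1 -> ch aJ (sat pab) m -> (m <= l)%N.
Proof.
move=> Hl cm.
have [k Hk] : exists k, ~ ch pab top k.
  by apply: finite_length => //; apply: le_idadd; apply: idadd_in.
have c0 : ch pab top 0.
  by exists top; split=> //; apply: chain0 => //; apply: top_sid.
have [h [ch1 nch]] := ch_max c0 Hk.
have : ch aJ top (m + h).
  apply: ch_concat cm _; apply: ch_low ch1 => N sN XN; exact: sat_min.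
have sA1 : sid (sat pa) by apply: sat_sid.
have aJA1 : le aJ (sat pa).
  move=> x aJx; apply: le_sat; move: x aJx; apply: idadd_min => //.
    apply: idadd_min => //; first exact: le_idadd.
    by apply: idealM => //; apply: idadd_in.
  by apply: idealMr => //; apply: idadd_in.
move/(ch_split iaJ sA1 aJA1 top_sid (fun _ _ => I)) => [m1 [k1 [le1 c1 c2]]].
have m1h : (m1 <= h)%N.
  rewrite leqNgt; apply/negP => hm; apply: nch; apply: (ch_leq hm).
  apply: ch_colon c1 => // x [y [c [[j [c' [pj ->]]] ->]]].
  exists (a * j + (a * a) * c'), c; split; last by ring.
  by exists (a * j), c'; split; [apply: idealM | ring].
have k1l : (k1 <= l)%N.
  rewrite leqNgt; apply/negP => hk; apply: Hl; apply: (ch_leq hk).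
  by apply: ch_low c2 => N _ h' x pax; apply: h'; apply: le_sat.
by rewrite -(leq_add2r h) (leq_trans le1) // addnC leq_add.
Qed.

Let bN (N : U -> Prop) : U -> Prop := fun x => exists n, N n /\ x = b * n.
Let bN_ideal N : is_ideal N -> is_ideal (bN N).
Proof.
move=> iN; split.
- by exists 0; split; [apply: ideal0 | ring].
- move=> _ _ [x [? ->]] [y [? ->]]; exists (x + y).
  by split; [apply: idealD | ring].
- by move=> c _ [x [? ->]]; exists (c * x); split; [apply: idealM | ring].
Qed.

(** Cancellation of b, up to factors outside q: from br = bn + sa^2 + wab it follows that sa^2 lies
    in (b), hence sa does by [stab]; dividing by b modulo p puts r in N + (a) = N. *)
Let bNK N r : sid N -> N a -> sat (idsum (bN N) aJ) (b * r) -> N r.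
Proof.
move=> [iN pN sN] Na.
move=> [u [qu [_ [z [[_ [_ [[n [Nn ->]] [_ [w [[j [s [pj ->]]] ->]]] ->]]] pz E]]]]].
have /stab : sat (idadd p b) (a * a * s).
  apply: le_sat; exists (- (j + z)), (u * r - n - a * w); split.
    by apply: idealN => //; apply: idealD.
  have -> : a * a * s = u * (b * r) - b * n - w * (a * b) - j - z by rewrite E; ring.
  by ring.
move=> [v [qv [_ [z' [[j' [y [pj' ->]]] pz' E']]]]].
apply: (sN (v * u)); first by move/(primeM pq) => [].
have pD : p (v * (u * r - n - a * w) - a * y).
  apply: (primeMl pp npb).
  have -> : b * (v * (u * r - n - a * w) - a * y) =
     v * (u * (b * r)) - v * b * n - v * b * a * w - a * b * y by ring.
  have -> : a * b * y = a * (v * (a * s)) - a * j' - a * z' by rewrite E'; ring.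
  rewrite E.
  have -> : v * (b * n + (j + s * (a * a) + w * (a * b)) + z) - v * b * n -
    v * b * a * w - (a * (v * (a * s)) - a * j' - a * z') =
    v * j + v * z + a * j' + a * z' by ring.
  by do ![apply: idealD => //]; apply: idealM.
have -> : v * u * r = (v * (u * r - n - a * w) - a * y) + v * n + (v * w + y) * a by ring.
by apply: idealD; rewrite ?idealM //; [apply: idealD => //; [apply: pN|apply: idealM]|apply: idealM].
Qed.

(** Multiplication by b carries a chain above (a) to one between (a^2, ab) and (a^2, b), strict by
    [bNK]. Against the bound of [length_ab] this leaves no room between (a^2, b) and (a, b). *)
Lemma length_mulb l : ch pa top l -> ch aJ (sat pa2b) l.
Proof.
move=> [N [cN _]].
have sid_bN N' : is_ideal N' -> sid (sat (idsum (bN N') aJ)).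
  by move=> ?; apply: sat_sid; apply: idsum_ideal => //; apply: bN_ideal.
exists (sat (idsum (bN N) aJ)); split; last first.
  have iN : is_ideal N by case: (chain_top cN).
  apply: sat_min; first exact: sat_sid.
  apply: idsum_min.
  - exact: sat_ideal.
  - by move=> _ [n [_ ->]]; apply: le_sat; apply: idealMr => //; apply: idadd_in; apply: idadd_ideal.
  - move=> x aJx; apply: le_sat; move: x aJx; apply: idadd_min => //.
      exact: le_idadd.
    by apply: idealM => //; apply: idadd_in; apply: idadd_ideal.
elim: cN => [N' sN' XN'|n N1 N2 c IH sN2 N12 nN21].
  have iN : is_ideal N' by case: sN'.
  apply: chain0; first exact: sid_bN.
  by move=> x aJx; apply: le_sat; apply: idsumr => //; apply: bN_ideal.
have iN2 : is_ideal N2 by case: sN2.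
have N1a : N1 a by apply: (chain_le c); apply: idadd_in.
apply: (chainS IH); first exact: sid_bN.
  apply: sat_min; first exact: sid_bN.
  move=> _ [_ [z [[n1 [N1n ->]] aJz ->]]]; apply: le_sat; exists (b * n1), z.
  by split=> //; exists n1; split=> //; apply: N12.
move=> h; apply: nN21 => r N2r; apply: (bNK (chain_top c) N1a); apply: h.
by apply: le_sat; apply: idsuml => //; exists r.
Qed.

Lemma a_in_sat : sat pa2b a.
Proof.
apply: contrapT => na.
have [k Hk] : exists k, ~ ch pa top k by apply: finite_length => //; apply: idadd_in.
have c0 : ch pa top 0.
  by exists top; split=> //; apply: chain0 => //; apply: top_sid.
have [l [cl ncl]] := ch_max c0 Hk.
have [N [cN NY]] := length_mulb cl.
suff : (l.+1 <= l)%N by rewrite ltnn.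
apply: (length_ab ncl); exists (sat pab); split=> //.
have pa2b_ab : le pa2b pab.
  apply: idadd_min => //; last exact: idadd_in.
  apply: idadd_min => //; first by move=> x px; do 2 apply: le_idadd.
  by apply: idealM => //; apply: le_idadd; apply: idadd_in.
apply: (chainS cN); first exact: sat_sid.
  by move=> x /NY; apply: sat_min; [apply: sat_sid | move=> y /pa2b_ab; apply: le_sat].
move=> h; apply: na; apply: NY; apply: h; apply: le_sat; apply: le_idadd.
exact: idadd_in.
Qed.

(** Since a lies locally in (a^2, b), some (u - ra)a lies in (b) + p with u outside q; as a is in q,
    the first factor is outside q and hence outside [P]. *)
Lemma caruth P : is_prime_ideal P -> le p P -> le P q -> P b -> P a.
Proof.
move=> pP pP' Pq Pb.
have [u [qu [_ [z [[_ [w [[j [r [pj ->]]] ->]]] pz E]]]]] := a_in_sat.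
have : P ((u - r * a) * a).
  have -> : (u - r * a) * a = w * b + j + z by rewrite mulrBl E; ring.
  have iP := prime_idealW pP.
  by do ![apply: idealD => //]; [apply: idealM|apply: pP'|apply: pP'].
move/(primeM pP) => [/Pq qx|//]; exfalso; apply: qu.
rewrite -(subrK (r * a) u); apply: idealD => //; first exact: prime_idealW.
by apply: idealM => //; apply: prime_idealW.
Qed.

End PrincipalIdeal.

Theorem krull_pit (U : comNzRingType) (p P q : U -> Prop) (a : U) :
  noetherian U -> is_prime_ideal p -> is_prime_ideal P -> is_prime_ideal q ->
  le p P -> le P q -> q a -> ~ P a ->
  (forall Q, is_prime_ideal Q -> le p Q -> Q a -> le Q q -> le q Q) ->
  le P p.
Proof.
move=> nU pp pP pq pP' Pq qa nPa mini b Pb; apply: contrapT => npb.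
have ip := prime_idealW pp.
have isb := sat_ideal pp pq (idadd_ideal b ip).
pose E n : U -> Prop := fun s => sat p q (idadd p b) (a ^+ n * s).
have Eid n : is_ideal (E n) by exact: colon_ideal.
have Einc n x : E n x -> E n.+1 x by rewrite /E exprS -mulrA => ?; apply: idealM.
(* Stability of the colon ideals of the powers of a from [N] on makes [stab] true for a^(N+1). The
   exponent is [N.+1] and not [N] because the power must lie in q even when [N] is 0. *)
have [N NP] := nU E Eid Einc.
apply/nPa/(primeX (n := N.+1) pP).
apply: (@caruth U p q nU pp pq _ _ _ b npb _ P pP pP' Pq Pb).
- by rewrite exprS; apply: idealMr => //; apply: prime_idealW.
- by move=> Q pQ pQ' /(primeX pQ); apply: mini.
move=> s; rewrite -exprD => h.
by apply/Einc/(NP (N.+1 + N.+1)%N) => //; rewrite addSn ltnW // ltnS leq_addr.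
Qed.

(** * Chains of primes in polynomial rings *)

Notation pch := (chain (@is_prime_ideal _)).

Section Chains.
Variable U : comNzRingType.
Implicit Types (Z Q : U -> Prop).

Lemma pch_pred Z n Q : pch Z n.+1 Q -> pch Z n Q.
Proof.
move=> c; have : forall m, n.+1 = m.+1 -> pch Z m Q; last exact.
elim: c => // k Q1 Q2 c IH pQ2 le1 nle m [<-].
case: k c IH => [|k] c IH; last by apply: chainS (IH _ erefl) _ _ _.
by apply: chain0 => // x /(chain_le c) /le1.
Qed.
Lemma pch_leq Z n m Q : (m <= n)%N -> pch Z n Q -> pch Z m Q.
Proof.
move=> /subnK <-; elim: (n - m)%N => [|k IH] //; rewrite addSn => /pch_pred; exact: IH.
Qed.
Lemma pch_eq Z n Q Q' : le Q Q' -> le Q' Q -> pch Z n Q -> pch Z n Q'.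
Proof. by move=> h1 h2; have -> : Q = Q' by apply/predeqP => x; split; [apply: h1|apply: h2]. Qed.

Lemma pch_prepend Z Z' n Q P : pch Z n Q -> is_prime_ideal P -> le Z' P -> le P Z ->
  ~ le Z P -> pch Z' n.+1 Q.
Proof.
move=> c pP Z'P PZ nZP; elim: c => [Q' pQ' ZQ'|k Q1 Q2 _ IH pQ2 le1 nle1].
  apply: (chainS (N := P)) => //; first exact: chain0.
    by move=> x /PZ /ZQ'.
  by move=> h; apply: nZP => x /ZQ' /h.
exact: chainS IH _ _ _.
Qed.

Lemma pch_chain Z n Q : pch Z n Q -> exists P : nat -> U -> Prop,
  prime_chain n P /\ P n = Q.
Proof.
elim=> [Q' pQ' _|k Q1 Q2 c [P [[P1 P2] Pk]] pQ2 le1 nle1].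
  by exists (fun _ => Q'); split=> //; split.
exists (fun i => if (i <= k)%N then P i else Q2); split; last by rewrite ltnn.
split=> i.
  by case: (leqP i k) => [ik _|ki _] //; apply: P1.
rewrite ltnS => ik0; have : (i == k) || (i < k)%N by rewrite -leq_eqVlt.
case/orP=> [/eqP->|ik]; last by rewrite (ltnW ik) ik; apply: P2.
rewrite leqnn ltnn Pk; split=> //; apply: contrapT => h; apply: nle1 => x Q2x.
by apply: contrapT => nQ; apply: h; exists x.
Qed.
End Chains.

Lemma preim_ideal (U V : comNzRingType) (f : {rmorphism U -> V}) (J : V -> Prop) :
  is_ideal J -> is_ideal (fun x => J (f x)).
Proof.
move=> iJ; split.
- by rewrite rmorph0; apply: ideal0.
- by move=> x y ? ?; rewrite rmorphD; apply: idealD.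
- by move=> a x ?; rewrite rmorphM; apply: idealM.
Qed.
Lemma preim_prime (U V : comNzRingType) (f : {rmorphism U -> V}) (Q : V -> Prop) :
  is_prime_ideal Q -> is_prime_ideal (fun x => Q (f x)).
Proof.
move=> [iQ n1 QM]; split; first exact: preim_ideal.
  by rewrite rmorph1.
by move=> x y; rewrite rmorphM => /QM.
Qed.

Section PolyPrimes.
Variable R : comNzRingType.
Implicit Types (p : R -> Prop) (Q : {poly R} -> Prop).

Definition ext p : {poly R} -> Prop := fun f => forall i, p f`_i.
Definition contr Q : R -> Prop := fun c => Q c%:P.

Lemma ext_ideal p : is_ideal p -> is_ideal (ext p).
Proof.
move=> ip; split.
- by move=> i; rewrite coef0; apply: ideal0.
- by move=> f g pf pg i; rewrite coefD; apply: idealD.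
- by move=> f g pg i; rewrite coefM; apply: ideal_sum => // j _; apply: idealM.
Qed.

Lemma ext_prime p : is_prime_ideal p -> is_prime_ideal (ext p).
Proof.
move=> pp; have ip := prime_idealW pp; split; first exact: ext_ideal.
  by move=> /(_ 0%N); rewrite coef1 /=; apply: prime1.
move=> f g pfg; apply: contrapT => /not_orP [nf ng].
have low h : ~ ext p h -> exists i, ~ p h`_i /\ forall j, (j < i)%N -> p h`_j.
  move=> nh; have [i ni] : exists i, ~ p h`_i by apply/existsNP.
  have ex : exists i, `[< ~ p h`_i >] by exists i; apply/asboolP.
  exists (ex_minn ex); case: ex_minnP => m /asboolP nm mmin; split=> // j jm.
  by apply: contrapT => nj; move: jm; rewrite ltnNge mmin //; apply/asboolP.
have [m [nm fm]] := low _ nf; have [n [nn gn]] := low _ ng.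
have : ~ p (f`_m * g`_n) by move/(primeM pp) => [].
apply; have := pfg (m + n)%N; rewrite coefM.
have mlt : (m < (m + n).+1)%N by rewrite ltnS leq_addr.
rewrite (bigD1 (Ordinal mlt)) //= addKn => h.
rewrite -[X in p X](addrK (\sum_(i < (m + n).+1 | i != Ordinal mlt) f`_i * g`_(m + n - i))).
apply: idealB => //; apply: ideal_sum => // i.
rewrite -val_eqE /= neq_ltn => /orP[im|mi].
  by apply: idealMr => //; apply: fm.
apply: idealM => //; apply: gn.
by rewrite ltn_subLR ?ltn_add2r // -ltnS.
Qed.

Lemma contr_prime Q : is_prime_ideal Q -> is_prime_ideal (contr Q).
Proof. exact: preim_prime. Qed.

Lemma ext_contr Q : is_ideal Q -> le (ext (contr Q)) Q.
Proof.
move=> iQ f h; rewrite -[f]coefK poly_def; apply: ideal_sum => // i _.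
by rewrite -mul_polyC; apply: idealMr => //; apply: h.
Qed.
Lemma contr_ext p : le (contr (ext p)) p.
Proof. by move=> c /(_ 0%N); rewrite coefC. Qed.
Lemma ext_const p c : is_ideal p -> p c -> ext p c%:P.
Proof. by move=> ip pc i; rewrite coefC; case: eqP => // _; apply: ideal0. Qed.

Lemma pseudo_div (f g : {poly R}) : g != 0 -> exists k h r,
  [/\ (lead_coef g ^+ k)%:P * f = h * g + r, (size r < size g)%N & (size h <= size f)%N].
Proof.
move=> g0; exists (Pdiv.Ring.rscalp f g), (Pdiv.Ring.rdivp f g), (Pdiv.Ring.rmodp f g).
split; first by rewrite mul_polyC Pdiv.ComRing.rdivp_eq.
  exact: Pdiv.Ring.ltn_rmodpN0.
exact: Pdiv.Ring.leq_rdivp.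
Qed.

End PolyPrimes.

Section PolyHeight.
Variable R : comNzRingType.
Implicit Types (p : R -> Prop) (Q : {poly R} -> Prop).

Lemma min_size (P : {poly R} -> Prop) : (exists f, P f) ->
  exists f, P f /\ forall g, P g -> (size f <= size g)%N.
Proof.
move=> [f Pf]; have ex : exists i, `[< exists f, P f /\ size f = i >].
  by exists (size f); apply/asboolP; exists f.
case: (ex_minnP ex) => m /asboolP [g [Pg <-]] gmin; exists g; split=> // h Ph.
by apply: gmin; apply/asboolP; exists h.
Qed.

Lemma size_trim (f : {poly R}) : f != 0 ->
  (size (f - (lead_coef f)%:P * 'X^((size f).-1))%R < size f)%N.
Proof.
move=> f0; have sf : (0 < size f)%N by rewrite size_poly_gt0.
rewrite -[X in (_ < X)%N](prednK sf) ltnS; apply/leq_sizeP => j.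
rewrite leq_eqVlt => /orP[/eqP<-|lej]; rewrite coefB coefCM coefXn ?eqxx.
  by rewrite mulr1 -lead_coefE subrr.
by rewrite nth_default ?(gtn_eqF lej) ?mulr0 ?subrr // -(prednK sf).
Qed.

(** The fibre over a prime is a polynomial ring in one variable over a field, hence of dimension
    one. This is carried out by pseudo-division: [f] of least size in [Q'] outside the extended
    ideal and [g] of least size in [Q] outside [Q'] act as generators of the two primes. *)
Lemma fiber_ext Q Q' : is_prime_ideal Q -> is_prime_ideal Q' ->
  le Q' Q -> ~ le Q Q' -> le (contr Q) (contr Q') -> le Q' (ext (contr Q')).
Proof.
move=> pQ pQ' Q'Q nQQ' cQQ'; have iQ := prime_idealW pQ; have iQ' := prime_idealW pQ'.
have pp := contr_prime pQ'; have pext := ext_prime pp.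
move=> f0 Qf0; apply: contrapT => nf0.
have [f [[Q'f nf] fmin]] : exists f, (Q' f /\ ~ ext (contr Q') f) /\
    forall g, Q' g /\ ~ ext (contr Q') g -> (size f <= size g)%N.
  by apply: min_size; exists f0.
have [g [[Qg ng] gmin]] : exists f, (Q f /\ ~ Q' f) /\
    forall g, Q g /\ ~ Q' g -> (size f <= size g)%N.
  by apply: min_size; apply: contrapT => h; apply: nQQ' => x Qx;
     apply: contrapT => nx; apply: h; exists x.
have f_neq0 : f != 0.
  by apply/eqP => E; apply: nf; rewrite E; exact: (ideal0 (prime_idealW pext)).
have g_neq0 : g != 0 by apply/eqP => E; apply: ng; rewrite E; apply: ideal0.
have lcf : ~ contr Q' (lead_coef f).
  move=> lc; have := size_trim f_neq0; rewrite ltnNge => /negP; apply; apply: fmin.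
  split; first by apply: idealB => //; exact: (idealMr _ iQ' lc).
  move=> h; apply: nf; rewrite -(subrK ((lead_coef f)%:P * 'X^((size f).-1)) f).
  apply: (idealD (prime_idealW pext)) => //.
  exact: (idealMr _ (prime_idealW pext) (ext_const (prime_idealW pp) lc)).
have lcg : ~ contr Q' (lead_coef g).
  move=> lc; have := size_trim g_neq0; rewrite ltnNge => /negP; apply; apply: gmin.
  split; first by apply: idealB => //; apply: Q'Q; exact: (idealMr _ iQ' lc).
  move=> h; apply: ng; rewrite -(subrK ((lead_coef g)%:P * 'X^((size g).-1)) g).
  by apply: idealD => //; exact: (idealMr _ iQ' lc).
have gf : (size g < size f)%N.
  have [k [h [r [E sr _]]]] := pseudo_div g f_neq0.
  apply: leq_ltn_trans sr; apply: gmin.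
  have Er : r = (lead_coef f ^+ k)%:P * g - h * f by rewrite E; ring.
  split.
    rewrite Er; apply: (idealB iQ); first exact: (idealM _ iQ Qg).
    exact: (idealM _ iQ (Q'Q _ Q'f)).
  move=> Q'r; have : Q' ((lead_coef f ^+ k)%:P * g).
    by rewrite E; apply: (idealD iQ') => //; apply: idealM.
  by move/(primeM pQ') => [] //; rewrite polyC_exp => /(primeX pQ').
have g2 : (2 <= size g)%N.
  rewrite ltnNge; apply/negP => /size1_polyC Eg; apply: ng; rewrite Eg.
  by apply: cQQ'; rewrite /contr -Eg.
have [k [h [r [E sr sh]]]] := pseudo_div f g_neq0.
have Er : r = (lead_coef g ^+ k)%:P * f - h * g by rewrite E; ring.
have Q'r : Q' r.
  apply: contrapT => nr; suff : (size g <= size r)%N by rewrite leqNgt sr.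
  apply: gmin; split=> //; rewrite Er; apply: idealB => //; last exact: idealM.
  by apply: idealM => //; apply: Q'Q.
have Q'h : Q' h.
  have : Q' (g * h).
    have -> : g * h = (lead_coef g ^+ k)%:P * f - r by rewrite Er; ring.
    by apply: idealB => //; apply: idealM.
  by move/(primeM pQ') => [].
have small x : Q' x -> (size x < size f)%N -> ext (contr Q') x.
  by move=> Q'x sx; apply: contrapT => nx; have := fmin _ (conj Q'x nx); rewrite leqNgt sx.
have eh : ext (contr Q') h.
  have [sf|fs] := ltnP (size h) (size f); first exact: small.
  have h0 : h != 0 by rewrite -size_poly_gt0 (leq_trans _ fs) // size_poly_gt0.
  (* [h] is as long as [f] and [g] is not constant, so hg can stay within the size of [f] only if
     the leading coefficients multiply to 0; [R] need not be a domain here. *)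
  have lch : contr Q' (lead_coef h).
    apply: (primeMl pp lcg); rewrite mulrC.
    have [->|/size_proper_mul] := eqVneq (lead_coef h * lead_coef g) 0.
      exact: (ideal0 (prime_idealW pp)).
    have -> : h * g = lead_coef g ^+ k *: f - r by rewrite -mul_polyC E addrK.
    have : (size (lead_coef g ^+ k *: f - r)%R <= size f)%N.
      apply: leq_trans (size_polyD _ _) _; rewrite size_polyN geq_max size_scale_leq.
      by rewrite (leq_trans (ltnW sr)) // ltnW.
    lia.
  rewrite -(subrK ((lead_coef h)%:P * 'X^((size h).-1)) h).
  have hX : ext (contr Q') ((lead_coef h)%:P * 'X^((size h).-1)).
    exact: (idealMr _ (prime_idealW pext) (ext_const (prime_idealW pp) lch)).
  apply: (idealD (prime_idealW pext)) => //; apply: small.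
    by apply: idealB => //; apply: (ext_contr iQ').
  exact: leq_trans (size_trim h0) sh.
have er : ext (contr Q') r by apply: small => //; apply: ltn_trans gf.
have : ext (contr Q') ((lead_coef g ^+ k)%:P * f).
  by rewrite E; apply: (idealD (prime_idealW pext)) er; exact: (idealMr _ (prime_idealW pext) eh).
move/(primeM pext) => [/(_ 0%N)|//]; rewrite coefC /=.
by move/(primeX pp)/lcg.
Qed.

(** If no prime lay strictly between [p'] and [p], the extension of [p] would be minimal over that
    of [p'] together with a constant [c] of [p] outside [p']; the principal ideal theorem would then
    leave no room for [Q']. *)
Lemma strong_S_property p p' Q' : noetherian {poly R} ->
  is_prime_ideal p -> is_prime_ideal p' -> is_prime_ideal Q' ->
  le p' p -> ~ le p p' -> le (ext p') Q' -> le Q' (ext p) -> ~ le Q' (ext p') ->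
  le (contr Q') p' ->
  exists p2, [/\ is_prime_ideal p2, le p' p2, ~ le p2 p', le p2 p & ~ le p p2].
Proof.
move=> nR pp pp' pQ' p'p npp' e1 e2 ne3 cQ'; apply: contrapT => none.
apply: ne3.
have [c [pc np'c]] : exists c, p c /\ ~ p' c.
  by apply: contrapT => h; apply: npp' => x px; apply: contrapT => nx; apply: h; exists x.
have ip := prime_idealW pp; have ip' := prime_idealW pp'.
apply: (krull_pit nR (ext_prime pp') pQ' (ext_prime pp) e1 e2 (a := c%:P)).
- exact: ext_const.
- by move/cQ'.
move=> Q pQ eQ Qc Qe.
have h : le p (contr Q).
  apply: contrapT => npQ; apply: none; exists (contr Q); split=> //.
  - exact: contr_prime.
  - by move=> x p'x; apply: eQ; apply: ext_const.
  - by move=> k; apply: np'c; apply: k.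
  - by move=> x /Qe; apply: contr_ext.
move=> f pf; apply: (ext_contr (prime_idealW pQ)) => i; exact: h.
Qed.

(** Contraction loses at most one step: neighbours with equal contraction force the lower one to be
    extended, by [fiber_ext], and below an extended prime nothing is lost. If an extended prime sits
    above one that is not, the strong S-property inserts a prime that makes up for the earlier
    loss. *)
Theorem poly_height (Z : {poly R} -> Prop) n Q : noetherian {poly R} -> pch Z n Q ->
  (le Q (ext (contr Q)) -> pch (contr Z) n (contr Q)) /\ pch (contr Z) n.-1 (contr Q).
Proof.
move=> nR; elim=> [Q0 pQ0 ZQ0|k Q' Q0 c [IH1 IH2] pQ0 Q'Q0 nQ0Q'].
  have h : pch (contr Z) 0 (contr Q0).
    by apply: chain0; [apply: contr_prime | move=> x; apply: ZQ0].
  by split.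
have pQ' := chain_top c; have iQ' := prime_idealW pQ'.
have pp := contr_prime pQ0; have pp' := contr_prime pQ'.
have le' : le (contr Q') (contr Q0) by move=> x; apply: Q'Q0.
have [Ep|nEp] := EM (le (contr Q0) (contr Q')).
  split=> [eQ0|/=].
    exfalso; apply: nQ0Q' => f /eQ0 h; apply: (ext_contr iQ') => i; exact: Ep.
  apply: (pch_eq le' Ep); apply: IH1; exact: fiber_ext nQ0Q' Ep.
have step m : pch (contr Z) m (contr Q') -> pch (contr Z) m.+1 (contr Q0).
  by move=> h; apply: chainS h _ _ _.
split=> [eQ0|/=].
  have [e'|ne'] := EM (le Q' (ext (contr Q'))); first by apply/step/IH1.
  have [|||p2 [pp2 h1 h2 h3 h4]] := @strong_S_property (contr Q0) (contr Q') Q' nR pp pp' pQ' le' nEp _ _ ne' _.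
  - exact: ext_contr.
  - by move=> f /Q'Q0 /eQ0.
  - by move=> x.
  apply: (@pch_leq _ _ k.-1.+2); first by case: (k).
  by apply: chainS h3 h4 => //; apply: chainS IH2 _ _ _.
case: k c IH1 IH2 => [|k] c IH1 IH2.
  by apply: pch_pred; apply: step.
exact: step.
Qed.

End PolyHeight.

(** * The dimension inequality *)

Definition ker (U V : comNzRingType) (f : {rmorphism U -> V}) : U -> Prop :=
  fun x => f x = 0.

Definition is_domain (A : comNzRingType) := is_prime_ideal (fun x : A => x = 0).

Definition algebraic_over (B A : comNzRingType) (g : {rmorphism B -> A}) (x : A) :=
  exists c b, g c <> 0 /\ g c * x = g b.

Section DimensionInequality.
Variable A : comNzRingType.
Hypothesis domA : is_domain A.

(* A chain of primes is already visible in any subring containing finitely many witnesses. *)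
Lemma pch_witness (Z : A -> Prop) n Q : pch Z n Q -> exists s : seq A,
  forall (B : comNzRingType) (h : {rmorphism B -> A}),
    (forall x, x \in s -> exists b, h b = x) ->
    pch (fun b => Z (h b)) n (fun b => Q (h b)).
Proof.
elim=> [Q' pQ' ZQ'|k Q1 Q2 c [s IH] pQ2 le1 nle].
  exists [::] => B h _; apply: chain0; first exact: preim_prime.
  by move=> b; apply: ZQ'.
have [y [Q2y nQ1y]] : exists y, Q2 y /\ ~ Q1 y.
  by apply: contrapT => h; apply: nle => x Q2x; apply: contrapT => nx; apply: h; exists x.
exists (y :: s) => B h hs; apply: (chainS (N := fun b => Q1 (h b))).
- by apply: IH => x xs; apply: hs; rewrite inE xs orbT.
- exact: preim_prime.
- by move=> b; apply: le1.
have [b Eb] := hs y (mem_head _ _).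
by move=> k'; apply: nQ1y; rewrite -Eb; apply: k'; rewrite Eb.
Qed.

(** The relation cx = b makes the kernel of B[X] -> A strictly larger than the extended kernel of
    [g]. Prepending the latter gains the one step that [poly_height] may lose. *)
Lemma adjoin_height (B : comNzRingType) (g : {rmorphism B -> A})
    (g' : {rmorphism {poly B} -> A}) c b n Q :
  noetherian B -> (forall a, g' a%:P = g a) -> g c <> 0 -> g c * g' 'X = g b ->
  pch (ker g') n (fun f => Q (g' f)) -> pch (ker g) n (fun a => Q (g a)).
Proof.
move=> nB gE gc0 E ch'.
have pk : is_prime_ideal (ker g) := preim_prime g domA.
have ch2 : pch (ext (ker g)) n.+1 (fun f => Q (g' f)).
  apply: (pch_prepend ch' (P := ext (ker g))) => //; first exact: ext_prime.
    move=> f kf; rewrite /ker -[f]coefK poly_def rmorph_sum big1 // => i _.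
    by rewrite -mul_polyC rmorphM gE kf mul0r.
  move=> /(_ (c%:P * 'X - b%:P)) h; apply: gc0.
  have : ext (ker g) (c%:P * 'X - b%:P).
    by apply: h; rewrite /ker rmorphB rmorphM !gE E subrr.
  by move=> /(_ 1%N); rewrite coefB coefCM coefX coefC mulr1 subr0.
have [_ /=] := poly_height (hilbert_basis nB) ch2.
have -> : contr (fun f => Q (g' f)) = (fun a => Q (g a)).
  by apply/predeqP => a; rewrite /contr gE.
by apply: chain_low => N _ kN a ka; apply: kN; apply: ext_const => //; apply: prime_idealW.
Qed.

Lemma adjoin_seq_height n Q (s : seq A) (B : comNzRingType) (g : {rmorphism B -> A}) :
  noetherian B -> (forall x, x \in s -> algebraic_over g x) ->
  (forall (B' : comNzRingType) (g' : {rmorphism B' -> A}),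
      (forall b, exists b', g' b' = g b) -> (forall x, x \in s -> exists b, g' b = x) ->
      pch (ker g') n (fun f => Q (g' f))) ->
  pch (ker g) n (fun a => Q (g a)).
Proof.
elim: s B g => [|x s IH] B g nB alg H; first by apply: H => // b; exists b.
have [c [b [gc0 E]]] := alg x (mem_head _ _).
have cfu : commr_rmorph g x by move=> a; apply: mulrC.
pose g' : {rmorphism {poly B} -> A} := horner_morph cfu.
have gE a : g' a%:P = g a by exact: horner_morphC.
apply: (@adjoin_height _ g g' c b) => //; first by rewrite [g' _]horner_morphX.
apply: IH; first exact: hilbert_basis.
  move=> y ys; have [c' [b' [h1 h2]]] := alg y (mem_behead (s := x :: s) ys).
  by exists c'%:P, b'%:P; rewrite !gE.
move=> B' g2 im ims; apply: H => [a|y].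
  by have [b' Eb'] := im a%:P; exists b'; rewrite Eb' gE.
rewrite inE => /orP[/eqP->|/ims//].
by have [b' Eb'] := im 'X; exists b'; rewrite Eb' [g' _]horner_morphX.
Qed.

(** A chain in [A] is already visible over R[X] with finitely many witnesses adjoined. Each witness
    is algebraic and costs nothing; only the passage from R[X] to [R] can lose a step. *)
Theorem dimension_inequality (R : comNzRingType) (g : {rmorphism {poly R} -> A}) n Q :
  noetherian R -> (forall x, algebraic_over g x) ->
  pch (fun x => x = 0) n Q -> pch (fun _ => False) n.-1 (fun c => Q (g c%:P)).
Proof.
move=> nR alg cA; have [s sP] := pch_witness cA.
have nR' := hilbert_basis nR.
have c' : pch (ker g) n (fun f => Q (g f)).
  by apply: (adjoin_seq_height (s := s)) => // B' g' _; apply: sP.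
have [_] := poly_height nR' c'.
by apply: chain_low => N _ _ x.
Qed.

End DimensionInequality.

(** * Generalized dimension of localizations *)

Section KrullDimension.
Variable U : comNzRingType.
Implicit Types (J S Q : U -> Prop).

(* The Krull boundary of x modulo J: the ideal J + (x) + (J : x^oo). *)
Definition boundary J x : U -> Prop := fun y => exists c z k, J (x ^+ k * z) /\ y = c * x + z.

(* [Kd J S n]: the localization of U/J at the monoid S has Krull dimension < n
   (Lombardi's inductive characterization). *)
Fixpoint Kd J S n : Prop :=
  match n with
  | 0 => exists u, S u /\ J u
  | n'.+1 => forall x, Kd (boundary J x) S n'
  end.

Lemma le_boundary J x : le J (boundary J x).
Proof. by move=> y Jy; exists 0, y, 0%N; rewrite expr0 mul1r mul0r add0r. Qed.

Lemma boundary_ideal J x : is_ideal J -> is_ideal (boundary J x).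
Proof.
move=> iJ; split.
- by apply: le_boundary; apply: ideal0.
- move=> _ _ [c [z [k [Jz ->]]]] [c' [z' [k' [Jz' ->]]]].
  exists (c + c'), (z + z'), (k + k')%N; split; last by ring.
  rewrite exprD; have -> : x ^+ k * x ^+ k' * (z + z') =
    x ^+ k' * (x ^+ k * z) + x ^+ k * (x ^+ k' * z') by ring.
  by apply: idealD => //; apply: idealM.
- move=> a _ [c [z [k [Jz ->]]]]; exists (a * c), (a * z), k; split; last by ring.
  by rewrite mulrCA; apply: idealM.
Qed.

Lemma Kd_mono J J' S S' n : le J J' -> le S S' -> Kd J S n -> Kd J' S' n.
Proof.
move=> JJ' SS'; elim: n J J' JJ' => [|n IH] J J' JJ' /=.
  by move=> [u [/SS' Su /JJ' Ju]]; exists u.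
move=> H x; apply: IH (H x) => _ [c [z [k [/JJ' Jz ->]]]].
by exists c, z, k.
Qed.

Lemma Kd_leq J S n m : (n <= m)%N -> Kd J S n -> Kd J S m.
Proof.
move=> /subnK <-; elim: (m - n)%N => // k IH /IH {IH} H x.
by apply: Kd_mono H => //; apply: le_boundary.
Qed.

Lemma pch_bottom (Z : U -> Prop) n Q : pch Z n Q ->
  exists Q0, [/\ is_prime_ideal Q0, le Z Q0 & pch Q0 n Q].
Proof.
elim=> [Q' pQ' ZQ'|k Q1 Q2 _ [Q0 [p0 ZQ0 c]] pQ2 le1 nle].
  by exists Q'; split=> //; apply: chain0.
by exists Q0; split=> //; apply: chainS c _ _ _.
Qed.

(** A prime [Q0] over the boundary of x is never minimal over [J]: the elements x^k z with z outside
    [Q0] miss [J], and a prime over [J] avoiding them lies in [Q0] but does not contain x, whereas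
    [Q0] does. So chains above the boundary extend downwards. *)
Lemma Kd_chain J S n : is_ideal J -> is_monoid S ->
  (forall Q, pch J n Q -> exists x, Q x /\ S x) -> Kd J S n.
Proof.
move=> iJ mS; elim: n J iJ => [|n IH] J iJ H /=.
  apply: contrapT => h; have [|Q [pQ JQ QS]] := prime_sep iJ mS.
    by move=> x Jx Sx; apply: h; exists x.
  by have [|x [/QS]] := H Q; first exact: chain0.
move=> x; apply: IH; first exact: boundary_ideal.
move=> Q c; have [Q0 [pQ0 bQ0 c0]] := pch_bottom c.
pose M y := exists k z, y = x ^+ k * z /\ ~ Q0 z.
have [||P [pP JP PM]] := @prime_sep U J M iJ.
- split; first by exists 0%N, 1; split; [rewrite expr0 mul1r | apply: prime1].
  move=> _ _ [k [z [-> nz]]] [k' [z' [-> nz']]]; exists (k + k')%N, (z * z').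
  by split; [rewrite exprD; ring | move/(primeM pQ0) => []].
- move=> y Jy [k [z [E nz]]]; apply: nz; apply: bQ0; exists 0, z, k.
  by rewrite -E mul0r add0r.
apply: H; apply: (pch_prepend c0 (P := P)) => //.
  move=> y Py; apply: contrapT => nQ; apply: (PM _ Py); exists 0%N, y.
  by rewrite expr0 mul1r.
move=> h; apply: (PM x); last by exists 1%N, 1; split; [rewrite expr1 mulr1 | apply: prime1].
apply: h; apply: bQ0; exists 1, 0, 0%N.
by rewrite mul1r addr0 mulr0; split=> //; apply: ideal0.
Qed.

End KrullDimension.

Definition dim_lt (R : comNzRingType) n := forall Z Q : R -> Prop, ~ pch Z n Q.

Section Dimensions.
Variables (R : idomainType) (d : nat) (s : R).
Hypotheses (nR : noetherian R) (dimR : dim_lt R d) (d0 : (0 < d)%N).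

Lemma idomain_domain (D : idomainType) : is_domain D.
Proof.
split; first exact: zero_ideal.
  by move/eqP; rewrite oner_eq0.
by move=> x y /eqP; rewrite mulf_eq0 => /orP[/eqP|/eqP]; [left|right].
Qed.

Definition SR (c : R) := exists k r, c = s ^+ k * (1 + s * r).

Lemma SR_monoid : is_monoid SR.
Proof.
split; first by exists 0%N, 0; rewrite expr0; ring.
move=> _ _ [k [r ->]] [k' [r' ->]]; exists (k + k')%N, (r + r' + s * r * r').
by rewrite exprD; ring.
Qed.
Lemma SR_s : SR s. Proof. by exists 1%N, 0; rewrite expr1; ring. Qed.
Lemma SR_1 r : SR (1 + s * r). Proof. by exists 0%N, r; rewrite expr0; ring. Qed.

(** A prime p avoiding the monoid does not contain s, and p + (s) is proper because p misses 1 + sR.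
    Hence inverting the monoid lowers the dimension by one. *)
Lemma extend_SR Z n p : pch Z n p -> (forall x, p x -> ~ SR x) ->
  exists p', pch Z n.+1 p'.
Proof.
move=> c av; have pp := chain_top c; have ip := prime_idealW pp.
have [||q [pq pq' _]] := @prime_sep _ (idadd p s) (fun x => x = 1) (idadd_ideal s ip).
- by split=> // x y -> ->; rewrite mulr1.
- move=> _ [y [r [py ->]]] E; apply: (av _ py); rewrite -[y](addrK (r * s)) E.
  by rewrite -mulNr mulrC; apply: SR_1.
exists q; apply: chainS c pq _ _; first by move=> x px; apply/pq'/le_idadd.
by move=> h; apply: (av s); [apply/h/pq'/idadd_in | apply: SR_s].
Qed.

Section Overring.
Variables (A : comNzRingType) (g : {rmorphism {poly R} -> A}).
Hypotheses (domA : is_domain A) (alg : forall x, algebraic_over g x).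
Let i (c : R) : A := g c%:P.
Let zeroI := zero_ideal A.

Lemma monoid_image (B C : comNzRingType) (f : {rmorphism B -> C}) (M : B -> Prop) :
  is_monoid M -> is_monoid (fun x => exists c, M c /\ x = f c).
Proof.
move=> [M1 MM]; split; first by exists 1; rewrite rmorph1.
by move=> _ _ [c [Mc ->]] [c' [Mc' ->]]; exists (c * c'); rewrite rmorphM; split=> //; apply: MM.
Qed.

Lemma Kd_mod x : x <> 0 -> Kd (idadd (fun y : A => y = 0) x) (fun y => y = 1) d.
Proof.
move=> x0; apply: Kd_chain; first exact: idadd_ideal.
  by split=> // y z -> ->; rewrite mulr1.
move=> Q c; exfalso.
have : pch (fun y : A => y = 0) d.+1 Q.
  apply: (pch_prepend c domA); [by [] | exact: le_idadd |].
  by move=> h; apply: x0; apply: h; apply: idadd_in.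
by move/(dimension_inequality domA nR alg) => /=; apply: dimR.
Qed.

Lemma Kd_loc : Kd (fun y : A => y = 0) (fun y => exists c, SR c /\ y = i c) d.
Proof.
apply: Kd_chain => //; first exact: (@monoid_image _ _ (g \o polyC) SR SR_monoid).
move=> Q c; apply: contrapT => av.
have c' := dimension_inequality domA nR alg c.
have [x px Sx|p'] := extend_SR c'; first by apply: av; exists (g x%:P); split=> //; exists x.
by rewrite (prednK d0); apply: dimR.
Qed.

(** The bound is 2 because a chain of length 2 in [A] contracts to one of length at least 1 in [R],
    whose top contains a nonzero constant. *)
Lemma Kd_generic : Kd (fun y : A => y = 0) (fun y => exists c, c <> 0 /\ y = i c) 2.
Proof.
apply: Kd_chain => //.
  apply: (@monoid_image _ _ (g \o polyC) (fun c => c <> 0)); split.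
    by apply/eqP; apply: oner_neq0.
  by move=> x y /eqP x0 /eqP y0; apply/eqP; rewrite mulf_neq0.
move=> Q c; apply: contrapT => av.
have /= c' := dimension_inequality domA nR alg c.
inversion c' as [|k Q' Q'' c0 p1 le1 nle]; subst.
apply: nle => x Qx.
have -> : x = 0.
  by apply: contrapT => x0; apply: av; exists (g x%:P); split=> //; exists x.
exact: (ideal0 (prime_idealW (chain_top c0))).
Qed.

End Overring.

(** Inverts X together with every polynomial whose constant term is in the monoid: the overlap of X
    != 0 with a neighbourhood of X = 0. *)
Definition S2 (w : {poly R}) := exists a b h, SR b /\ w = 'X^a * (b%:P + 'X * h).

Lemma S2_monoid : is_monoid S2.
Proof.
have [S1 SM] := SR_monoid; split.
  by exists 0%N, 1, 0; split=> //; rewrite expr0 mulr0 addr0 mul1r.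
move=> _ _ [a [b [h [Sb ->]]]] [a' [b' [h' [Sb' ->]]]].
exists (a + a')%N, (b * b'), (b%:P * h' + h * b'%:P + 'X * h * h').
by split; [apply: SM | rewrite exprD polyCM; ring].
Qed.

Lemma Kd_poly : Kd (fun y : {poly R} => y = 0) (fun y => exists c, SR c /\ y = c%:P) d.
Proof.
have alg (x : {poly R}) : algebraic_over (idfun : {rmorphism {poly R} -> {poly R}}) x.
  by exists 1, x; rewrite /= mul1r; split=> //; apply/eqP; apply: oner_neq0.
exact: (Kd_loc (idomain_domain _) alg).
Qed.

(** Two variables may cost two steps, and both are recovered: a prime of R[X] avoiding [S2] extends
    by X, and the contraction to [R] extends by s. *)
Lemma Kd_poly2 : Kd (fun y : {poly {poly R}} => y = 0) (fun y => exists w, S2 w /\ y = w%:P) d.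
Proof.
apply: Kd_chain; first exact: zero_ideal.
  exact: (@monoid_image _ _ polyC S2 S2_monoid).
move=> Q c; apply: contrapT => av.
have nP := hilbert_basis nR.
have [_ c1] := poly_height (hilbert_basis nP) c.
have pq := chain_top c1; have iq := prime_idealW pq; set q := contr Q in c1 pq iq.
have avq w : q w -> ~ S2 w by move=> qw Sw; apply: av; exists w%:P; split=> //; exists w.
have [||q' [pq' qq' avq']] :=
  @prime_sep _ (idadd q 'X) (fun y => exists c, SR c /\ y = c%:P) (idadd_ideal _ iq).
- exact: (@monoid_image _ _ polyC SR SR_monoid).
- move=> _ [y [h [qy ->]]] [b [Sb E]]; apply: (avq _ qy); exists 0%N, b, (- h).
  by split=> //; rewrite expr0 -E; ring.
have c2 : pch (contr (fun y => y = 0)) d q'.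
  rewrite -(prednK d0); apply: chainS c1 pq' _ _.
    by move=> x qx; apply/qq'/le_idadd.
  move=> h; apply: (avq 'X); first by apply/h/qq'/idadd_in.
  by exists 1%N, 1, 0; split; [case: SR_monoid | rewrite expr1; ring].
have [_ c3] := poly_height nP c2.
have [x px Sx|p'] := extend_SR c3.
  by apply: (avq' _ px); exists x.
by rewrite (prednK d0); apply: dimR.
Qed.

End Dimensions.

(** * Unimodular elements *)

Section Radical.
Variable U : comNzRingType.
Implicit Types (J L S : U -> Prop).

Definition rad S L : U -> Prop := fun x => exists u k, S u /\ L (u * x ^+ k).

Lemma rad_ideal S L : is_monoid S -> is_ideal L -> is_ideal (rad S L).
Proof.
move=> [S1 SM] iL; split.
- by exists 1, 1%N; rewrite expr1 mulr0; split=> //; apply: ideal0.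
- move=> x y [u [k [Su Lx]]] [v [l [Sv Ly]]]; exists (u * v), (k + l)%N.
  split; first exact: SM.
  rewrite exprDn mulr_sumr; apply: ideal_sum => // i _.
  rewrite -mulr_natr !mulrA; apply: idealMr => //.
  have [li|il] := leqP l i.
    rewrite -(subnK li) exprD.
    have -> : u * v * x ^+ (k + l - (i - l + l)) * (y ^+ (i - l) * y ^+ l) =
      u * x ^+ (k + l - (i - l + l)) * y ^+ (i - l) * (v * y ^+ l) by ring.
    exact: idealM.
  have ki : (k <= k + l - i)%N by rewrite -addnBA ?leq_addr // ltnW.
  rewrite -(subnK ki) exprD.
  have -> : u * v * (x ^+ (k + l - i - k) * x ^+ k) * y ^+ i =
    v * x ^+ (k + l - i - k) * y ^+ i * (u * x ^+ k) by ring.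
  exact: idealM.
- move=> a x [u [k [Su Lx]]]; exists u, k; split=> //.
  by rewrite exprMn mulrCA; apply: idealM.
Qed.
Lemma le_rad S L : is_monoid S -> le L (rad S L).
Proof. by move=> [S1 _] x Lx; exists 1, 1%N; rewrite mul1r expr1. Qed.
Lemma rad_mono S L L' : le L L' -> le (rad S L) (rad S L').
Proof. by move=> h x [u [k [Su /h Lx]]]; exists u, k. Qed.
Lemma rad_root S L x k : rad S L (x ^+ k) -> rad S L x.
Proof. by move=> [u [l [Su Lx]]]; exists u, (k * l)%N; rewrite exprM. Qed.
Lemma rad_sat S L u x : is_monoid S -> is_ideal L -> S u -> rad S L (u * x) -> rad S L x.
Proof.
move=> mS iL Su [v [k [Sv Lx]]]; exists (v * u ^+ k), k.
by split; [apply: (proj2 mS) => //; apply: monoidX | rewrite -mulrA -exprMn].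
Qed.

Fixpoint gen J (s : seq U) : U -> Prop :=
  if s is a :: s' then gen (idadd J a) s' else J.

Lemma gen_ideal J s : is_ideal J -> is_ideal (gen J s).
Proof. by elim: s J => //= a s IH J iJ; apply: IH; apply: idadd_ideal. Qed.
Lemma le_gen J s : le J (gen J s).
Proof. by elim: s J => [|a s IH] J x Jx //=; apply: IH; apply: le_idadd. Qed.
Lemma gen_in J s x : is_ideal J -> x \in s -> gen J s x.
Proof.
elim: s J => //= a s IH J iJ; rewrite inE => /orP[/eqP->|xs].
  by apply: le_gen; apply: idadd_in.
by apply: IH => //; apply: idadd_ideal.
Qed.
Lemma gen_min J s L : is_ideal L -> le J L -> (forall x, x \in s -> L x) -> le (gen J s) L.
Proof.
elim: s J => //= a s IH J iL JL sL; apply: IH => //.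
  by apply: idadd_min => //; apply: sL; rewrite mem_head.
by move=> x xs; apply: sL; rewrite inE xs orbT.
Qed.
Lemma gen_boundary J a s : is_ideal J ->
  le (gen (boundary J a) s) (idsum (boundary J a) (gen J s)).
Proof.
move=> iJ; have [iB iG] := (boundary_ideal a iJ, gen_ideal s iJ); apply: gen_min.
- exact: idsum_ideal.
- exact: idsuml.
- by move=> x xs; apply: idsumr => //; apply: gen_in.
Qed.

(* The boundary argument of Coquand: if z kills a up to nilpotents then
   (a + b z) has the same radical as (a, b z). *)
Lemma kronecker J S b c t (s : seq U) : is_monoid S -> is_ideal J -> S (c * t) ->
  Kd J S (size s) ->
  exists xs, size xs = size s /\
    rad S (gen J [seq ax.1 + b * c * ax.2 | ax <- zip s xs]) b.
Proof.
move=> mS; elim: s J => [|a s IH] J iJ Sct /=.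
  move=> [u [Su Ju]]; exists [::]; split=> //=; exists u, 0%N.
  by rewrite expr0 mulr1.
move=> /(_ a) /(IH _ (boundary_ideal a iJ) Sct) [xs [sxs [u [k [Su]]]]].
move=> /(gen_boundary iJ) [_ [v [[c1 [z [m [Jz ->]]]] Gv Ev]]].
exists (z :: xs); split; first by rewrite /= sxs.
rewrite /=; set s' := map _ _ in Gv *; set a' := a + b * c * z.
set G := gen (idadd J a') s'.
have iJa : is_ideal (idadd J a') by exact: idadd_ideal.
have iG : is_ideal G by exact: gen_ideal.
have iR := rad_ideal mS iG.
have Jr x : J x -> rad S G x by move=> Jx; apply: le_rad => //; apply: le_gen; apply: le_idadd.
have a'R : rad S G a' by apply: le_rad => //; apply: le_gen; apply: idadd_in.
have abR : rad S G (a * (b * c * z)).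
  apply: (@rad_root _ _ _ m.+1); apply: Jr.
  have -> : (a * (b * c * z)) ^+ m.+1 = a * (b * c) ^+ m.+1 * z ^+ m * (a ^+ m * z).
    by rewrite !exprMn !exprS; ring.
  exact: idealM.
have aR : rad S G a.
  apply: (@rad_root _ _ _ 2).
  have -> : a ^+ 2 = a * a' - a * (b * c * z) by rewrite /a'; ring.
  by apply: idealB => //; apply: idealM.
have bzR : rad S G (b * z).
  apply: (rad_sat (u := c * t)) => //.
  have -> : c * t * (b * z) = t * (a' - a) by rewrite /a'; ring.
  by apply: idealM => //; apply: idealB.
apply: (@rad_root _ _ _ k.+1); apply: (rad_sat (u := u)) => //.
have -> : u * b ^+ k.+1 = b * v + b * c1 * a + b * z by rewrite exprS mulrCA Ev; ring.
apply: idealD => //; apply: idealD => //; last exact: idealM.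
apply: idealM => //; apply: le_rad => //.
have mono : le (gen J s') G.
  apply: gen_min => //; first by move=> x Jx; apply: le_gen; apply: le_idadd.
  by move=> x xs'; apply: gen_in.
exact: mono.
Qed.

End Radical.

Lemma entryD (V : nmodType) m k (M N : 'M[V]_(m, k)) i l : (M + N) i l = M i l + N i l.
Proof. by rewrite mxE. Qed.
Lemma entryZ (V : pzRingType) m k (a : V) (M : 'M[V]_(m, k)) i l : (a *: M) i l = a * M i l.
Proof. by rewrite mxE. Qed.

(** * Order ideals and general position in projective modules *)

Section Stable.
Variables (U : comNzRingType) (n : nat) (e : 'M[U]_n).
Implicit Types (J S : U -> Prop) (p x : 'rV[U]_n).

Definition inP p := p *m e = p.

Lemma inPD p x a : inP p -> inP x -> inP (p + a *: x).
Proof. by rewrite /inP mulmxDl -scalemxAl => -> ->. Qed.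

Lemma evalD p x a (psi : 'cV[U]_n) :
  ((p + a *: x) *m psi) 0 0 = (p *m psi) 0 0 + a * (x *m psi) 0 0.
Proof. by rewrite mulmxDl -scalemxAl entryD entryZ. Qed.

Definition orderid J p : U -> Prop :=
  fun y => exists (psi : 'cV[U]_n) j, J j /\ y = (p *m psi) 0 0 + j.

Lemma orderid_ideal J p : is_ideal J -> is_ideal (orderid J p).
Proof.
move=> iJ; split.
- by exists 0, 0; rewrite mulmx0 mxE addr0; split=> //; apply: ideal0.
- move=> _ _ [psi [j [Jj ->]]] [psi' [j' [Jj' ->]]]; exists (psi + psi'), (j + j').
  by split; [exact: idealD | rewrite mulmxDr entryD; ring].
- move=> a _ [psi [j [Jj ->]]]; exists (a *: psi), (a * j).
  by split; [exact: idealM | rewrite -scalemxAr entryZ; ring].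
Qed.
Lemma le_orderid J p : le J (orderid J p).
Proof. by move=> x Jx; exists 0, x; rewrite mulmx0 mxE add0r. Qed.

(** General position in the localization of U/J at [S]: adding to p a multiple of bc brings b into
    the radical of its order ideal. The unit c is carried along so that a later move can be confined
    to multiples of a prescribed f. *)
Definition good J S := forall p b c, inP p -> (exists t, S (c * t)) ->
  exists x, inP x /\ rad S (orderid J (p + (b * c) *: x)) b.

(** Vectors and functionals dual to each other up to the factor f: a free summand of rank r once f
    is inverted. *)
Definition local_basis r (f : U) := exists (p : 'I_r -> 'rV[U]_n) (phi : 'I_r -> 'cV[U]_n),
  (forall i, inP (p i)) /\ forall i j, (p j *m phi i) 0 0 = f *+ (i == j).

Lemma good_free J S r f : is_monoid S -> is_ideal J -> (exists t, S (f * t)) ->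
  local_basis r f -> Kd J S r -> good J S.
Proof.
move=> mS iJ [t' Sft'] [q [phi [qP qphi]]] K p b c Pp [t Sct].
pose s := [seq (p *m phi i) 0 0 | i <- enum 'I_r].
have ss : size s = r by rewrite size_map size_enum_ord.
have Scf : S ((c * f) * (t * t')).
  have -> : c * f * (t * t') = (c * t) * (f * t') by ring.
  exact: (proj2 mS).
have [|xs [sxs R]] := @kronecker U J S b _ _ s mS iJ Scf; first by rewrite ss.
exists (\sum_(i < r) xs`_i *: q i); split.
  rewrite /inP mulmx_suml; apply: eq_bigr => i _.
  by rewrite -scalemxAl qP.
apply: rad_mono R => y; apply: gen_min.
- exact: orderid_ideal.
- exact: le_orderid.
move=> {}y /mapP [[a x] axin ->] /=.
have [i] := nthP (0, 0) axin; rewrite size_zip sxs minnn ss => ir.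
rewrite nth_zip // => -[<- <-].
exists (phi (Ordinal ir)), 0; split; first exact: ideal0.
rewrite addr0 /s (nth_map (Ordinal ir)) ?size_enum_ord //.
rewrite (nth_ord_enum _ (Ordinal ir)).
rewrite mulmxDl -scalemxAl mulmx_suml entryD; congr (_ + _).
rewrite entryZ summxE (bigD1 (Ordinal ir)) //= big1 ?addr0 => [|j ji].
  by rewrite -scalemxAl entryZ qphi eqxx mulr1n; ring.
by rewrite -scalemxAl entryZ qphi eq_sym (negPf ji) mulr0n mulr0.
Qed.

Definition adjoin_pow S f : U -> Prop := fun y => exists u k, S u /\ y = u * f ^+ k.

Lemma adjoin_pow_monoid S f : is_monoid S -> is_monoid (adjoin_pow S f).
Proof.
move=> [S1 SM]; split; first by exists 1, 0%N; rewrite expr0 mulr1.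
move=> _ _ [u [k [Su ->]]] [v [l [Sv ->]]]; exists (u * v), (k + l)%N.
by split; [apply: SM | rewrite exprD; ring].
Qed.
Lemma le_adjoin_pow S f : le S (adjoin_pow S f).
Proof. by move=> u Su; exists u, 0%N; rewrite expr0 mulr1. Qed.

(** The first move is made modulo f, the second with f inverted and by a multiple of bcf. The first
    relation, multiplied by b, survives modulo fb, and fb lies in the radical after the second
    move. *)
Lemma good_glue J S f : is_monoid S -> is_ideal J ->
  good (idadd J f) S -> good J (adjoin_pow S f) -> good J S.
Proof.
move=> mS iJ G1 G2 p b c Pp [t Sct].
have [|x0 [Px0 [u0 [k0 [Su0 [psi [_ [[j [r [Jj ->]]] E0]]]]]]]] := G1 p b c Pp; first by exists t.
set p' := p + _ in E0.
have Pp' : inP p' by apply: inPD.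
have [|x1 [Px1 R1]] := G2 p' b (c * f) Pp'.
  by exists t, (c * t), 1%N; split=> //; rewrite expr1; ring.
exists (x0 + f *: x1); split; first exact: inPD.
have -> : p + (b * c) *: (x0 + f *: x1) = p' + (b * (c * f)) *: x1.
  by rewrite /p' scalerDr scalerA addrA mulrA.
set p'' := p' + _ in R1 *.
have iO := orderid_ideal p'' iJ; have iR := rad_ideal mS iO.
have fbR : rad S (orderid J p'') (f * b).
  move: R1 => [_ [m [[u [k [Su ->]]] O1]]]; exists u, (m + k)%N; split=> //.
  have -> : u * (f * b) ^+ (m + k) = f ^+ m * b ^+ k * (u * f ^+ k * b ^+ m).
    by rewrite exprMn !exprD; ring.
  exact: idealM.
apply: (@rad_root _ _ _ _ k0.+1); apply: (rad_sat mS iO Su0).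
pose r' := r - (b * c) * (x1 *m psi) 0 0.
have -> : u0 * b ^+ k0.+1 = b * (p'' *m psi) 0 0 + b * j + r' * (f * b).
  rewrite exprS mulrCA E0 /r' /p'' (evalD p'); ring.
have inO y : orderid J p'' y -> rad S (orderid J p'') y by apply: le_rad.
apply: idealD => //; last exact: idealM.
apply: idealD => //; apply: idealM => //; apply: inO.
  by exists psi, 0; rewrite addr0; split=> //; apply: ideal0.
exact: le_orderid.
Qed.

Lemma good_cover J S r fs : is_monoid S -> is_ideal J ->
  (forall f, f \in fs -> local_basis r f) -> gen J fs 1 -> Kd J S r -> good J S.
Proof.
move=> mS; elim: fs J => [|f fs IH] J iJ lb /= G1 K.
  move=> p b c Pp _; exists 0; split; first by rewrite /inP mul0mx.
  by exists 1, 0%N; rewrite mul1r expr0; split; [case: mS | apply: le_orderid].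
apply: (@good_glue _ _ f) => //.
  apply: IH => //; first exact: idadd_ideal.
    by move=> g gfs; apply: lb; rewrite inE gfs orbT.
  by apply: Kd_mono K => //; apply: le_idadd.
apply: (@good_free _ _ r f) => //.
- exact: adjoin_pow_monoid.
- by exists 1, 1, 1%N; split; [case: mS | rewrite expr1; ring].
- by apply: lb; rewrite mem_head.
by apply: Kd_mono K => //; apply: le_adjoin_pow.
Qed.

(** Taking b = a and c = 1 puts a into the radical of the order ideal of p + ax; as (p, a) is
    unimodular over the localization, that order ideal then meets [S]. *)
Lemma good_unimodular S p a (psi0 : 'cV[U]_n) y0 : is_monoid S ->
  good (fun u : U => u = 0) S -> inP p -> S ((p *m psi0) 0 0 + a * y0) ->
  exists x (psi : 'cV[U]_n), inP x /\ S (((p + a *: x) *m psi) 0 0).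
Proof.
move=> mS G Pp S0.
have i0 := zero_ideal U.
have [|x [Px]] := G p a 1 Pp; first by exists 1; rewrite mulr1; case: mS.
rewrite mulr1 => R; set p' := p + _ in R.
have iO := orderid_ideal p' i0; have iR := rad_ideal mS iO.
have : rad S (orderid (fun u : U => u = 0) p') ((p *m psi0) 0 0 + a * y0).
  have -> : (p *m psi0) 0 0 + a * y0 = (p' *m psi0) 0 0 + (y0 - (x *m psi0) 0 0) * a.
    by rewrite /p' mulmxDl -scalemxAl entryD entryZ; ring.
  apply: idealD => //; last exact: idealM.
  by apply: le_rad => //; exists psi0, 0; rewrite addr0.
move=> [u [k [Su [psi [_ [-> E]]]]]]; exists x, psi; split=> //.
rewrite addr0 in E; rewrite -/p' -E; apply: (proj2 mS) => //; exact: monoidX.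
Qed.

End Stable.

(** * Local bases of a projective module from mixed minors *)

Section Minors.
Variables (A : comNzRingType) (F : fieldType) (j : {rmorphism A -> F}).
Hypothesis j_inj : injective j.
Variables (n : nat) (e : 'M[A]_n).
Hypothesis ee : e *m e = e.

(** These matrices come from the multilinear expansion by rows of det(e + (1 - e)) = 1, so their
    determinants are comaximal. *)
Definition mixed (f : {ffun 'I_n -> bool}) : 'M[A]_n :=
  \matrix_(i, k) if f i then e i k else (1%:M - e) i k.

Lemma sum_det_mixed : \sum_f \det (mixed f) = 1.
Proof.
have -> : 1 = \det (e + (1%:M - e)) by rewrite addrCA subrr addr0 det1.
rewrite /determinant exchange_big /=; apply: eq_bigr => s _.
rewrite -big_distrr /=; congr (_ * _).
transitivity (\prod_i \sum_(b : bool) (if b then e i (s i) else (1%:M - e) i (s i))).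
  rewrite bigA_distr_bigA /=; apply: eq_bigr => f _; apply: eq_bigr => i _.
  by rewrite !mxE; case: (f i); rewrite ?mxE.
by apply: eq_bigr => i _; rewrite big_bool /= !mxE.
Qed.

Lemma row_free_rowsub (m : nat) (g : 'I_m -> 'I_n) (N : 'M[F]_n) :
  injective g -> N \in unitmx -> \rank (rowsub g N) = m.
Proof.
move=> gi Nu; apply/eqP; rewrite -/(row_free _); apply/row_freeP.
exists (invmx N *m (rowsub g 1%:M)^T).
have -> : rowsub g N = rowsub g 1%:M *m N by rewrite mul_rowsub_mx mul1mx.
rewrite mulmxA mulmxK //.
apply/matrixP => i k; rewrite !mxE (bigD1 (g i)) //= big1 => [|l li].
  by rewrite !mxE eqxx mul1r addr0 eq_sym (inj_eq gi) eq_sym.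
by rewrite !mxE eq_sym (negPf li) mul0r.
Qed.

(** At most rank many rows of e and corank many rows of 1 - e are independent, so a nonzero
    determinant uses exactly r rows of e. These and the matching columns of the adjugate are dual up
    to the determinant. For determinant 0 zero vectors do. *)
Lemma local_basis_mixed f : local_basis e (\rank (map_mx j e)) (\det (mixed f)).
Proof.
set r := \rank _.
have [d0|d0] := eqVneq (\det (mixed f)) 0.
  exists (fun _ => 0), (fun _ => 0); split=> [i|i k]; first by rewrite /inP mul0mx.
  by rewrite mul0mx mxE d0 mul0rn.
pose E := map_mx j e; pose N := map_mx j (mixed f).
have Nu : N \in unitmx.
  by rewrite unitmxE unitfE det_map_mx; apply: contra d0 => /eqP;
     rewrite -(rmorph0 j) => /j_inj ->.
have EE : E *m E = E by rewrite -map_mxM ee.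
pose T := [set i | f i].
have sub1 : (#|T| <= r)%N.
  rewrite -(@row_free_rowsub _ (@enum_val _ (mem T)) N (@enum_val_inj _ _) Nu).
  apply: mxrankS; apply/row_subP => i; rewrite row_rowsub.
  have -> : row (enum_val i) N = row (enum_val i) E.
    apply/rowP => k; rewrite !mxE.
    by have := enum_valP i; rewrite inE => ->.
  exact: row_sub.
have sub2 : (#|~: T| <= n - r)%N.
  rewrite -(@row_free_rowsub _ (@enum_val _ (mem (~: T))) N (@enum_val_inj _ _) Nu).
  rewrite -mxrank_ker; apply: mxrankS; apply/row_subP => i; rewrite row_rowsub.
  have -> : row (enum_val i) N = row (enum_val i) (1%:M - E).
    apply/rowP => k; rewrite !mxE.
    have := enum_valP i; rewrite !inE => /negPf ->.
    by rewrite rmorphB rmorph_nat.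
  apply/sub_kermxP; rewrite -row_mul mulmxBl mul1mx EE subrr.
  by apply/rowP => k; rewrite !mxE.
have Tr : #|T| = r.
  apply/eqP; rewrite eqn_leq sub1 /=.
  have := cardsC T; rewrite card_ord => cT.
  have rn : (r <= n)%N by exact: rank_leq_row.
  by rewrite -(leq_add2r #|~: T|) cT -(leq_subRL _ rn).
rewrite -Tr.
exists (fun i => row (enum_val i) e), (fun i => col (enum_val i) (\adj (mixed f))).
split=> [i|i k]; first by rewrite /inP -row_mul ee.
have -> : row (enum_val k) e = row (enum_val k) (mixed f).
  by apply/rowP => l; rewrite !mxE; have := enum_valP k; rewrite inE => ->.
have -> : (row (enum_val k) (mixed f) *m col (enum_val i) (\adj (mixed f))) 0 0
  = (mixed f *m \adj (mixed f)) (enum_val k) (enum_val i).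
  by rewrite !mxE; apply: eq_bigr => l _; rewrite !mxE.
by rewrite mul_mx_adj mxE (inj_eq (@enum_val_inj _ _)) eq_sym.
Qed.

Lemma good_projective J S : is_monoid S -> is_ideal J ->
  Kd J S (\rank (map_mx j e)) -> good e J S.
Proof.
move=> mS iJ; apply: (@good_cover _ _ _ _ _ _ [seq \det (mixed f) | f : {ffun 'I_n -> bool}]) => //.
  by move=> _ /mapP [f _ ->]; apply: local_basis_mixed.
rewrite -sum_det_mixed; apply: ideal_sum; first exact: gen_ideal.
by move=> f _; apply: gen_in => //; apply: map_f; rewrite mem_enum.
Qed.

End Minors.

Lemma good_id (U : comNzRingType) r J S : is_monoid S -> is_ideal J ->
  Kd J S r -> @good U r 1%:M J S.
Proof.
move=> mS iJ; apply: (@good_free _ _ _ _ _ _ 1) => //.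
  by exists 1; rewrite mulr1; case: mS.
exists (fun i => delta_mx 0 i), (fun i => delta_mx i 0); split=> [i|i k].
  by rewrite /inP mulmx1.
by rewrite mul_delta_mx_cond eq_sym; case: eqP; rewrite !mxE ?eqxx.
Qed.

(** * Isotopies and Quillen splitting *)

Section Subrings.
Variable V : comNzRingType.
Implicit Types D : V -> Prop.

Definition subr D :=
  [/\ D 1, forall x y, D x -> D y -> D (x + y), forall x, D x -> D (- x) &
      forall x y, D x -> D y -> D (x * y)].

Lemma subr1 D : subr D -> D 1. Proof. by case. Qed.
Lemma subrD D x y : subr D -> D x -> D y -> D (x + y). Proof. by case=> _ h _ _; apply: h. Qed.
Lemma subrN D x : subr D -> D x -> D (- x). Proof. by case=> _ _ h _; apply: h. Qed.
Lemma subrM D x y : subr D -> D x -> D y -> D (x * y). Proof. by case=> _ _ _; apply. Qed.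
Lemma subrB D x y : subr D -> D x -> D y -> D (x - y).
Proof. by move=> sD *; apply: subrD => //; apply: subrN. Qed.
Lemma subr0_in D : subr D -> D 0.
Proof. by move=> sD; rewrite -(subrr 1); apply: subrB => //; apply: subr1. Qed.
Lemma subrX D x n : subr D -> D x -> D (x ^+ n).
Proof.
move=> sD Dx; elim: n => [|n IH]; first by rewrite expr0; apply: subr1.
by rewrite exprS; apply: subrM.
Qed.
Lemma subr_sum D (I : Type) (r : seq I) (P : pred I) (G : I -> V) :
  subr D -> (forall i, P i -> D (G i)) -> D (\sum_(i <- r | P i) G i).
Proof.
move=> sD h; elim/big_ind: _ => //; first exact: subr0_in.
by move=> *; apply: subrD.
Qed.

Definition mxin m n D (M : 'M[V]_(m, n)) := forall i k, D (M i k).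

Lemma mxinM m n l D (M : 'M[V]_(m, n)) (N : 'M[V]_(n, l)) :
  subr D -> mxin D M -> mxin D N -> mxin D (M *m N).
Proof. by move=> sD hM hN i k; rewrite mxE; apply: subr_sum => // t _; apply: subrM. Qed.
Lemma mxinD m n D (M N : 'M[V]_(m, n)) : subr D -> mxin D M -> mxin D N -> mxin D (M + N).
Proof. by move=> sD hM hN i k; rewrite mxE; apply: subrD. Qed.
Lemma mxinN m n D (M : 'M[V]_(m, n)) : subr D -> mxin D M -> mxin D (- M).
Proof. by move=> sD hM i k; rewrite mxE; apply: subrN. Qed.
Lemma mxin0 m n D : subr D -> mxin D (0 : 'M[V]_(m, n)).
Proof. by move=> sD i k; rewrite mxE; apply: subr0_in. Qed.
Lemma mxin1 n D : subr D -> mxin D (1%:M : 'M[V]_n).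
Proof. by move=> sD i k; rewrite mxE; case: eqP => _; [apply: subr1|apply: subr0_in]. Qed.
Lemma mxinZ m n D a (M : 'M[V]_(m, n)) : subr D -> D a -> mxin D M -> mxin D (a *: M).
Proof. by move=> sD Da hM i k; rewrite mxE; apply: subrM. Qed.
Lemma mxin_block m1 m2 n1 n2 D (M1 : 'M[V]_(m1, n1)) M2 M3 (M4 : 'M[V]_(m2, n2)) :
  mxin D M1 -> mxin D M2 -> mxin D M3 -> mxin D M4 -> mxin D (block_mx M1 M2 M3 M4).
Proof.
move=> h1 h2 h3 h4 i k; rewrite !mxE; case: splitP => i' _; rewrite !mxE; case: splitP => k' _; by
  [apply: h1 | apply: h2 | apply: h3 | apply: h4].
Qed.
Lemma mxin_ul m1 m2 n1 n2 D (M : 'M[V]_(m1 + m2, n1 + n2)) : mxin D M -> mxin D (ulsubmx M).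
Proof. by move=> h i k; rewrite !mxE. Qed.
Lemma mxin_ur m1 m2 n1 n2 D (M : 'M[V]_(m1 + m2, n1 + n2)) : mxin D M -> mxin D (ursubmx M).
Proof. by move=> h i k; rewrite !mxE. Qed.
Lemma mxin_dl m1 m2 n1 n2 D (M : 'M[V]_(m1 + m2, n1 + n2)) : mxin D M -> mxin D (dlsubmx M).
Proof. by move=> h i k; rewrite !mxE. Qed.
Lemma mxin_dr m1 m2 n1 n2 D (M : 'M[V]_(m1 + m2, n1 + n2)) : mxin D M -> mxin D (drsubmx M).
Proof. by move=> h i k; rewrite !mxE. Qed.

Definition lower n (x : 'rV[V]_n) : 'M[V]_(n + 1) := block_mx 1%:M 0 x 1%:M.
Definition upper n (y : 'cV[V]_n) : 'M[V]_(n + 1) := block_mx 1%:M y 0 1%:M.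
Definition last_row n : 'rV[V]_(n + 1) := row_mx 0 1%:M.

Lemma lowerD n (x y : 'rV[V]_n) : lower x *m lower y = lower (x + y).
Proof. by rewrite /lower mulmx_block !mul1mx !mul0mx !mulmx0 !mulmx1 !addr0 add0r. Qed.
Lemma upperD n (x y : 'cV[V]_n) : upper x *m upper y = upper (x + y).
Proof. by rewrite /upper mulmx_block !mul1mx !mul0mx !mulmx0 !mulmx1 !addr0 !add0r addrC. Qed.
Lemma lower0 n : lower (0 : 'rV[V]_n) = 1%:M.
Proof. by rewrite /lower -scalar_mx_block. Qed.
Lemma upper0 n : upper (0 : 'cV[V]_n) = 1%:M.
Proof. by rewrite /upper -scalar_mx_block. Qed.
Lemma mul_lower n (q x : 'rV[V]_n) a : row_mx q a%:M *m lower x = row_mx (q + a *: x) a%:M.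
Proof. by rewrite mul_row_block !mulmx1 mulmx0 add0r mul_scalar_mx. Qed.
Lemma mul_upper n (q : 'rV[V]_n) y a :
  row_mx q a%:M *m upper y = row_mx q ((q *m y) 0 0 + a)%:M.
Proof.
by rewrite mul_row_block !mulmx1 mulmx0 addr0 raddfD /= -mx11_scalar.
Qed.
Lemma mxin_lower n D (x : 'rV[V]_n) : subr D -> mxin D x -> mxin D (lower x).
Proof. by move=> sD h; apply: mxin_block; rewrite //; try apply: mxin1; try apply: mxin0. Qed.
Lemma mxin_upper n D (x : 'cV[V]_n) : subr D -> mxin D x -> mxin D (upper x).
Proof. by move=> sD h; apply: mxin_block; rewrite //; try apply: mxin1; try apply: mxin0. Qed.

(** Meant for a third argument q + ax: the factors carry (q, a) to (q + ax, a), then to (q + ax, 1)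
    if y takes the value 1 - a there, and finally to (0, 1). *)
Definition transv n (x : 'rV[V]_n) (y : 'cV[V]_n) q := lower x *m upper y *m lower (- q).

Lemma transv0 n (x : 'rV[V]_n) : transv x 0 x = 1%:M.
Proof. by rewrite /transv upper0 mulmx1 lowerD subrr lower0. Qed.
Lemma transvK n (x q : 'rV[V]_n) y : transv x y q *m transv q (- y) x = 1%:M.
Proof.
rewrite /transv !mulmxA -(mulmxA _ (lower (- q))) lowerD addNr lower0 mulmx1.
by rewrite -(mulmxA _ (upper y)) upperD subrr upper0 mulmx1 lowerD subrr lower0.
Qed.
Lemma row_transv n (q x : 'rV[V]_n) y a : ((q + a *: x) *m y) 0 0 + a = 1 ->
  row_mx q a%:M *m transv x y (q + a *: x) = last_row n.
Proof. by move=> E; rewrite !mulmxA mul_lower mul_upper E mul_lower scale1r subrr. Qed.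
Lemma mxin_transv n D (x q : 'rV[V]_n) y : subr D ->
  mxin D x -> mxin D y -> mxin D q -> mxin D (transv x y q).
Proof.
move=> sD hx hy hq; apply: (mxinM sD); first by apply: (mxinM sD); [exact: mxin_lower | exact: mxin_upper].
by apply: mxin_lower => //; apply: mxinN.
Qed.

Lemma last_rowP n m (M : 'M[V]_(n + 1, m + 1)) :
  last_row n *m M = last_row m -> dlsubmx M = 0 /\ drsubmx M = 1%:M.
Proof.
rewrite -{1}[M]submxK /last_row mul_row_block !mul0mx !mul1mx !add0r.
by move/eq_row_mx.
Qed.

Lemma ul_mul l n m (M : 'M[V]_(l + 1, n + 1)) (N : 'M[V]_(n + 1, m + 1)) :
  last_row n *m N = last_row m -> ulsubmx (M *m N) = ulsubmx M *m ulsubmx N.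
Proof.
move/last_rowP => [E _].
by rewrite -{1}[M]submxK -{1}[N]submxK mulmx_block block_mxKul E mulmx0 addr0.
Qed.

End Subrings.

Lemma map_lower (V W : comNzRingType) (f : {rmorphism V -> W}) n (x : 'rV[V]_n) :
  map_mx f (lower x) = lower (map_mx f x).
Proof. by rewrite /lower map_block_mx !map_mx1 map_mx0. Qed.
Lemma map_upper (V W : comNzRingType) (f : {rmorphism V -> W}) n (x : 'cV[V]_n) :
  map_mx f (upper x) = upper (map_mx f x).
Proof. by rewrite /upper map_block_mx !map_mx1 map_mx0. Qed.
Lemma map_transv (V W : comNzRingType) (f : {rmorphism V -> W}) n (x : 'rV[V]_n) y q :
  map_mx f (transv x y q) = transv (map_mx f x) (map_mx f y) (map_mx f q).
Proof. by rewrite /transv !map_mxM !map_lower map_upper map_mxN. Qed.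
Lemma map_last_row (V W : comNzRingType) (f : {rmorphism V -> W}) n :
  map_mx f (last_row V n) = last_row W n.
Proof. by rewrite /last_row map_row_mx map_mx1 map_mx0. Qed.

Lemma fin_common (I : finType) (V : Type) (W : V -> Prop) (op : V -> V -> V) v0
    (D : I -> V -> Prop) :
  W v0 -> (forall v w, W v -> W w -> W (op v w)) ->
  (forall i v w, W v -> W w -> D i v -> D i (op v w) /\ D i (op w v)) ->
  (forall i, exists v, W v /\ D i v) -> exists v, W v /\ forall i, D i v.
Proof.
move=> W0 Wop Dop H.
have [v [Wv Dv]] : exists v, W v /\ forall i, i \in enum I -> D i v.
  elim: (enum I) => [|i s [v [Wv Dv]]]; first by exists v0.
  have [w [Ww Dw]] := H i; exists (op v w); split; first exact: Wop.
  move=> k; rewrite inE => /orP[/eqP->|ks].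
    by have [] := Dop i w v Ww Wv Dw.
  by have [] := Dop k v w Wv Ww (Dv _ ks).
by exists v; split=> // i; apply: Dv; rewrite mem_enum.
Qed.

Section Field.
Variable F : fieldType.
Implicit Types (D B : F -> Prop).

Definition pin D : {poly F} -> Prop := fun f => forall i, D f`_i.

Lemma pin_subr D : subr D -> subr (pin D).
Proof.
move=> sD; split.
- by move=> i; rewrite coef1; case: eqP => _; [apply: subr1 | apply: subr0_in].
- by move=> f g hf hg i; rewrite coefD; apply: subrD.
- by move=> f hf i; rewrite coefN; apply: subrN.
- by move=> f g hf hg i; rewrite coefM; apply: subr_sum => // k _; apply: subrM.
Qed.
Lemma pinC D c : subr D -> D c -> pin D c%:P.
Proof. by move=> sD Dc i; rewrite coefC; case: eqP => // _; apply: subr0_in. Qed.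
Lemma pinX D : subr D -> pin D 'X.
Proof. by move=> sD i; rewrite coefX; case: eqP => _; [apply: subr1 | apply: subr0_in]. Qed.
Lemma pin_horner D f t : subr D -> pin D f -> D t -> D f.[t].
Proof.
move=> sD hf Dt; rewrite horner_coef; apply: subr_sum => // i _.
by apply: subrM => //; apply: subrX.
Qed.
Lemma pin_mono D D' f : le D D' -> pin D f -> pin D' f.
Proof. by move=> h hf i; apply: h. Qed.
Lemma mxin_mono (V : comNzRingType) m n (D D' : V -> Prop) (M : 'M[V]_(m, n)) :
  le D D' -> mxin D M -> mxin D' M.
Proof. by move=> h hM i k; apply: h. Qed.

Definition ev m n (t : F) (M : 'M[{poly F}]_(m, n)) := map_mx (horner_eval t) M.

Lemma evM m n l t (M : 'M[{poly F}]_(m, n)) (N : 'M[{poly F}]_(n, l)) :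
  ev t (M *m N) = ev t M *m ev t N.
Proof. exact: map_mxM. Qed.
Lemma ev1 n t : ev t (1%:M : 'M[{poly F}]_n) = 1%:M.
Proof. exact: map_mx1. Qed.
Lemma ev_const m n t (M : 'M[F]_(m, n)) : ev t (map_mx polyC M) = M.
Proof. by apply/matrixP => i k; rewrite !mxE /horner_eval hornerC. Qed.
Lemma evZ m n t c (M : 'M[{poly F}]_(m, n)) : ev t (c%:P *: M) = c *: ev t M.
Proof. by rewrite /ev map_mxZ /= /horner_eval hornerC. Qed.
Lemma ev_map_poly (B : comNzRingType) (f : {rmorphism B -> F}) m n t
    (M : 'M[{poly B}]_(m, n)) :
  ev (f t) (map_mx (map_poly f) M) = map_mx f (map_mx (horner_eval t) M).
Proof. by apply/matrixP => i k; rewrite !mxE /horner_eval horner_map. Qed.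
Lemma mxin_ev m n D t (M : 'M[{poly F}]_(m, n)) : subr D -> D t ->
  mxin (pin D) M -> mxin D (ev t M).
Proof. by move=> sD Dt h i k; rewrite mxE /horner_eval; apply: pin_horner. Qed.
Lemma mxin_const m n D (M : 'M[F]_(m, n)) : subr D -> mxin D M -> mxin (pin D) (map_mx polyC M).
Proof. by move=> sD h i k; rewrite mxE; apply: pinC. Qed.

(** The inverse path is part of the data since its coefficients must lie in [D] as well. *)
Definition isotopic D r (s : 'M[F]_r) := exists G H : 'M[{poly F}]_r,
  [/\ mxin (pin D) G, mxin (pin D) H, G *m H = 1%:M, ev 0 G = 1%:M & ev 1 G = s].

Lemma isotopicM D r (s t : 'M[F]_r) : subr D ->
  isotopic D s -> isotopic D t -> isotopic D (s *m t).
Proof.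
move=> sD [G [H [hG hH GH G0 G1]]] [G' [H' [hG' hH' GH' G0' G1']]].
have sp := pin_subr sD; exists (G *m G'), (H' *m H); split.
- exact: mxinM.
- exact: mxinM.
- by rewrite mulmxA -(mulmxA G) GH' mulmx1.
- by rewrite evM G0 G0' mulmx1.
- by rewrite evM G1 G1'.
Qed.
Lemma isotopic_mono D D' r (s : 'M[F]_r) : le D D' -> isotopic D s -> isotopic D' s.
Proof.
move=> h [G [H [hG hH GH G0 G1]]]; exists G, H; split=> //.
  by apply: mxin_mono hG => f; apply: pin_mono.
by apply: mxin_mono hH => f; apply: pin_mono.
Qed.
Lemma isotopic_inv D r (s t : 'M[F]_r) : s *m t = 1%:M -> isotopic D s -> isotopic D t.
Proof.
move=> st [G [H [hG hH GH G0 G1]]]; exists H, G; split=> //; first exact: mulmx1C.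
  by rewrite -[ev 0 H]mul1mx -G0 -evM GH ev1.
have E : ev 1 H *m s = 1%:M by rewrite -G1 -evM (mulmx1C GH) ev1.
by rewrite -[ev 1 H]mulmx1 -st mulmxA E mul1mx.
Qed.

(* The transvections reducing the last row to (0, 1) are trivial where it already
   is (0, 1), so they straighten a path without moving its endpoints. *)
Lemma stable_isotopic D r (G H : 'M[{poly F}]_(r + 1)) : subr D ->
  mxin (pin D) G -> mxin (pin D) H -> G *m H = 1%:M ->
  ev 0 G = 1%:M -> last_row F r *m ev 1 G = last_row F r ->
  (forall (q : 'rV[{poly F}]_r) a (psi : 'cV_r) y, mxin (pin D) q -> pin D a ->
     mxin (pin D) psi -> pin D y -> (q *m psi) 0 0 + a * y = 1 ->
     exists (x : 'rV_r) (psi' : 'cV_r), [/\ mxin (pin D) x, mxin (pin D) psi' &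
       ((q + a *: x) *m psi') 0 0 = 1]) ->
  isotopic D (ulsubmx (ev 1 G)).
Proof.
move=> sD hG hH GH G0 G1 good; have sp := pin_subr sD.
pose q : 'rV[{poly F}]_r := dlsubmx G; pose a := drsubmx G 0 0.
have wE : last_row _ r *m G = row_mx q a%:M.
  by rewrite -[G]submxK /last_row mul_row_block !mul0mx !mul1mx !add0r -mx11_scalar.
have hq : mxin (pin D) q by exact: mxin_dl.
have ha : pin D a by exact: mxin_dr.
have [//|//||||x [psi [hx hpsi E]]] := good q a (ursubmx H) (drsubmx H 0 0).
- exact: mxin_ur.
- exact: mxin_dr.
- have E : drsubmx (G *m H) = dlsubmx G *m ursubmx H + drsubmx G *m drsubmx H.
    by rewrite -{1}[G]submxK -{1}[H]submxK mulmx_block block_mxKdr.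
  have := congr1 (fun M : 'M_1 => M 0 0) E.
  rewrite GH (scalar_mx_block r 1) block_mxKdr entryD mxE eqxx mulr1n => ->.
  by congr (_ + _); rewrite [RHS]mxE big_ord1.
pose q' := q + a *: x.
have hq' : mxin (pin D) q' by apply: mxinD => //; apply: mxinZ.
(* The factor 1 - a gives the value that [row_transv] requires and vanishes at both ends of the
   path, where the last row is (0, 1). *)
pose y := (1 - a) *: psi.
have hy : mxin (pin D) y by apply: mxinZ => //; apply: (subrB sp) => //; exact: (subr1 sp).
pose t := transv x y q'; pose t' := transv q' (- y) x.
have tt' : t *m t' = 1%:M by exact: transvK.
have wt : row_mx q a%:M *m t = last_row _ r.
  by apply: row_transv; rewrite -scalemxAr entryZ E mulr1 subrK.
have ht : mxin (pin D) t by exact: mxin_transv.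
have ht' : mxin (pin D) t' by apply: mxin_transv => //; apply: mxinN.
have evt c : last_row F r *m ev c G = last_row F r -> ev c t = 1%:M.
  move=> Ec; have : row_mx (ev c q) (horner_eval c a)%:M = row_mx 0 1%:M.
    rewrite -/(last_row F r) -Ec -(map_last_row (horner_eval c)) -[map_mx _ _]/(ev c _) -evM wE.
    by rewrite /ev map_row_mx map_scalar_mx.
  move/eq_row_mx => [q0 /(congr1 (fun M : 'M_1 => M 0 0))]; rewrite !mxE mulr1n => a1.
  have a1' : a.[c] = 1 := a1.
  have yc : ev c y = 0 by rewrite /ev /y map_mxZ /= /horner_eval hornerD hornerN hornerC a1' subrr scale0r.
  have q'c : ev c q' = ev c x.
    by rewrite /ev /q' map_mxD map_mxZ -/(ev c q) q0 /= /horner_eval a1' scale1r add0r.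
  by rewrite /t /ev map_transv -!/(ev c _) yc q'c transv0.
have eGt : last_row _ r *m (G *m t) = last_row _ r by rewrite mulmxA wE wt.
have inv : (G *m t) *m (t' *m H) = 1%:M.
  by rewrite mulmxA -(mulmxA G) tt' mulmx1.
have et'H : last_row _ r *m (t' *m H) = last_row _ r.
  by rewrite -{1}eGt -mulmxA inv mulmx1.
exists (ulsubmx (G *m t)), (ulsubmx (t' *m H)); split.
- by apply: mxin_ul; apply: mxinM.
- by apply: mxin_ul; apply: mxinM.
- by rewrite -ul_mul // inv (scalar_mx_block r 1) block_mxKul.
- rewrite /ev map_ulsubmx -/(ev 0 _) evM G0 evt ?mulmx1 //; last by rewrite G0 mulmx1.
  by rewrite (scalar_mx_block r 1) block_mxKul.
- by rewrite /ev map_ulsubmx -/(ev 1 _) evM evt // mulmx1.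
Qed.

Section Splitting.
Variables (B : F -> Prop) (x y g : F).
Hypotheses (sB : subr B) (Bx : B x) (By : B y) (gE : g = 1 - x * y).

Lemma geometric t n : B t -> exists w, B w /\ 1 - t ^+ n = (1 - t) * w.
Proof.
move=> Bt; exists (\sum_(i < n) t ^+ i); split; last by rewrite -opprB subrX1 -mulNr opprB.
by apply: subr_sum => // i _; apply: subrX.
Qed.

Lemma comaximal_pow N : exists l m u, [/\ B m, B u, l = x ^+ N * m & 1 - l = g ^+ N * u].
Proof.
have Ba : B (x * y) by exact: subrM.
have [w [Bw Ew]] := geometric N Ba.
have [w' [Bw' Ew']] := geometric N (subrB sB (subr1 sB) (subrX N sB Ba)).
(* This l is divisible by (xy)^N, and 1 - l = (1 - (xy)^N)^N is divisible by (1 - xy)^N. *)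
exists (1 - (1 - (x * y) ^+ N) ^+ N), (y ^+ N * w'), (w ^+ N); split.
- by apply: subrM => //; apply: subrX.
- exact: subrX.
- by rewrite Ew' opprB addrC subrK exprMn mulrA.
- by rewrite opprB addrC subrK Ew exprMn gE.
Qed.

Definition locw w : F -> Prop := fun t => exists n, B (t * w ^+ n).

Lemma locw_subr w : B w -> subr (locw w).
Proof.
move=> Bw; split.
- by exists 0%N; rewrite expr0 mulr1; apply: subr1.
- move=> s t [n Bs] [m Bt]; exists (n + m)%N; rewrite exprD.
  have -> : (s + t) * (w ^+ n * w ^+ m) = s * w ^+ n * w ^+ m + t * w ^+ m * w ^+ n by ring.
  by apply: subrD => //; apply: subrM => //; apply: subrX.
- by move=> s [n Bs]; exists n; rewrite mulNr; apply: subrN.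
- move=> s t [n Bs] [m Bt]; exists (n + m)%N; rewrite exprD mulrACA.
  exact: subrM.
Qed.
Lemma le_locw w : le B (locw w).
Proof. by move=> t Bt; exists 0%N; rewrite expr0 mulr1. Qed.
Lemma locw_leq w t n m : B w -> (n <= m)%N -> B (t * w ^+ n) -> B (t * w ^+ m).
Proof.
by move=> Bw /subnKC <- Bt; rewrite exprD mulrA; apply: subrM => //; apply: subrX.
Qed.

Lemma locw_cap t : locw x t -> locw g t -> B t.
Proof.
have Bg : B g by rewrite gE; apply: subrB => //; [apply: subr1 | apply: subrM].
move=> [n Bn] [m Bm]; have [l [u [v [Bu Bv El El']]]] := comaximal_pow (maxn n m).
have -> : t = (t * x ^+ maxn n m) * u + (t * g ^+ maxn n m) * v.
  by rewrite -!mulrA -El -El' -mulrDr addrC subrK mulr1.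
apply: subrD => //; apply: subrM => //.
  by apply: locw_leq Bn => //; apply: leq_maxl.
by apply: locw_leq Bm => //; apply: leq_maxr.
Qed.

Definition dil (l : F) (f : {poly F}) := f \Po (l *: 'X).

Lemma coef_dil l f i : (dil l f)`_i = f`_i * l ^+ i.
Proof.
have -> : dil l f = \poly_(k < size f) (f`_k * l ^+ k).
  rewrite /dil comp_polyE poly_def; apply: eq_bigr => k _.
  by rewrite exprZn scalerA.
by rewrite coef_poly; case: ltnP => // fi; rewrite nth_default ?mul0r.
Qed.

Lemma pin_bound (I : finType) (f : I -> {poly F}) w : B w -> (forall i, pin (locw w) (f i)) ->
  exists m, forall i l, B ((f i)`_l * w ^+ m).
Proof.
move=> Bw hf.
have [|m [_ Hm]] := @fin_common I nat (fun _ => True) maxn 0%N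
    (fun i m => forall l, B ((f i)`_l * w ^+ m)) Logic.I (fun _ _ _ _ => Logic.I)
    (fun i v u _ _ h => conj (fun l => locw_leq Bw (leq_maxl v u) (h l))
                             (fun l => locw_leq Bw (leq_maxr u v) (h l))).
  move=> i.
  have [|m [_ Hm]] := @fin_common 'I_(size (f i)) nat (fun _ => True) maxn 0%N
    (fun l m => B ((f i)`_l * w ^+ m)) Logic.I (fun _ _ _ _ => Logic.I)
    (fun l v u _ _ h => conj (locw_leq Bw (leq_maxl v u) h) (locw_leq Bw (leq_maxr u v) h)).
    by move=> l; have [n Bn] := hf i l; exists n.
  exists m; split=> // l; have [sl|ls] := leqP (size (f i)) l.
    by rewrite nth_default // mul0r; apply: subr0_in.
  exact: (Hm (Ordinal ls)).
by exists m.
Qed.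

(** With l divisible by a high power of x and 1 - l by one of g, the factor a = G(l) differs from 1
    by multiples of x^K with only powers of g as denominators, while G(T)G(lT)^-1 has only powers of
    x as denominators and joins 1 to G(1)G(l)^-1. *)
Lemma quillen_split r (G H : 'M[{poly F}]_r) K :
  mxin (pin (locw (x * g))) G -> mxin (pin (locw (x * g))) H -> G *m H = 1%:M ->
  ev 0 G = 1%:M ->
  exists a a', [/\ a *m a' = 1%:M,
    (forall i k, exists m b, B b /\ (a - 1%:M) i k * g ^+ m = x ^+ K * b),
    (forall i k, exists m b, B b /\ (a' - 1%:M) i k * g ^+ m = x ^+ K * b) &
    isotopic (locw x) (ev 1 G *m a')].
Proof.
move=> hG hH GH G0.
have sL := locw_subr Bx.
have H0 : ev 0 H = 1%:M by rewrite -[ev 0 H]mul1mx -G0 -evM GH ev1.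
have Bg : B g by rewrite gE; apply: subrB => //; [apply: subr1 | apply: subrM].
have Bxg : B (x * g) by exact: subrM.
have [m1 Hm1] := @pin_bound _ (fun ik : 'I_r * 'I_r => G ik.1 ik.2) _ Bxg
                  (fun ik => hG ik.1 ik.2).
have [m2 Hm2] := @pin_bound _ (fun ik : 'I_r * 'I_r => H ik.1 ik.2) _ Bxg
                  (fun ik => hH ik.1 ik.2).
pose m := maxn m1 m2.
have hGm i k l : B ((G i k)`_l * (x * g) ^+ m).
  by apply: locw_leq (Hm1 (i, k) l) => //; apply: leq_maxl.
have hHm i k l : B ((H i k)`_l * (x * g) ^+ m).
  by apply: locw_leq (Hm2 (i, k) l) => //; apply: leq_maxr.
(* One [m] clears the denominators of a coefficient of [G] or [H], two clear those of a product of
   such coefficients; [K] is the prescribed order of contact with 1. *)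
have [l [u [v [Bu Bv El El']]]] := comaximal_pow (m + m + K).
have Bl : B l by rewrite El; apply: subrM => //; apply: subrX.
have near1 (M : 'M[{poly F}]_r) : ev 0 M = 1%:M ->
    (forall i k j, B ((M i k)`_j * (x * g) ^+ m)) ->
    forall i k, exists n b, B b /\ (ev l M - 1%:M) i k * g ^+ n = x ^+ K * b.
  move=> M0 hM i k; exists m.
  have Mik : (M i k)`_0 = (1%:M : 'M[F]_r) i k.
    by rewrite -M0 mxE /horner_eval horner_coef0.
  exists (\sum_(j < (size (M i k)).-1)
     ((M i k)`_j.+1 * (x * g) ^+ m) * (l ^+ j * u * x ^+ m)); split.
    by apply: subr_sum => // j _; do ![apply: subrM => //]; apply: subrX.
  have -> : (ev l M - 1%:M) i k = \sum_(j < (size (M i k)).-1) (M i k)`_j.+1 * l ^+ j.+1.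
    rewrite mxE [X in _ + X]mxE -Mik mxE /horner_eval horner_coef.
    case: (size (M i k)) (size_poly0 F) (@size_poly_eq0 _ (M i k)) => [_ /esym/eqP ->|n _ _].
      by rewrite !big_ord0 coef0 subr0.
    by rewrite big_ord_recl /= expr0 mulr1 addrC addKr.
  rewrite mulr_suml mulr_sumr; apply: eq_bigr => j _.
  rewrite exprS {1}El exprMn !exprD; ring.
exists (ev l G), (ev l H); split.
- by rewrite -evM GH ev1.
- exact: near1.
- exact: near1.
pose Gl := map_mx (dil l) G; pose Hl := map_mx (dil l) H.
have GHl : Gl *m Hl = 1%:M by rewrite /Gl /Hl -map_mxM GH map_mx1.
have evl (M : 'M[{poly F}]_r) c : ev c (map_mx (dil l) M) = ev (l * c) M.
  by apply/matrixP => i k; rewrite !mxE /horner_eval /dil horner_comp hornerZ hornerX.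
have diff (P Q : {poly F}) : (forall p, B (P`_p * (x * g) ^+ m)) ->
    (forall p, B (Q`_p * (x * g) ^+ m)) -> pin (locw x) ((P - dil l P) * dil l Q).
  move=> hP hQ i; rewrite coefM; apply: subr_sum => // p _; exists (m + m)%N.
  rewrite coefB !coef_dil; have [w [Bw Ew]] := geometric p Bl.
  have -> : (P`_p - P`_p * l ^+ p) * (Q`_(i - p) * l ^+ (i - p)) * x ^+ (m + m) =
      (P`_p * (x * g) ^+ m) * (Q`_(i - p) * (x * g) ^+ m) * (g ^+ K * v * w * l ^+ (i - p)).
    have -> : P`_p - P`_p * l ^+ p = P`_p * (1 - l ^+ p) by ring.
    by rewrite Ew El' !exprMn !exprD; ring.
  by do ![apply: subrM => //]; apply: subrX.
exists (G *m Hl), (Gl *m H); split.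
- have -> : G *m Hl = 1%:M + (G - Gl) *m Hl by rewrite mulmxBl GHl addrC subrK.
  apply: mxinD; [exact: pin_subr sL | exact: (mxin1 (pin_subr sL)) |].
  move=> i k; rewrite mxE; apply: (@subr_sum _ (pin (locw x)) _ _ _ _ (pin_subr sL)) => t _.
  by rewrite !mxE; apply: diff.
- have -> : Gl *m H = 1%:M + Gl *m (H - Hl) by rewrite mulmxBr GHl addrC subrK.
  apply: mxinD; [exact: pin_subr sL | exact: (mxin1 (pin_subr sL)) |].
  move=> i k; rewrite mxE; apply: (@subr_sum _ (pin (locw x)) _ _ _ _ (pin_subr sL)) => t _.
  by rewrite !mxE mulrC; apply: diff.
- by rewrite mulmxA -(mulmxA G) (mulmx1C GHl) mulmx1.
- by rewrite evM evl mulr0 G0 H0 mulmx1.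
- by rewrite evM evl mulr1.
Qed.

End Splitting.
End Field.

(** * Isotopies over localized polynomial and Laurent rings *)

Section Localization.
Variables (B : comNzRingType) (F : fieldType) (f : {rmorphism B -> F}) (W : B -> Prop).
Hypotheses (mW : is_monoid W) (W0 : forall w, W w -> f w != 0).

Definition locp (y : F) := exists b w, W w /\ y * f w = f b.

Lemma locp_subr : subr locp.
Proof.
have [W1 WM] := mW; split.
- by exists 1, 1; rewrite rmorph1 mulr1.
- move=> x y [b [w [Ww E]]] [c [v [Wv E']]]; exists (b * v + c * w), (w * v).
  split; first exact: WM.
  by rewrite rmorphD !rmorphM -E -E'; ring.
- by move=> x [b [w [Ww E]]]; exists (- b), w; rewrite rmorphN -E mulNr.
- move=> x y [b [w [Ww E]]] [c [v [Wv E']]]; exists (b * c), (w * v).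
  split; first exact: WM.
  by rewrite !rmorphM -E -E'; ring.
Qed.
Lemma locp_im b : locp (f b).
Proof. by exists b, 1; rewrite rmorph1 mulr1; case: mW. Qed.
Lemma locpV w b : W w -> locp (f b / f w).
Proof. by move=> Ww; exists b, w; split=> //; rewrite mulfVK // W0. Qed.

Let common (I : finType) (D : I -> B -> Prop) :
  (forall i v w, D i v -> D i (w * v)) ->
  (forall i, exists v, W v /\ D i v) -> exists v, W v /\ forall i, D i v.
Proof.
move=> h; apply: (@fin_common _ _ W *%R 1) => //; try by case: mW.
by move=> i v w _ _ Dv; split; [rewrite mulrC|]; apply: h.
Qed.

Lemma clear_mx m n (M : 'M[F]_(m, n)) : mxin locp M ->
  exists w (M0 : 'M[B]_(m, n)), W w /\ f w *: M = map_mx f M0.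
Proof.
move=> hM.
have [||w [Ww H]] := @common ('I_m * 'I_n)%type
    (fun ik w => exists b, f w * M ik.1 ik.2 = f b).
- by move=> ik v u [b E]; exists (u * b); rewrite !rmorphM -mulrA E.
- by move=> [i k]; have [b [w [Ww E]]] := hM i k; exists w; split=> //; exists b; rewrite -E mulrC.
have [g Hg] := fin_all_exists H.
exists w, (\matrix_(i, k) g (i, k)); split=> //.
by apply/matrixP => i k; rewrite !mxE (Hg (i, k)).
Qed.

Lemma clear_poly m n (M : 'M[{poly F}]_(m, n)) : mxin (pin locp) M ->
  exists w (M0 : 'M[{poly B}]_(m, n)), W w /\ (f w)%:P *: M = map_mx (map_poly f) M0.
Proof.
move=> hM.
have [||w [Ww H]] := @common ('I_m * 'I_n)%type
    (fun ik w => exists g, (f w)%:P * M ik.1 ik.2 = map_poly f g).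
- move=> ik v u [g E]; exists (u%:P * g).
  by rewrite !rmorphM -mulrA E /= map_polyC.
- move=> [i k].
  have [||w [Ww H]] := @common 'I_(size (M i k)) (fun l w => exists b, f w * (M i k)`_l = f b).
  + by move=> l v u [b E]; exists (u * b); rewrite !rmorphM -mulrA E.
  + by move=> l; have [b [w [Ww E]]] := hM i k l; exists w; split=> //; exists b; rewrite -E mulrC.
  exists w; split=> //; have [g Hg] := fin_all_exists H.
  exists (\poly_(l < size (M i k)) if insub l is Some l' then g l' else 0).
  apply/polyP => l; rewrite coefCM coef_map coef_poly.
  have [ls|sl] := ltnP l (size (M i k)); last by rewrite nth_default //= mulr0 rmorph0.
  by rewrite (insubT (fun l => l < _)%N ls) /= -(Hg (Sub l ls)).
have [g Hg] := fin_all_exists H.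
exists w, (\matrix_(i, k) g (i, k)); split=> //.
by apply/matrixP => i k; rewrite !mxE (Hg (i, k)).
Qed.

Lemma clear_pair m n k l (P : 'M[{poly F}]_(m, n)) (Q : 'M[{poly F}]_(k, l)) :
  mxin (pin locp) P -> mxin (pin locp) Q -> exists w P0 Q0,
  [/\ W w, (f w)%:P *: P = map_mx (map_poly f) P0 & (f w)%:P *: Q = map_mx (map_poly f) Q0].
Proof.
move=> /clear_poly [w [P0 [Ww EP]]] /clear_poly [v [Q0 [Wv EQ]]].
exists (w * v), (v%:P *: P0), (w%:P *: Q0); split; first exact: (proj2 mW).
  by rewrite map_mxZ -EP scalerA /= map_polyC rmorphM polyCM mulrC.
by rewrite map_mxZ -EQ scalerA /= map_polyC rmorphM polyCM.
Qed.

Hypothesis f_inj : injective f.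

Lemma map_poly_injf : injective (map_poly f).
Proof.
move=> p q E; apply/polyP => i; apply: f_inj.
by rewrite -!coef_map E.
Qed.

Lemma stable_loc r : Kd (fun y : {poly B} => y = 0) (fun y => exists w, W w /\ y = w%:P) r ->
  forall (q : 'rV[{poly F}]_r) a (psi : 'cV_r) y, mxin (pin locp) q -> pin locp a ->
     mxin (pin locp) psi -> pin locp y -> (q *m psi) 0 0 + a * y = 1 ->
     exists (x : 'rV_r) (psi' : 'cV_r), [/\ mxin (pin locp) x, mxin (pin locp) psi' &
       ((q + a *: x) *m psi') 0 0 = 1].
Proof.
move=> K q a psi y hq ha hpsi hy E1; have sp := pin_subr locp_subr.
have scal c : pin locp c -> mxin (pin locp) (c%:M : 'M_1).
  by move=> h i k; rewrite !ord1 mxE eqxx.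
have [w1 [q1 [A1 [Ww1 Eq EA]]]] := clear_pair hq (scal _ ha).
have [w2 [psi2 [Y2 [Ww2 Epsi EY]]]] := clear_pair hpsi (scal _ hy).
pose phi : {rmorphism {poly B} -> {poly F}} := map_poly f.
have Ea : (f w1)%:P * a = phi (A1 0 0).
  by have := congr1 (fun M : 'M_1 => M 0 0) EA; rewrite !mxE eqxx mulr1n.
have Ey : (f w2)%:P * y = phi (Y2 0 0).
  by have := congr1 (fun M : 'M_1 => M 0 0) EY; rewrite !mxE eqxx mulr1n.
have mS : is_monoid (fun y : {poly B} => exists w, W w /\ y = w%:P).
  exact: (@monoid_image _ _ polyC W mW).
have G := good_id mS (zero_ideal _) K.
have [||X [psi1 [_ [w3 [Ww3 E3]]]]] :=
  good_unimodular (p := q1) (a := A1 0 0) (psi0 := psi2) (y0 := Y2 0 0) mS G.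
- by rewrite /inP mulmx1.
- exists (w1 * w2); split; first by apply: (proj2 mW).
  apply: map_poly_injf; rewrite rmorphD rmorphM -/phi -Ea -Ey.
  have -> : phi ((q1 *m psi2) 0 0) = (map_mx phi q1 *m map_mx phi psi2) 0 0.
    by rewrite -map_mxM [RHS]mxE.
  rewrite -Eq -Epsi -scalemxAl -scalemxAr !entryZ.
  transitivity ((f w1)%:P * (f w2)%:P * ((q *m psi) 0 0 + a * y)); first by ring.
  by rewrite E1 mulr1 /phi /= map_polyC /= rmorphM polyCM.
have Dphi m n (N : 'M[{poly B}]_(m, n)) : mxin (pin locp) (map_mx phi N).
  by move=> i k l; rewrite mxE coef_map; apply: locp_im.
exists (map_mx phi X), ((f w1 / f w3)%:P *: map_mx phi psi1); split=> //.
  apply: mxinZ => //; apply: pinC; [exact: locp_subr | exact: locpV].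
rewrite -scalemxAr entryZ polyCM -mulrA mulrCA.
have -> : (f w1)%:P * ((q + a *: map_mx phi X) *m map_mx phi psi1) 0 0 =
   phi (((q1 + A1 0 0 *: X) *m psi1) 0 0).
  rewrite -entryZ scalemxAl scalerDr scalerA Eq Ea -map_mxZ -map_mxD -map_mxM.
  by rewrite [LHS]mxE.
by rewrite E3 /phi /= map_polyC /= -polyCM mulVf ?W0.
Qed.

Lemma path_isotopic r (G H : 'M[{poly F}]_(r + 1)) :
  Kd (fun y : {poly B} => y = 0) (fun y => exists w, W w /\ y = w%:P) r ->
  mxin (pin locp) G -> mxin (pin locp) H -> G *m H = 1%:M ->
  ev 0 G = 1%:M -> last_row F r *m ev 1 G = last_row F r ->
  isotopic locp (ulsubmx (ev 1 G)).
Proof.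
move=> K hG hH GH G0 G1; apply: (stable_isotopic locp_subr hG hH GH G0 G1).
exact: stable_loc.
Qed.

End Localization.

Lemma map_mx_injf (U V : Type) (f : U -> V) m n : injective f ->
  injective (fun M : 'M[U]_(m, n) => map_mx f M).
Proof.
move=> f_inj M N E; apply/matrixP => i k; apply: f_inj.
by have := congr1 (fun L : 'M_(m, n) => L i k) E; rewrite !mxE.
Qed.

(** * Contraction of the variable X to 0 *)

Section Contraction.
Variables (R : idomainType) (F : fieldType) (rho : {rmorphism {poly R} -> F}) (S : R -> Prop).
Hypotheses (rho_inj : injective rho) (mS : is_monoid S) (S0 : forall c, S c -> c != 0).

Definition constp (p : {poly R}) := exists c, S c /\ p = c%:P.

Lemma constp_monoid : is_monoid constp.
Proof. exact: (@monoid_image _ _ polyC S mS). Qed.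

Lemma rho_neq0 p : p != 0 -> rho p != 0.
Proof. by apply: contra => /eqP; rewrite -(rmorph0 rho) => /rho_inj ->. Qed.

Lemma constp_neq0 p : constp p -> rho p != 0.
Proof. by move=> [c [Sc ->]]; rewrite rho_neq0 // polyC_eq0 S0. Qed.

Definition B0 := locp rho constp.
Let z := rho 'X.

Lemma B0_subr : subr B0. Proof. exact: locp_subr constp_monoid. Qed.
Lemma B0_rho p : B0 (rho p). Proof. exact: (locp_im rho constp_monoid). Qed.
Lemma B0_div p c : S c -> B0 (rho p / rho c%:P).
Proof. by move=> Sc; apply: (locpV constp_neq0); exists c. Qed.

(* The homotopy p(X) |-> p(z T). *)
Definition stretch : {rmorphism {poly R} -> {poly F}} :=
  comp_poly (z *: 'X) \o map_poly (rho \o polyC).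

Lemma stretch0 p : (stretch p).[0] = rho (p.[0])%:P.
Proof.
rewrite /stretch /= horner_comp hornerZ hornerX mulr0 -[X in _.[X]](rmorph0 (rho \o polyC)).
by rewrite horner_map.
Qed.
Lemma stretch1 p : (stretch p).[1] = rho p.
Proof.
rewrite /stretch /= horner_comp hornerZ hornerX mulr1.
by rewrite -[p in RHS]comp_polyXr /comp_poly -horner_map -map_poly_comp.
Qed.
Lemma pin_stretch p : pin B0 (stretch p).
Proof.
move=> i; rewrite /stretch /= -/(dil z _) coef_dil coef_map /=.
by apply: (subrM B0_subr); [|apply: (subrX _ B0_subr)]; apply: B0_rho.
Qed.

(** [G] is s with X replaced by zT: it runs from the value of s at X = 0 to s. Divided by its start
    it becomes a path from 1, so s is isotopic to 1 as soon as its value at X = 0 is. *)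
Lemma contraction r (s t : 'M[F]_r) c (M : 'M[{poly R}]_r) :
  mxin B0 t -> s *m t = 1%:M -> S c -> rho c%:P *: s = map_mx rho M ->
  isotopic B0 ((rho c%:P)^-1 *: map_mx (fun p => rho (p.[0])%:P) M) ->
  isotopic B0 s.
Proof.
move=> ht st Sc EM iso0.
have [c' [N [[b [Sb ->]] EN]]] := clear_mx constp_monoid ht.
have [c0 b0] : rho c%:P != 0 /\ rho b%:P != 0 by split; apply: constp_neq0; [exists c|exists b].
have MN : M *m N = (c * b)%:P%:M.
  apply: (map_mx_injf rho_inj); rewrite /= map_mxM -EM -EN -scalemxAl -scalemxAr st.
  by rewrite scalerA -rmorphM -polyCM map_scalar_mx scalemx1.
pose G := (rho c%:P)^-1%:P *: map_mx stretch M.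
pose H := (rho b%:P)^-1%:P *: map_mx stretch N.
have stC a : stretch a%:P = (rho a%:P)%:P.
  by rewrite /stretch /= map_polyC comp_polyC.
have GH : G *m H = 1%:M.
  rewrite /G /H -scalemxAl -scalemxAr -map_mxM MN map_scalar_mx stC !polyCM rmorphM polyCM.
  by rewrite scalerA scale_scalar_mx mulrACA -!polyCM !mulVf // mulr1 polyC1.
have hinv a : S a -> pin B0 (rho a%:P)^-1%:P.
  move=> Sa; apply: pinC; first exact: B0_subr.
  by rewrite -[_^-1]mul1r -(rmorph1 rho); apply: B0_div.
have hmap (L : 'M[{poly R}]_r) : mxin (pin B0) (map_mx stretch L).
  by move=> i k; rewrite mxE; apply: pin_stretch.
have sp := pin_subr B0_subr.
have [hG hH] : mxin (pin B0) G /\ mxin (pin B0) H.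
  by split; apply: mxinZ => //; apply: hinv.
have hC (L : 'M_r) : mxin (pin B0) L -> mxin (pin B0) (map_mx polyC (ev 0 L)).
  move=> hL; apply: (mxin_const B0_subr); apply: mxin_ev hL; first exact: B0_subr.
  exact: (subr0_in B0_subr).
have G1 : ev 1 G = s.
  apply: (scalerI c0); rewrite EM; apply/matrixP => i k.
  rewrite !mxE /horner_eval hornerM hornerC stretch1 mulrA mulfV // mul1r //.
have H0 : ev 0 G = (rho c%:P)^-1 *: map_mx (fun p => rho (p.[0])%:P) M.
  by apply/matrixP => i k; rewrite !mxE /horner_eval hornerM hornerC stretch0.
rewrite -H0 in iso0; clear H0.
have s0H : ev 0 G *m ev 0 H = 1%:M by rewrite -evM GH ev1.
have iso1 : isotopic B0 (s *m ev 0 H).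
  exists (G *m map_mx polyC (ev 0 H)), (map_mx polyC (ev 0 G) *m H); split.
  - exact: (mxinM sp hG (hC _ hH)).
  - exact: (mxinM sp (hC _ hG) hH).
  - rewrite mulmxA -(mulmxA G) -map_mxM (mulmx1C s0H) map_mx1 mulmx1 //.
  - by rewrite evM ev_const s0H.
  - by rewrite evM ev_const G1.
have -> : s = (s *m ev 0 H) *m ev 0 G by rewrite -mulmxA (mulmx1C s0H) mulmx1.
by apply: isotopicM => //; apply: B0_subr.
Qed.

Lemma isotopic1 D r : @subr F D -> isotopic D (1%:M : 'M_r).
Proof.
move=> sD; have sp := pin_subr sD.
by exists 1%:M, 1%:M; split; rewrite ?ev1 ?mulmx1 //; apply: mxin1.
Qed.

Lemma contraction1 r (N N' : 'M[F]_r) : mxin B0 N -> mxin B0 N' ->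
  (1%:M + z *: N) *m (1%:M + z *: N') = 1%:M -> isotopic B0 (1%:M + z *: N).
Proof.
move=> hN hN' E; have [c' [N0 [[c [Sc ->]] EN]]] := clear_mx constp_monoid hN.
apply: (contraction (c := c) (M := c%:P%:M + 'X *: N0)) E _ _ _ => //.
- apply: mxinD; [exact: B0_subr | exact: (mxin1 B0_subr) |].
  by apply: mxinZ => //; [apply: B0_subr | apply: B0_rho].
- rewrite scalerDr map_mxD map_scalar_mx scalemx1; congr (_ + _).
  by rewrite map_mxZ -EN !scalerA mulrC.
set M := map_mx _ _; have -> : M = (rho c%:P)%:M.
  apply/matrixP => i k; rewrite !mxE hornerD hornerM hornerX mul0r addr0.
  by rewrite hornerMn hornerC polyCMn rmorphMn.
rewrite scale_scalar_mx mulVf; last by apply: constp_neq0; exists c.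
exact/isotopic1/B0_subr.
Qed.

End Contraction.

Section Isotopy.
Variables (R : idomainType) (d : nat) (s : R) (F : fieldType) (rho : {rmorphism {poly R} -> F}).
Hypotheses (nR : noetherian R) (dimR : dim_lt R d) (d0 : (0 < d)%N).
Hypotheses (rho_inj : injective rho) (SR0 : forall c, SR s c -> c != 0).
Variable r : nat.
Hypothesis dr : (d <= r)%N.

Let S := SR s.
Let mS : is_monoid S. Proof. exact: SR_monoid. Qed.
Let z := rho 'X.
Let D := B0 rho S.
Let sD : subr D. Proof. exact: B0_subr. Qed.
Let z0 : z != 0. Proof. by apply: rho_neq0 => //; rewrite polyX_eq0. Qed.

Definition rho0 : {rmorphism {poly R} -> F} := rho \o (polyC \o horner_eval 0).
Definition rhoC : {rmorphism R -> F} := rho \o polyC.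

(** Straightening over S^-1 R[X] directly may need one more unit of rank. Setting X = 0 in the whole
    path gives a path over S^-1 R, where the dimension is small enough; its end is therefore
    isotopic to 1, and contraction carries this over to the original end. *)
Lemma path_isotopic_poly (G H : 'M[{poly F}]_(r + 1)) :
  mxin (pin D) G -> mxin (pin D) H -> G *m H = 1%:M -> ev 0 G = 1%:M ->
  last_row F r *m ev 1 G = last_row F r -> isotopic D (ulsubmx (ev 1 G)).
Proof.
move=> hG hH GH G0 G1.
have mC := constp_monoid mS; have C0 := constp_neq0 rho_inj SR0.
have [_ [M [[c [Sc ->]] EM]]] := clear_poly mC hG.
have [_ [N [[b [Sb ->]] EN]]] := clear_poly mC hH.
have cn : rho c%:P != 0 by apply: C0; exists c.
have bn : rho b%:P != 0 by apply: C0; exists b.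
have MN : M *m N = (c * b)%:P%:P%:M.
  apply: (map_mx_injf (map_poly_injf rho_inj)); rewrite /= map_mxM -EM -EN.
  rewrite -scalemxAl -scalemxAr GH scalerA scalemx1 map_scalar_mx /= map_polyC /=.
  by rewrite polyCM (rmorphM rho) polyCM.
have M0 : map_mx (horner_eval 0) M = c%:P%:M.
  apply: (map_mx_injf rho_inj); rewrite /= -ev_map_poly rmorph0 -EM evZ G0 scalemx1.
  by rewrite map_scalar_mx.
have M1 : rho c%:P *: ev 1 G = map_mx rho (map_mx (horner_eval 1) M).
  by rewrite -ev_map_poly rmorph1 -EM evZ.
pose Gz := (rho c%:P)^-1%:P *: map_mx (map_poly rho0) M.
pose Hz := (rho b%:P)^-1%:P *: map_mx (map_poly rho0) N.
have rho0C a : rho0 a%:P = rho a%:P by rewrite /rho0 /= /horner_eval hornerC.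
have SRC w : S w -> rhoC w != 0 by move=> Sw; apply: C0; exists w.
pose DR := locp rhoC S.
have sDR : subr DR by exact: locp_subr.
have DRD : le DR D.
  move=> y [a [w [Sw E]]]; exists a%:P, w%:P; split=> //; by exists w.
have GHz : Gz *m Hz = 1%:M.
  rewrite /Gz /Hz -scalemxAl -scalemxAr -map_mxM MN map_scalar_mx /= map_polyC /=.
  rewrite /horner_eval hornerC polyCM (rmorphM rho) polyCM.
  rewrite scalerA scale_scalar_mx mulrACA -!polyCM.
  by rewrite !mulVf // mulr1 polyC1.
have hz (L : 'M[{poly {poly R}}]_(r + 1)) a : S a ->
    mxin (pin DR) ((rho a%:P)^-1%:P *: map_mx (map_poly rho0) L).
  move=> Sa; have sp := pin_subr sDR; apply: mxinZ => //.
    apply: pinC => //; rewrite -[_^-1]mul1r -(rmorph1 rhoC) -/(rhoC a).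
    exact: (locpV SRC).
  move=> i k l; rewrite mxE coef_map /=.
  exact: (locp_im rhoC mS).
have Gz0 : ev 0 Gz = 1%:M.
  rewrite /Gz evZ -[X in ev X _](rmorph0 rho0) ev_map_poly M0 map_scalar_mx rho0C.
  by rewrite scale_scalar_mx mulVf.
have Gz1 : ev 1 Gz = (rho c%:P)^-1 *: map_mx rho0 (map_mx (horner_eval 1) M).
  by rewrite /Gz evZ -[X in ev X _](rmorph1 rho0) ev_map_poly.
have lastM : last_row _ r *m map_mx (horner_eval 1) M = c%:P *: last_row _ r.
  apply: (map_mx_injf rho_inj); rewrite /= map_mxM map_mxZ map_last_row -M1.
  by rewrite -scalemxAr G1.
have last1 : last_row F r *m ev 1 Gz = last_row F r.
  rewrite Gz1 -scalemxAr -(map_last_row rho0) -map_mxM lastM map_mxZ scalerA rho0C.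
  by rewrite mulVf // scale1r.
have iso : isotopic D (ulsubmx (ev 1 Gz)).
  apply: (isotopic_mono DRD); apply: (path_isotopic mS SRC) (GHz) Gz0 last1.
  - by move=> x y /rho_inj /polyC_inj.
  - by apply: (Kd_leq dr); apply: Kd_poly.
  - exact: hz.
  - exact: hz.
apply: (contraction rho_inj mS SR0 (t := ulsubmx (ev 1 H)) (c := c)
          (M := ulsubmx (map_mx (horner_eval 1) M))) => //.
- by apply: mxin_ul; apply: mxin_ev => //; apply: subr1.
- have GH1 : ev 1 G *m ev 1 H = 1%:M by rewrite -evM GH ev1.
  rewrite -ul_mul ?GH1; first by rewrite (scalar_mx_block r 1) block_mxKul.
  by rewrite -{1}G1 -mulmxA GH1 mulmx1.
- by rewrite map_ulsubmx -M1; apply/matrixP => i k; rewrite !mxE.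
move: iso; rewrite Gz1.
have -> // : ulsubmx ((rho c%:P)^-1 *: map_mx rho0 (map_mx (horner_eval 1) M)) =
  (rho c%:P)^-1 *: map_mx (fun p => rho (p.[0])%:P) (ulsubmx (map_mx (horner_eval 1) M)).
by apply/matrixP => i k; rewrite !mxE.
Qed.

(** X is invertible and cannot be set to 0. Inverting [S2] makes the dimension small enough, and the
    isotopy found there splits along z and g: one factor is isotopic to 1 over the Laurent ring, the
    other is defined over S^-1 R[X] and congruent to 1 modulo X, so it contracts. *)
Lemma path_isotopic_laurent (G H : 'M[{poly F}]_(r + 1)) :
  mxin (pin (locw D z)) G -> mxin (pin (locw D z)) H -> G *m H = 1%:M -> ev 0 G = 1%:M ->
  last_row F r *m ev 1 G = last_row F r -> isotopic (locw D z) (ulsubmx (ev 1 G)).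
Proof.
move=> hG hH GH G0 G1.
have Dz : D z by exact: B0_rho.
have sL : subr (locw D z) by exact: locw_subr.
have m2 : is_monoid (S2 s) by exact: S2_monoid.
have n2 w : S2 s w -> rho w != 0.
  move=> [a [b [h [Sb ->]]]]; apply: rho_neq0 => //; rewrite mulf_neq0 //.
    by rewrite expf_neq0 // polyX_eq0.
  apply/eqP => /(congr1 (fun p => p.[0])); rewrite hornerD hornerM hornerX mul0r addr0 !hornerC.
  by apply/eqP/SR0.
pose Dt := locp rho (S2 s).
have LDt : le (locw D z) Dt.
  move=> y [n [p [_ [[c [Sc ->]] E]]]]; exists p, ('X^n * c%:P); split.
    by exists n, c, 0; split=> //; rewrite mulr0 addr0.
  by rewrite -E rmorphM rmorphXn mulrA.
have iso : isotopic Dt (ulsubmx (ev 1 G)).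
  apply: (path_isotopic m2 n2 rho_inj) GH G0 G1.
  - by apply: (Kd_leq dr); apply: Kd_poly2.
  - by apply: mxin_mono hG => f; apply: pin_mono.
  - by apply: mxin_mono hH => f; apply: pin_mono.
case: iso => [P [Q [hP hQ PQ P0 P1]]].
have [_ [P' [Q' [[a [b [h [Sb ->]]]] EP EQ]]]] := clear_pair m2 hP hQ.
have bn : rho b%:P != 0 by apply: (constp_neq0 rho_inj SR0); exists b.
(* Normalizes b + Xh to constant term 1, so that g = 1 - zy is comaximal with z. *)
pose y := - (rho h / rho b%:P).
pose g := 1 - z * y.
have Dy : D y by apply: (subrN sD); apply: (B0_div rho_inj SR0).
have gE : g * rho b%:P = rho (b%:P + 'X * h).
  rewrite /g /y rmorphD rmorphM -/z mulrN opprK mulrDl mul1r; congr (_ + _).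
  by rewrite mulrA divfK.
have Dg : D g by apply: (subrB sD); [apply: subr1 | apply: (subrM sD)].
have coefw (L : 'M[{poly F}]_r) L' :
    (rho ('X^a * (b%:P + 'X * h)))%:P *: L = map_mx (map_poly rho) L' ->
    mxin (pin (locw D (z * g))) L.
  move=> EL k l i; have := congr1 (fun N : 'M_r => N k l) EL.
  rewrite !mxE; set f := L k l; set p := L' k l => E; exists a.+1; rewrite exprMn.
  have -> : f`_i * (z ^+ a.+1 * g ^+ a.+1) = (f`_i * (z ^+ a * g)) * (z * g ^+ a).
    by rewrite !exprS; ring.
  apply: (subrM sD); last by apply: (subrM sD) => //; apply: (subrX _ sD).
  exists (p`_i), b%:P; split; first by exists b.
  rewrite -coef_map -E coefCM rmorphM rmorphXn -gE -/z; ring.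
have [al [al' [E nal nal' isoL]]] :=
  @quillen_split F D z y g sD Dz Dy (erefl _) r P Q 1 (coefw _ _ EP) (coefw _ _ EQ) PQ P0.
set sg := ulsubmx (ev 1 G) in P1 *; rewrite P1 in isoL.
have GH1 : ev 1 G *m ev 1 H = 1%:M by rewrite -evM GH ev1.
have lastH : last_row F r *m ev 1 H = last_row F r by rewrite -{1}G1 -mulmxA GH1 mulmx1.
have sgV : sg *m ulsubmx (ev 1 H) = 1%:M.
  by rewrite -ul_mul // GH1 (scalar_mx_block r 1) block_mxKul.
have hsg : mxin (locw D z) sg by apply: mxin_ul; apply: mxin_ev => //; apply: (subr1 sL).
have hsgV : mxin (locw D z) (ulsubmx (ev 1 H)).
  by apply: mxin_ul; apply: mxin_ev => //; apply: (subr1 sL).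
have iso_sub (t : 'M[F]_r) : isotopic (locw D z) t -> mxin (locw D z) t.
  by move=> [K [_ [hK _ _ _ <-]]]; apply: mxin_ev => //; apply: (subr1 sL).
have hal' : mxin (locw D z) al'.
  rewrite -[al']mul1mx -(mulmx1C sgV) -mulmxA; apply: mxinM => //; exact: iso_sub.
have inv : (sg *m al') *m (al *m ulsubmx (ev 1 H)) = 1%:M.
  by rewrite mulmxA -(mulmxA sg) (mulmx1C E) mulmx1.
have hal : mxin (locw D z) al.
  have -> : al = (al *m ulsubmx (ev 1 H)) *m sg by rewrite -mulmxA (mulmx1C sgV) mulmx1.
  by apply: mxinM => //; apply: iso_sub; apply: isotopic_inv inv isoL.
(* Order of contact 1 suffices: the entries of (t - 1)/z need only powers of z as denominators over
   [D], and also only powers of g, so they lie in [D]. *)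
have div (t : 'M[F]_r) : mxin (locw D z) t ->
    (forall i k, exists m b0, D b0 /\ (t - 1%:M) i k * g ^+ m = z ^+ 1 * b0) ->
    exists N, mxin D N /\ t = 1%:M + z *: N.
  move=> ht nt; exists (z^-1 *: (t - 1%:M)); split; last first.
    by rewrite scalerA mulfV // scale1r addrC subrK.
  move=> i k; rewrite entryZ; apply: (locw_cap sD Dz Dy (erefl _)).
    have [n Dn] : locw D z ((t - 1%:M) i k).
      by apply: mxinD => //; apply: mxinN => //; apply: mxin1.
    by exists n.+1; rewrite [z^-1 * _]mulrC exprS mulrA mulfVK.
  have [m [b0 [Db0 E0]]] := nt i k.
  by exists m; rewrite -mulrA E0 expr1 mulrA mulVf // mul1r.
have [N [hN EN]] := div _ hal nal.
have [N' [hN' EN']] := div _ hal' nal'.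
have isoal : isotopic (locw D z) al.
  apply: (isotopic_mono (@le_locw F D z)).
  by rewrite EN; apply: (contraction1 rho_inj mS SR0 hN hN'); rewrite -EN -EN'.
have -> : sg = (sg *m al') *m al by rewrite -mulmxA (mulmx1C E) mulmx1.
exact: isotopicM.
Qed.

End Isotopy.

(** * Generic freeness *)

Definition principal (F : fieldType) (D : F -> Prop) := forall J : F -> Prop,
  J 0 -> (forall x y, J x -> J y -> J (x + y)) ->
  (forall a x, D a -> J x -> J (a * x)) -> (forall x, J x -> D x) ->
  exists g, J g /\ forall x, J x -> exists a, D a /\ x = a * g.

Section PrincipalSubring.
Variables (F : fieldType) (D : F -> Prop).
Hypotheses (sD : subr D) (pidD : principal D).

Lemma submodule_basis n (M : 'rV[F]_n -> Prop) :
  M 0 -> (forall x y, M x -> M y -> M (x + y)) ->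
  (forall a x, D a -> M x -> M (a *: x)) -> (forall x, M x -> mxin D x) ->
  exists m (B : 'M[F]_(m, n)), [/\ forall i, M (row i B),
    forall x, M x -> exists y : 'rV_m, mxin D y /\ x = y *m B &
    forall y : 'rV_m, y *m B = 0 -> y = 0].
Proof.
elim: n M => [M M0 MD MZ Min|n IH]; last rewrite -[n.+1]/(1 + n)%N => M M0 MD MZ Min.
  exists 0%N, 0; split=> [[]//|x _|y _]; last by apply/rowP => -[].
  by exists 0; split; [apply: mxin0 | apply/rowP => -[]].
pose J c := exists x, M x /\ c = x 0 0.
have [||||g [[x0 [Mx0 Eg]] Hg]] := pidD (J := J).
- by exists 0; rewrite mxE.
- by move=> _ _ [x [Mx ->]] [y [My ->]]; exists (x + y); rewrite mxE; split=> //; apply: MD.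
- by move=> a _ Da [x [Mx ->]]; exists (a *: x); rewrite mxE; split=> //; apply: MZ.
- by move=> _ [x [Mx ->]]; apply: Min.
have first0 (x : 'rV[F]_(1 + n)) : x 0 0 = 0 -> x = row_mx 0 (rsubmx x).
  move=> x00; rewrite -{1}[x]hsubmxK; congr (row_mx _ _).
  by apply/rowP => i; rewrite !mxE ord1 -x00; congr (x _ _); apply: val_inj.
pose M' (x : 'rV_n) := M (row_mx (0 : 'rV_1) x).
have [||||m [B [B1 B2 B3]]] := IH M'.
- by rewrite /M' row_mx0.
- move=> x y Mx My; rewrite /M' (_ : row_mx 0 (x + y) = row_mx 0 x + row_mx 0 y).
    exact: MD.
  by rewrite add_row_mx addr0.
- move=> a x Da Mx; rewrite /M' (_ : row_mx 0 (a *: x) = a *: row_mx 0 x).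
    exact: MZ.
  by rewrite scale_row_mx scaler0.
- by move=> x /Min hx i k; rewrite -(row_mxEr (0 : 'rV_1) x i k); apply: hx.
have [g0|g0] := eqVneq g 0.
  exists m, (row_mx (0 : 'cV_m) B); split.
  - by move=> i; rewrite row_row_mx row0; apply: B1.
  - move=> x Mx; have [a [_ E]] := Hg _ (ex_intro _ x (conj Mx erefl)).
    have Ex : x = row_mx 0 (rsubmx x) by apply: first0; rewrite E g0 mulr0.
    have [|y [hy Ey]] := B2 (rsubmx x); first by rewrite /M' -Ex.
    by exists y; split=> //; rewrite mul_mx_row mulmx0 -Ey.
  - move=> y E; apply: B3; move/(congr1 rsubmx): E.
    by rewrite mul_mx_row row_mxKr linear0.
exists (1 + m)%N, (col_mx x0 (row_mx (0 : 'cV_m) B)); split.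
- move=> i; case: (splitP i) => k Ek.
    have -> : i = lshift m k by apply: val_inj.
    by rewrite rowKu ord1 (_ : row 0 x0 = x0) //; apply/rowP => l; rewrite mxE.
  have -> : i = rshift 1 k by apply: val_inj.
  by rewrite rowKd row_row_mx row0; apply: B1.
- move=> x Mx; have [a [Da E]] := Hg _ (ex_intro _ x (conj Mx erefl)).
  pose x' := x + (- a) *: x0.
  have Mx' : M x' by apply: MD => //; apply: MZ => //; apply: subrN.
  have Ex' : x' = row_mx 0 (rsubmx x').
    by apply: first0; rewrite /x' !mxE E Eg; ring.
  have [|y [hy Ey]] := B2 (rsubmx x'); first by rewrite /M' -Ex'.
  exists (row_mx a%:M y); split.
    move=> i k; rewrite mxE; case: splitP => l _; last exact: hy.
    by rewrite mxE !ord1 eqxx.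
  rewrite mul_row_col mul_scalar_mx mul_mx_row mulmx0 -Ey -Ex' /x' scaleNr.
  by rewrite addrC subrK.
move=> y; rewrite -[y]hsubmxK mul_row_col => E.
have l0 : lsubmx y = 0.
  have x0E : lsubmx x0 = g%:M.
    apply/rowP => i; rewrite !mxE ord1 eqxx mulr1n Eg; congr (x0 _ _).
    exact: val_inj.
  move/(congr1 lsubmx): E; rewrite linearD /= -mulmx_lsub mul_mx_row row_mxKl mulmx0 addr0.
  by rewrite x0E mul_mx_scalar linear0 => /eqP; rewrite scaler_eq0 (negPf g0) => /eqP.
rewrite l0 (B3 (rsubmx y)) ?row_mx0 //.
by move/(congr1 rsubmx): E; rewrite l0 mul0mx add0r mul_mx_row row_mxKr linear0.
Qed.

Lemma projective_free n (e : 'M[F]_n) : mxin D e -> e *m e = e ->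
  exists m (B : 'M[F]_(m, n)) (C : 'M[F]_(n, m)),
    [/\ mxin D B, mxin D C, B *m C = 1%:M & C *m B = e].
Proof.
move=> De ee.
have [||||m [B [B1 B2 B3]]] := @submodule_basis n (fun x => mxin D x /\ x *m e = x).
- by split; [apply: mxin0 | rewrite mul0mx].
- by move=> x y [hx Ex] [hy Ey]; split; [apply: mxinD | rewrite mulmxDl Ex Ey].
- by move=> a x Da [hx Ex]; split; [apply: mxinZ | rewrite -scalemxAl Ex].
- by move=> x [].
have H i : exists y : 'rV_m, mxin D y /\ row i e = y *m B.
  by apply: B2; split; [move=> k l; rewrite mxE | rewrite -row_mul ee].
have [c Hc] := fin_all_exists H.
pose C : 'M_(n, m) := \matrix_i c i.
have CB : C *m B = e.
  by apply/row_matrixP => i; rewrite row_mul rowK; have [_ ->] := Hc i.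
exists m, B, C; split=> //.
- by move=> i k; have [h _] := B1 i; have := h 0 k; rewrite mxE.
- by move=> i k; rewrite mxE; have [h _] := Hc i; apply: h.
apply/eqP; rewrite -subr_eq0; apply/eqP/row_matrixP => i; rewrite row0.
apply: B3; rewrite -row_mul mulmxBl -mulmxA CB mul1mx.
have -> : B *m e = B by apply/row_matrixP => k; rewrite row_mul; have [_ ->] := B1 k.
by rewrite subrr row0.
Qed.

End PrincipalSubring.

(** All nonzero constants are inverted, so pseudo-division acts as division, and a nonzero
    polynomial of least size in [J] generates it. *)
Lemma principal_loc (R : idomainType) (F : fieldType) (rho : {rmorphism {poly R} -> F})
    (D : F -> Prop) : injective rho -> subr D -> (forall p, D (rho p)) ->
  (forall c, c != 0 -> D (rho c%:P)^-1) ->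
  (forall y, D y -> exists p q, [/\ q != 0, D (rho q)^-1 & y * rho q = rho p]) ->
  principal D.
Proof.
move=> rho_inj sD Drho Dinv Dfrac J J0 JD JM Jin.
have [[y [Jy y0]]|none] := EM (exists y, J y /\ y != 0); last first.
  exists 0; split=> // x Jx; exists 0; split; first exact: subr0_in.
  rewrite mulr0; apply: contrapT => /eqP x0; apply: none; by exists x.
have [p [[Jp p0] pmin]] : exists p, (J (rho p) /\ p != 0) /\
    forall q, J (rho q) /\ q != 0 -> (size p <= size q)%N.
  apply: min_size; have [p [q [q0 _ E]]] := Dfrac _ (Jin _ Jy).
  exists p; split; first by rewrite -E mulrC; apply: JM.
  apply: contraNneq y0 => p0; move/eqP: E; rewrite p0 rmorph0 mulf_eq0 => /orP[//|].
  by rewrite (negPf (rho_neq0 rho_inj q0)).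
exists (rho p); split=> // x Jx.
have [p1 [q [q0 Dq E]]] := Dfrac _ (Jin _ Jx).
have [k [h [r [Ediv sr _]]]] := pseudo_div p1 p0.
have r0 : r = 0.
  apply: contrapT => /eqP r0; suff : (size p <= size r)%N by rewrite leqNgt sr.
  apply: pmin; split=> //.
  have -> : r = (lead_coef p ^+ k)%:P * p1 + (- h) * p by rewrite Ediv; ring.
  rewrite rmorphD !rmorphM; apply: JD; last by apply: JM.
  by apply: (JM) => //; rewrite -E mulrC; apply: JM => //; exact: Drho.
have l0 : lead_coef p ^+ k != 0 by rewrite expf_neq0 // lead_coef_eq0.
exists (rho h * (rho q)^-1 * (rho (lead_coef p ^+ k)%:P)^-1); split.
  by apply: subrM => //; [apply: subrM | apply: Dinv].
have lr : rho (lead_coef p ^+ k)%:P != 0 by rewrite rho_neq0 // polyC_eq0.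
have qr := rho_neq0 rho_inj q0.
apply: (mulIf qr); apply: (mulIf lr); rewrite E -rmorphM [p1 * _]mulrC Ediv r0 addr0 rmorphM.
rewrite -!mulrA; congr (_ * _).
rewrite mulrC -!mulrA; field.
by rewrite qr lr.
Qed.

Definition plus1 (V : pzRingType) n (e : 'M[V]_n) : 'M[V]_(n + 1) := block_mx e 0 0 1%:M.

(** * Transvections *)

Section Transvections.
Variables (F : fieldType) (D : F -> Prop) (n : nat) (e : 'M[F]_n).
Hypothesis sD : subr D.

Lemma lower_comm (V : comNzRingType) (f : {rmorphism F -> V}) (x : 'rV[V]_n) : x *m map_mx f e = x ->
  map_mx f (plus1 e) *m lower x = lower x *m map_mx f (plus1 e).
Proof.
move=> Ex; rewrite /plus1 map_block_mx !map_mx0 map_mx1 /lower !mulmx_block.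
by rewrite !mul1mx !mulmx1 !mul0mx !mulmx0 !addr0 !add0r Ex.
Qed.
Lemma upper_comm (V : comNzRingType) (f : {rmorphism F -> V}) (y : 'cV[V]_n) : map_mx f e *m y = y ->
  map_mx f (plus1 e) *m upper y = upper y *m map_mx f (plus1 e).
Proof.
move=> Ey; rewrite /plus1 map_block_mx !map_mx0 map_mx1 /upper !mulmx_block.
by rewrite !mul1mx !mulmx1 !mul0mx !mulmx0 !addr0 !add0r Ey.
Qed.

(** Scaling the three transvections by T joins them to 1. The functional is composed with e so that
    they commute with e + (1), that is, act on its image; t is only a unit, so [y] is divided by
    it. *)
Lemma transvection_path (p x : 'rV[F]_n) (psi : 'cV[F]_n) a t :
  mxin D e -> e *m e = e -> mxin D p -> mxin D x -> mxin D psi -> D a -> D t^-1 -> t != 0 ->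
  p *m e = p -> x *m e = x -> ((p + a *: x) *m psi) 0 0 = t ->
  exists G H : 'M[{poly F}]_(n + 1),
    [/\ mxin (pin D) G, mxin (pin D) H, G *m H = 1%:M, ev 0 G = 1%:M &
     row_mx p a%:M *m ev 1 G = last_row F n /\
     map_mx polyC (plus1 e) *m G = G *m map_mx polyC (plus1 e)].
Proof.
move=> De ee Dp Dx Dpsi Da Dt t0 Pp Px Et; have sp := pin_subr sD.
pose p' := p + a *: x.
have Dp' : mxin D p' by apply: mxinD => //; apply: mxinZ.
have Pp' : p' *m e = p' by rewrite /p' mulmxDl -scalemxAl Pp Px.
pose y : 'cV_n := ((1 - a) * t^-1) *: (e *m psi).
have Dy : mxin D y.
  apply: mxinZ => //; last exact: mxinM.
  by apply: subrM => //; apply: subrB => //; apply: subr1.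
have ey : e *m y = y by rewrite /y -scalemxAr mulmxA ee.
pose X k l (v : 'M[F]_(k, l)) : 'M[{poly F}]_(k, l) := 'X *: map_mx polyC v.
have DX k l (v : 'M_(k, l)) : mxin D v -> mxin (pin D) (X k l v).
  by move=> Dv; apply: mxinZ => //; [apply: pinX | apply: mxin_const].
have evX k l (v : 'M_(k, l)) c : ev c (X k l v) = c *: v.
  by apply/matrixP => i i'; rewrite !mxE /horner_eval hornerM hornerX hornerC.
have XP (v : 'rV_n) : v *m e = v -> X _ _ v *m map_mx polyC e = X _ _ v.
  by move=> Ev; rewrite /X -scalemxAl -map_mxM Ev.
have YP : map_mx polyC e *m X _ _ y = X _ _ y.
  by rewrite /X -scalemxAr -map_mxM ey.
exists (transv (X _ _ x) (X _ _ y) (X _ _ p')), (transv (X _ _ p') (- X _ _ y) (X _ _ x)).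
split; last split.
- by apply: mxin_transv => //; apply: DX.
- by apply: mxin_transv => //; [|apply: mxinN => //|]; apply: DX.
- exact: transvK.
- by rewrite /ev map_transv -!/(ev 0 _) !evX !scale0r transv0.
- rewrite /ev map_transv -!/(ev 1 _) !evX !scale1r; apply: row_transv.
  by rewrite /y -scalemxAr entryZ mulmxA Pp' Et mulfVK // subrK.
- have h1 := lower_comm (XP _ Px); have h2 := upper_comm YP.
  have h3 : map_mx polyC (plus1 e) *m lower (- X _ _ p') = lower (- X _ _ p') *m map_mx polyC (plus1 e).
    by apply: (lower_comm (f := polyC)); rewrite mulNmx XP.
  by rewrite /transv !mulmxA h1 -!mulmxA; congr (_ *m _); rewrite !mulmxA h2 -!mulmxA h3.
Qed.

End Transvections.

(** * Subrings of R[X] and R[X, 1/X] *)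

Definition imA (A : comNzRingType) (F : fieldType) (j : A -> F) (y : F) := exists a, y = j a.

Lemma imA_subr (A : comNzRingType) (F : fieldType) (j : {rmorphism A -> F}) : subr (imA j).
Proof.
split; first by exists 1; rewrite rmorph1.
- by move=> _ _ [a ->] [b ->]; exists (a + b); rewrite rmorphD.
- by move=> _ [a ->]; exists (- a); rewrite rmorphN.
- by move=> _ _ [a ->] [b ->]; exists (a * b); rewrite rmorphM.
Qed.

Lemma imA_comp (R : comNzRingType) (A : comNzRingType) (F : fieldType)
    (rho : {rmorphism {poly R} -> F}) (j : {rmorphism A -> F}) p q :
  (forall c, imA j (rho c%:P)) -> imA j (rho q) -> imA j (rho (p \Po q)).
Proof.
move=> jC jq; have sA := imA_subr j.
rewrite comp_polyE rmorph_sum; apply: subr_sum => // i _.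
by rewrite -mul_polyC rmorphM rmorphXn; apply: subrM => //; apply: subrX.
Qed.

(** Multiplication by x^N turns a polynomial in X into one in xX, which is how elements of R[X] are
    brought into the Rees algebra. *)
Lemma clear_denominators (R : comNzRingType) (x : R) N (p : {poly R}) : (size p <= N)%N ->
  (x ^+ N)%:P * p = (\poly_(i < N) (x ^+ (N - i) * p`_i)) \Po (x%:P * 'X).
Proof.
move=> pN; rewrite -{1}[p]coefK poly_def (big_ord_widen _ (fun i => p`_i *: 'X^i) pN).
rewrite big_mkcond mulr_sumr /comp_poly poly_def rmorph_sum horner_sum /=.
apply: eq_bigr => i _; rewrite map_polyZ map_polyXn hornerZ hornerXn.
have -> : x ^+ N = x ^+ (N - i) * x ^+ i by rewrite -exprD subnK // ltnW.
case: ltnP => [_|/(nth_default 0) ->]; last by rewrite !mulr0 rmorph0 mul0r.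
by rewrite /= -mul_polyC exprMn -polyC_exp !polyCM; ring.
Qed.

Section ReesShape.
Variables (R : idomainType) (A : comNzRingType) (F : fieldType).
Variables (rho : {rmorphism {poly R} -> F}) (g : {rmorphism {poly R} -> A}) (j : {rmorphism A -> F}).
Hypotheses (rho_inj : injective rho) (j_inj : injective j).
Hypothesis jg : forall c, j (g c%:P) = rho c%:P.

Let z := rho 'X.
Local Notation imA := (imA j).

(* A is squeezed between R[xX] and R[X], respectively between R[X, x/X] and R[X, 1/X]. *)
Definition rees_shape :=
  (forall a, exists p, j a = rho p) /\ (exists x a, x != 0 /\ j a = rho (x%:P * 'X)).
Definition ext_rees_shape :=
  [/\ forall a, exists N p, j a * z ^+ N = rho p, exists a, j a = z &
      exists x a, x != 0 /\ j a * z = rho x%:P].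

Lemma imA_const c : imA (rho c%:P). Proof. by exists (g c%:P); rewrite jg. Qed.

Let z0 : z != 0. Proof. by apply: rho_neq0 => //; rewrite polyX_eq0. Qed.

Definition constA (S : R -> Prop) (a : A) := exists c, S c /\ a = g c%:P.

Lemma constA_monoid S : is_monoid S -> is_monoid (constA S).
Proof. exact: (@monoid_image _ _ (g \o polyC) S). Qed.
Lemma constA_neq0 S : (forall c, S c -> c != 0) -> forall a, constA S a -> j a != 0.
Proof. by move=> S0 a [c [Sc ->]]; rewrite jg rho_neq0 // polyC_eq0 S0. Qed.

Lemma rees_clear x a s t (p : {poly R}) : j a = rho (x%:P * 'X) -> s = x * t ->
  imA (rho ((s ^+ size p)%:P * p)).
Proof.
move=> Ea ->; rewrite exprMn mulrC polyCM (mulrC (x ^+ _)%:P) mulrA mulrC.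
rewrite clear_denominators; first by apply: imA_comp; [exact: imA_const | exists a].
by rewrite mulrC mul_polyC size_scale_leq.
Qed.

Lemma ext_rees_rho : ext_rees_shape -> forall p, imA (rho p).
Proof.
move=> [_ [a Ea] _] p; rewrite -[p]comp_polyXr.
by apply: imA_comp; [exact: imA_const | exists a].
Qed.

Let nz (c : R) := c != 0.
Let nzM : is_monoid nz.
Proof. by split; [exact: oner_neq0 | move=> x y; rewrite /nz => *; rewrite mulf_neq0]. Qed.
Let D := locp j (constA nz).
Let sD : subr D. Proof. by apply: locp_subr; apply: constA_monoid. Qed.
Let D_inv c : c != 0 -> D (rho c%:P)^-1.
Proof.
move=> c0; exists 1, (g c%:P); split; first by exists c.
by rewrite jg rmorph1 mulVf // rho_neq0 // polyC_eq0.
Qed.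
Let imA_D y : imA y -> D y.
Proof. by move=> [a ->]; apply: locp_im; apply: constA_monoid. Qed.

(** With the nonzero constants inverted, [A] becomes K[X] or K[X, 1/X] for K the fraction field of
    [R]. These are principal ideal domains, so the image of e is free there; s collects the
    denominators of a basis and of its dual. *)
Lemma free_generic n (e : 'M[A]_n) : rees_shape \/ ext_rees_shape -> e *m e = e ->
  exists s m (B : 'M[F]_(m, n)) (C : 'M[F]_(n, m)),
    [/\ s != 0, B *m C = 1%:M, C *m B = map_mx j e,
        forall i k, imA (B i k * rho s%:P) & forall i k, imA (C i k * rho s%:P)].
Proof.
move=> shape ee.
have H : (forall p, D (rho p)) /\
    (forall y, D y -> exists p q, [/\ q != 0, D (rho q)^-1 & y * rho q = rho p]).
  case: shape => [[h1 [x [a [x0 Ea]]]]|ext].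
    split=> [p|y [b [_ [[c [c0 ->]] E]]]].
      have [b Eb] := rees_clear p Ea (esym (mulr1 x)).
      exists b, (g (x ^+ size p)%:P); split; last by rewrite jg mulrC -rmorphM Eb.
      by exists (x ^+ size p); rewrite /nz expf_neq0.
    have [p Ep] := h1 b; exists p, c%:P; rewrite polyC_eq0 -jg E Ep; split=> //.
    by rewrite jg; apply: D_inv.
  have rA := ext_rees_rho ext; case: ext => h1 [a Ea] [x [b [x0 Eb]]].
  split=> [p|y [b' [_ [[c [c0 ->]] E]]]]; first exact: imA_D.
  have [N [p Ep]] := h1 b'; exists p, (c%:P * 'X^N).
  rewrite mulf_neq0 ?polyC_eq0 ?expf_neq0 ?polyX_eq0 //; split=> //.
    rewrite rmorphM rmorphXn invfM -exprVn; apply: subrM => //; first exact: D_inv.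
    apply: subrX => //; exists b, (g x%:P); split; first by exists x.
    by rewrite jg -Eb mulrC mulfK.
  by rewrite rmorphM rmorphXn mulrA -jg E Ep.
have [Drho Dfrac] := H.
have pid := principal_loc rho_inj sD Drho D_inv Dfrac.
have EE : map_mx j e *m map_mx j e = map_mx j e by rewrite -map_mxM ee.
have De : mxin D (map_mx j e) by move=> i k; rewrite mxE; apply: imA_D; exists (e i k).
have [m [B [C [DB DC BC CB]]]] := projective_free sD pid De EE.
have mA := constA_monoid nzM.
have [_ [B1 [[b [b0 ->]] EB]]] := clear_mx mA DB.
have [_ [C1 [[c [c0 ->]] EC]]] := clear_mx mA DC.
exists (b * c), m, B, C; split=> //; first by rewrite mulf_neq0.
  move=> i k; have := congr1 (fun M : 'M_(m, n) => M i k) EB; rewrite !mxE jg => E.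
  rewrite polyCM rmorphM mulrA [B i k * _]mulrC E; apply: (subrM (imA_subr j)); last exact: imA_const.
  by exists (B1 i k).
move=> i k; have := congr1 (fun M : 'M_(n, m) => M i k) EC; rewrite !mxE jg => E.
rewrite [b * c]mulrC polyCM rmorphM mulrA [C i k * _]mulrC E.
by apply: (subrM (imA_subr j)); [exists (C1 i k) | exact: imA_const].
Qed.

Variable d : nat.
Hypotheses (nR : noetherian R) (dimR : dim_lt R d) (d0 : (0 < d)%N).

(* The localization A_{s(1+sR)}, in which stably trivial automorphisms of free
   modules of rank at least d are isotopic to the identity. *)
Definition good_overlap s (C : F -> Prop) :=
  [/\ subr C, forall y, imA y -> C y, forall c, SR s c -> C (rho c%:P)^-1,
      forall y, C y -> locp j (constA (SR s)) y &
      forall r, (d <= r)%N -> forall G H : 'M[{poly F}]_(r + 1),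
        mxin (pin C) G -> mxin (pin C) H -> G *m H = 1%:M -> ev 0 G = 1%:M ->
        last_row F r *m ev 1 G = last_row F r -> isotopic C (ulsubmx (ev 1 G))].

(** x is the nonzero element with xX, respectively x/X, in [A]: once a multiple of x is inverted,
    [A] fills up the polynomial, respectively Laurent polynomial, ring. *)
Lemma exists_overlap : rees_shape \/ ext_rees_shape -> exists x, x != 0 /\
  forall t, (forall c, SR (x * t) c -> c != 0) -> exists C, good_overlap (x * t) C.
Proof.
case=> [[h1 [x [a [x0 Ea]]]]|ext].
  exists x; split=> // t; set s := x * t => SR0.
  have mS : is_monoid (SR s) by exact: SR_monoid.
  exists (B0 rho (SR s)); split.
  - exact: B0_subr.
  - by move=> _ [b ->]; have [p ->] := h1 b; apply: B0_rho.
  - by move=> c Sc; rewrite -[_^-1]mul1r -(rmorph1 rho); apply: B0_div.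
  - move=> y [p [_ [[c [Sc ->]] E]]].
    have [b Eb] := rees_clear p Ea (erefl s).
    exists b, (g (c * s ^+ size p)%:P); split.
      exists (c * s ^+ size p); split=> //; apply: (proj2 mS) => //.
      by apply: monoidX => //; apply: SR_s.
    by rewrite jg polyCM rmorphM mulrA E mulrC -rmorphM Eb.
  - by move=> r dr G H; apply: path_isotopic_poly.
have rA := ext_rees_rho ext; case: (ext) => h1 [a Ea] [x [b [x0 Eb]]].
exists x; split=> // t; set s := x * t => SR0.
have mS : is_monoid (SR s) by exact: SR_monoid.
have sB : subr (B0 rho (SR s)) by exact: B0_subr.
exists (locw (B0 rho (SR s)) z); split.
- by apply: locw_subr => //; apply: B0_rho.
- move=> _ [b' ->]; have [N [p E]] := h1 b'; exists N; rewrite E; exact: B0_rho.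
- move=> c Sc; apply: le_locw; rewrite -[_^-1]mul1r -(rmorph1 rho); exact: B0_div.
- move=> y [n [p [_ [[c [Sc ->]] E]]]].
  have [b1 Eb1] := rA p; have [b2 Eb2] := imA_const t.
  exists (b1 * (b2 * b) ^+ n), (g (c * s ^+ n)%:P); split.
    exists (c * s ^+ n); split=> //; apply: (proj2 mS) => //.
    by apply: monoidX => //; apply: SR_s.
  rewrite jg rmorphM rmorphXn rmorphM -Eb1 -E -Eb2 polyCM rmorphM polyC_exp rmorphXn /s.
  by rewrite polyCM rmorphM -Eb !exprMn; ring.
- by move=> r dr G H; apply: path_isotopic_laurent.
Qed.

End ReesShape.

(** * Cancellation of a free summand of rank one *)

Definition idem_iso (V : comNzRingType) n n' (e : 'M[V]_n) (e' : 'M[V]_n') :=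
  exists X Y, X *m Y = e /\ Y *m X = e'.

Lemma idem_iso_norm (V : comNzRingType) n n' (e : 'M[V]_n) (e' : 'M[V]_n') :
  e *m e = e -> e' *m e' = e' -> idem_iso e e' -> exists X Y,
  [/\ X *m Y = e, Y *m X = e', e *m X = X /\ X *m e' = X & e' *m Y = Y /\ Y *m e = Y].
Proof.
move=> ee ee' [X [Y [XY YX]]].
have Xe : X *m e' = e *m X by rewrite -YX -XY mulmxA.
have Ye : Y *m e = e' *m Y by rewrite -YX -XY mulmxA.
exists (e *m X), (e' *m Y); split.
- by rewrite -mulmxA (mulmxA X) Xe -mulmxA XY !ee.
- by rewrite -mulmxA (mulmxA Y) Ye -mulmxA YX !ee'.
- by rewrite -mulmxA Xe mulmxA ee.
- by rewrite -mulmxA Ye mulmxA ee'.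
Qed.

Lemma plus1_idem (V : comNzRingType) n (e : 'M[V]_n) : e *m e = e ->
  plus1 e *m plus1 e = plus1 e.
Proof.
move=> ee; rewrite /plus1 mulmx_block ee.
by rewrite !mulmx1 !mul0mx !mulmx0 !addr0 !add0r.
Qed.
Lemma map_plus1 (V W : comNzRingType) (f : {rmorphism V -> W}) n (e : 'M[V]_n) :
  map_mx f (plus1 e) = plus1 (map_mx f e).
Proof. by rewrite /plus1 map_block_mx !map_mx0 map_mx1. Qed.
Lemma last_plus1 (V : comNzRingType) n (e : 'M[V]_n) :
  last_row V n *m plus1 e = last_row V n.
Proof. by rewrite /last_row /plus1 mul_row_block !mul0mx !mul1mx !add0r. Qed.
Lemma ul_plus1 (V : comNzRingType) n (e : 'M[V]_n) : ulsubmx (plus1 e) = e.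
Proof. exact: block_mxKul. Qed.

Lemma conj_idem (V : comNzRingType) m n (b : 'M[V]_(m, n)) (c : 'M_(n, m)) (N N' E : 'M_n) :
  c *m b = E -> E *m N = N *m E -> b *m E = b -> N *m N' = 1%:M -> b *m c = 1%:M ->
  (b *m N *m c) *m (b *m N' *m c) = 1%:M.
Proof.
move=> cb EN bE NN bc.
rewrite -!mulmxA (mulmxA c) cb (mulmxA N) -EN -!mulmxA (mulmxA N) NN mul1mx mulmxA bE.
exact: bc.
Qed.

Lemma split_rank (F : fieldType) k k' (E : 'M[F]_k) (U : 'M_(k', k)) (V : 'M_(k, k')) :
  U *m V = 1%:M -> V *m U = E -> \rank E = k'.
Proof.
move=> UV VU; apply/eqP; rewrite eqn_leq -{1}VU.
rewrite (leq_trans (mxrankM_maxr _ _) (rank_leq_row _)) /=.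
have <- : \rank (U *m E *m V) = k' by rewrite -VU mulmxA UV mul1mx UV mxrank1.
by apply: leq_trans (mxrankM_maxl _ _) _; apply: mxrankM_maxr.
Qed.

Lemma rank_idem_iso (F : fieldType) n n' (e : 'M[F]_n) (e' : 'M[F]_n') :
  e *m e = e -> e' *m e' = e' -> idem_iso e e' -> \rank e = \rank e'.
Proof.
move=> ee ee' /(idem_iso_norm ee ee') [X [Y [XY YX [eX Xe] [eY Ye]]]].
have r1 : (\rank e <= \rank e')%N.
  by rewrite -XY; apply: leq_trans (mxrankM_maxl _ _) _; rewrite -Xe; apply: mxrankM_maxr.
have r2 : (\rank e' <= \rank e)%N.
  by rewrite -YX; apply: leq_trans (mxrankM_maxl _ _) _; rewrite -Ye; apply: mxrankM_maxr.
by apply/eqP; rewrite eqn_leq r1.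
Qed.

Section Cancel.
Variables (R : idomainType) (A : comNzRingType) (F : fieldType).
Variables (rho : {rmorphism {poly R} -> F}) (g : {rmorphism {poly R} -> A}) (j : {rmorphism A -> F}).
Hypotheses (rho_inj : injective rho) (j_inj : injective j).
Hypothesis jg : forall c, j (g c%:P) = rho c%:P.
Hypothesis alg : forall x, algebraic_over g x.
Hypothesis shape : rees_shape rho j \/ ext_rees_shape rho j.
Variable d : nat.
Hypotheses (nR : noetherian R) (dimR : dim_lt R d) (d0 : (0 < d)%N).

Lemma domainA : is_domain A.
Proof.
split; [exact: zero_ideal | by move/eqP; rewrite oner_eq0 |].
move=> x y /(congr1 j); rewrite rmorphM rmorph0 => /eqP.
by rewrite mulf_eq0 -(rmorph0 j) => /orP[/eqP/j_inj|/eqP/j_inj]; [left|right].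
Qed.

Section Idempotent.
Variables (n : nat) (e : 'M[A]_n).
Hypotheses (ee : e *m e = e) (rk_e : (d <= \rank (map_mx j e))%N).

Let i0 := zero_ideal A.

(* Generically the dimension is at most 1. *)
Lemma good_generic : (2 <= d)%N -> good e (fun a => a = 0) (constA g (fun c => c != 0)).
Proof.
move=> d2; apply: (good_projective j_inj) => //.
  by apply: constA_monoid; split; [exact: oner_neq0 | move=> x y *; rewrite mulf_neq0].
apply: (Kd_leq (leq_trans d2 rk_e)).
apply: (Kd_mono (fun _ h => h) _ (Kd_generic nR domainA alg)).
by move=> _ [c [/eqP c0 ->]]; exists c.
Qed.

(* Over A_{1+sR} the generalized dimension is less than d: both A/sA and the
   overlap A_{s(1+sR)} have dimension less than d. *)
Lemma good_near s : s != 0 -> (forall r, 1 + s * r != 0) ->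
  good e (fun a => a = 0) (constA g (fun c => exists r, c = 1 + s * r)).
Proof.
move=> s0 s1; pose S (c : R) := exists r, c = 1 + s * r; rewrite -/S.
have mS : is_monoid S.
  split; first by exists 0; rewrite mulr0 addr0.
  by move=> _ _ [r ->] [r' ->]; exists (r + r' + s * r * r'); ring.
have mA := constA_monoid g mS.
apply: (good_glue (f := g s%:P)) => //.
  apply: (good_projective j_inj) => //; first exact: idadd_ideal.
  apply: (Kd_leq rk_e).
  apply: (Kd_mono (fun _ h => h) _ (Kd_mod nR dimR domainA alg _)).
    by move=> _ ->; case: mA.
  move=> h; move: s0; rewrite -polyC_eq0 => /(rho_neq0 rho_inj).
  by rewrite -jg h rmorph0 eqxx.
apply: (good_projective j_inj) => //; first exact: adjoin_pow_monoid.
apply: (Kd_leq rk_e).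
apply: (Kd_mono (fun _ h => h) _ (Kd_loc s nR dimR d0 domainA alg)).
move=> _ [_ [[k [r ->]] ->]]; exists (g (1 + s * r)%:P), k; split.
  by exists (1 + s * r); split=> //; exists r.
by rewrite polyCM rmorphM polyC_exp rmorphXn mulrC.
Qed.

Lemma move_to_last (S : R -> Prop) (v : 'rV[A]_(n + 1)) (u : 'cV[A]_(n + 1)) (D : F -> Prop) :
  is_monoid S -> (forall c, S c -> c != 0) -> good e (fun a => a = 0) (constA g S) ->
  v *m plus1 e = v -> v *m u = 1%:M -> subr D -> (forall y, imA j y -> D y) ->
  (forall c, S c -> D (rho c%:P)^-1) ->
  exists G H : 'M[{poly F}]_(n + 1),
    [/\ mxin (pin D) G, mxin (pin D) H, G *m H = 1%:M, ev 0 G = 1%:M &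
     map_mx j v *m ev 1 G = last_row F n /\
     map_mx polyC (plus1 (map_mx j e)) *m G = G *m map_mx polyC (plus1 (map_mx j e))].
Proof.
move=> mS S0 gd vE vu sD AD DV.
pose p : 'rV_n := lsubmx v; pose a := rsubmx v 0 0.
have vpa : v = row_mx p a%:M by rewrite -[v]hsubmxK /p /a -mx11_scalar.
have pe : p *m e = p.
  move: vE; rewrite vpa mul_row_block mulmx0 addr0 => /eq_row_mx [].
  by [].
have mA := constA_monoid g mS.
have [|x [psi [xP [c [Sc Ec]]]]] :=
  good_unimodular (p := p) (a := a) (psi0 := usubmx u) (y0 := dsubmx u 0 0) mA gd pe.
  suff -> : (p *m usubmx u) 0 0 + a * dsubmx u 0 0 = 1 by case: mA.
  have vu1 : (v *m u) 0 0 = 1 by rewrite vu mxE.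
  by rewrite -vu1 -{3}[u]vsubmxK vpa mul_row_col entryD mul_scalar_mx entryZ.
have jin k l (M : 'M[A]_(k, l)) : mxin D (map_mx j M).
  by move=> i q; rewrite mxE; apply: AD; exists (M i q).
have [|||||||||||G [H [h1 h2 h3 h4 [h5 h6]]]] := @transvection_path F D n (map_mx j e) sD (map_mx j p) (map_mx j x)
  (map_mx j psi) (j a) (rho c%:P).
- exact: jin.
- by rewrite -map_mxM ee.
- exact: jin.
- exact: jin.
- exact: jin.
- by apply: AD; exists a.
- exact: DV.
- by rewrite rho_neq0 // polyC_eq0 S0.
- by rewrite -map_mxM pe.
- by rewrite -map_mxM xP.
- by rewrite -jg -Ec -map_mxZ -map_mxD -map_mxM mxE.
exists G, H; split=> //; split=> //.
by rewrite vpa map_row_mx map_scalar_mx.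
Qed.

Lemma mxin_imA k l (M : 'M[F]_(k, l)) : mxin (imA j) M -> exists M0, M = map_mx j M0.
Proof.
move=> hM; have H (il : 'I_k * 'I_l) : exists a, M il.1 il.2 = j a := hM il.1 il.2.
have [f Hf] := fin_all_exists H; exists (\matrix_(i, q) f (i, q)).
by apply/matrixP => i q; rewrite !mxE -(Hf (i, q)).
Qed.

(** The last row of [Y] is the image of (0, 1). Once it is moved back to (0, 1), the isomorphism of
    e + (1) with e' + (1) respects the extra summands and induces one of e with e' on the upper left
    blocks. *)
Lemma straighten n' (e' : 'M[A]_n') X Y (G H : 'M[{poly F}]_(n + 1)) :
  e' *m e' = e' -> X *m Y = plus1 e -> Y *m X = plus1 e' ->
  plus1 e *m X = X -> X *m plus1 e' = X -> plus1 e' *m Y = Y -> Y *m plus1 e = Y ->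
  G *m H = 1%:M -> map_mx j (last_row A n' *m Y) *m ev 1 G = last_row F n ->
  map_mx polyC (plus1 (map_mx j e)) *m G = G *m map_mx polyC (plus1 (map_mx j e)) ->
  exists x y, [/\ x = ulsubmx (ev 1 H *m map_mx j X) /\ y = ulsubmx (map_mx j Y *m ev 1 G),
    x *m y = map_mx j e /\ y *m x = map_mx j e',
    x *m map_mx j e' = x /\ y *m map_mx j e = y, map_mx j e' *m y = y &
    last_row F n *m (ev 1 H *m map_mx j X) = last_row F n' /\
    last_row F n' *m (map_mx j Y *m ev 1 G) = last_row F n].
Proof.
move=> ee' XY YX eX Xe eY Ye GH vG EG.
set x' := ev 1 H *m map_mx j X; set y' := map_mx j Y *m ev 1 G.
pose E := plus1 (map_mx j e); pose E' := plus1 (map_mx j e').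
have gh : ev 1 G *m ev 1 H = 1%:M by rewrite -evM GH ev1.
have hg := mulmx1C gh.
have Eg : E *m ev 1 G = ev 1 G *m E.
  by have := congr1 (ev 1) EG; rewrite !evM !ev_const.
have Eh : E *m ev 1 H = ev 1 H *m E.
  by rewrite -[LHS]mul1mx -hg -mulmxA (mulmxA (ev 1 G)) -Eg -mulmxA gh mulmx1.
have jXY : map_mx j X *m map_mx j Y = E by rewrite -map_mxM XY map_plus1.
have jYX : map_mx j Y *m map_mx j X = E' by rewrite -map_mxM YX map_plus1.
have jXe : map_mx j X *m E' = map_mx j X by rewrite /E' -map_plus1 -map_mxM Xe.
have jYe : map_mx j Y *m E = map_mx j Y by rewrite /E -map_plus1 -map_mxM Ye.
have jeY : E' *m map_mx j Y = map_mx j Y by rewrite /E' -map_plus1 -map_mxM eY.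
have lh : last_row F n *m ev 1 H = map_mx j (last_row A n' *m Y).
  by rewrite -vG -mulmxA gh mulmx1.
have lx : last_row F n *m x' = last_row F n'.
  by rewrite /x' mulmxA lh -map_mxM -mulmxA YX last_plus1 map_last_row.
have ly : last_row F n' *m y' = last_row F n.
  by rewrite /y' mulmxA -vG map_mxM map_last_row.
have lE k (f : 'M[F]_k) : last_row F k *m plus1 f = last_row F k by exact: last_plus1.
exists (ulsubmx x'), (ulsubmx y'); split=> //.
- rewrite -!ul_mul // -[in RHS](ul_plus1 (map_mx j e)) -[in X in _ /\ _ = X](ul_plus1 (map_mx j e')).
  split; congr ulsubmx.
    by rewrite /x' /y' -mulmxA (mulmxA (map_mx j X)) jXY Eg mulmxA hg mul1mx.
  by rewrite /x' /y' -mulmxA (mulmxA (ev 1 G)) gh mul1mx.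
- rewrite -(ul_plus1 (map_mx j e')) -(ul_plus1 (map_mx j e)) -!ul_mul //.
  by rewrite /x' /y' -!mulmxA jXe -Eg (mulmxA (map_mx j Y)) jYe.
- rewrite -(ul_plus1 (map_mx j e')) -ul_mul //.
  by rewrite /y' mulmxA jeY.
Qed.

Lemma cancel_one n' (e' : 'M[A]_n') : (2 <= d)%N -> e' *m e' = e' ->
  (exists w : R, w != 0 /\ forall r, 1 + w * r != 0) ->
  idem_iso (plus1 e) (plus1 e') -> idem_iso e e'.
Proof.
move=> d2 ee' [w [w0 w1]] iso.
have [X [Y [XY YX [eX Xe] [eY Ye]]]] := idem_iso_norm (plus1_idem ee) (plus1_idem ee') iso.
pose eF := map_mx j e; pose E := plus1 eF.
have jE : map_mx j (plus1 e) = E by rewrite map_plus1.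
pose v := last_row A n' *m Y; pose u : 'cV_(n + 1) := rsubmx X.
have vE : v *m plus1 e = v by rewrite /v -mulmxA Ye.
have vX : v *m X = last_row A n' by rewrite /v -mulmxA YX last_plus1.
have vu : v *m u = 1%:M by rewrite /u mulmx_rsub vX row_mxKr.
have [s1 [m [B [C [s10 BC CB Bs Cs]]]]] := free_generic rho_inj jg shape ee.
rewrite -/eF in CB.
have rk_m : \rank eF = m := split_rank BC CB.
have dm : (d <= m)%N by rewrite -rk_m.
have mnz : is_monoid (fun c : R => c != 0).
  by split; [exact: oner_neq0 | move=> x y *; rewrite mulf_neq0].
(* v is moved to (0, 1) over A_{s0}. *)
pose Dgen := locp j (constA g (fun c => c != 0)).
have gen_neq0 a : constA g (fun c => c != 0) a -> j a != 0.
  exact: (constA_neq0 rho_inj jg (fun _ h => h)).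
have sAA : subr (imA j) by exact: imA_subr.
have [s0 [s00 [G1 [H1 [hG1 hH1 GH1 G10 [vG1 EG1]]]]]] : exists s0 : R, s0 != 0 /\
   exists G H : 'M[{poly F}]_(n + 1),
    [/\ mxin (pin (locw (imA j) (rho s0%:P))) G, mxin (pin (locw (imA j) (rho s0%:P))) H,
        G *m H = 1%:M, ev 0 G = 1%:M &
     map_mx j v *m ev 1 G = last_row F n /\ map_mx polyC E *m G = G *m map_mx polyC E].
  have mg := constA_monoid g mnz.
  have [|||G [H [hG hH GH G0 rest]]] := @move_to_last (fun c => c != 0) v u Dgen mnz (fun _ h => h)
    (good_generic d2) vE vu.
  - exact: locp_subr.
  - by move=> _ [a ->]; apply: locp_im.
  - move=> c c0; exists 1, (g c%:P); split; first by exists c.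
    by rewrite jg rmorph1 mulVf // rho_neq0 // polyC_eq0.
  have [_ [G' [H' [[c [c0 ->]] EG EH]]]] := clear_pair mg hG hH.
  have cleared (L : 'M[{poly F}]_(n + 1)) L' : (j (g c%:P))%:P *: L = map_mx (map_poly j) L' ->
      mxin (pin (locw (imA j) (rho c%:P))) L.
    move=> EL i k l; exists 1%N; rewrite expr1 -jg mulrC -coefCM.
    have := congr1 (fun N : 'M_(n + 1) => N i k) EL.
    by rewrite !mxE => ->; rewrite coef_map; eexists.
  by exists c; split=> //; exists G, H; split=> //; [exact: cleared EG | exact: cleared EH].
have [x [x0 overlap]] := exists_overlap rho_inj jg nR dimR d0 shape.
(* s is a multiple of all that has to be inverted: [x] for the shape of the overlap, [s1] for a
   basis of the image of e, [s0] for the first motion. The factor [w] keeps 0 out of 1 + sR. *)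
pose t := s1 * s0 * w; pose s := x * t.
have [Es0 Es1] : s = s0 * (x * s1 * w) /\ s = s1 * (x * s0 * w).
  by rewrite /s /t; split; ring.
have iAC c : imA j (rho c%:P) by exact: (imA_const jg).
have s_dvd k q y : s = k * q -> imA j (y * rho k%:P) -> imA j (y * rho s%:P).
  by move=> -> ?; rewrite polyCM rmorphM mulrA; apply: (subrM sAA).
have s_neq0 : s != 0 by rewrite !mulf_neq0.
have s1r r : 1 + s * r != 0.
  by have := w1 (x * (s1 * s0) * r); congr (_ != _); rewrite /s /t; ring.
have SR0 c : SR s c -> c != 0.
  by move=> [k [r ->]]; rewrite mulf_neq0 // expf_neq0.
have [K [sK AK SK Kloc Kiso]] := overlap t SR0.
have As_K y k : locw (imA j) (rho k%:P) y -> (exists q, s = k * q) -> K y.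
  move=> [N hN] [q Eq].
  have kn : rho k%:P != 0.
    by rewrite rho_neq0 // polyC_eq0; apply: contraNneq s_neq0 => k0; rewrite Eq k0 mul0r.
  have -> : y = (y * rho k%:P ^+ N) * (rho q%:P * (rho s%:P)^-1) ^+ N.
    have qn : rho q%:P != 0.
      by rewrite rho_neq0 // polyC_eq0; apply: contraNneq s_neq0 => q0; rewrite Eq q0 mulr0.
    have -> : rho q%:P * (rho s%:P)^-1 = (rho k%:P)^-1.
      by rewrite Eq polyCM rmorphM invfM mulrCA mulfV // mulr1.
    by rewrite exprVn mulfK // expf_neq0.
  apply: (subrM sK); first exact: AK.
  apply: (subrX _ sK); apply: (subrM sK); first by apply: AK; exists (g q%:P); rewrite jg.
  by apply: SK; apply: SR_s.
(* v is moved to (0, 1) over A_{1+sR}, hence over some A_c with c in 1 + sR. *)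
pose S c := exists r, c = 1 + s * r.
have mS : is_monoid S.
  split; first by exists 0; rewrite mulr0 addr0.
  by move=> _ _ [r ->] [r' ->]; exists (r + r' + s * r * r'); ring.
pose D2 := locp j (constA g S).
have S_neq0 c : S c -> c != 0 by move=> [r ->].
have mA2 := constA_monoid g mS.
have sD2 : subr D2 by exact: locp_subr.
have A_D2 y : imA j y -> D2 y by move=> [a ->]; apply: locp_im.
have [||G2 [H2 [hG2 hH2 GH2 G20 [vG2 EG2]]]] := @move_to_last S v u D2 mS S_neq0
    (good_near s_neq0 s1r) vE vu sD2.
- exact: A_D2.
- move=> c Sc; exists 1, (g c%:P); split; first by exists c.
  by rewrite jg rmorph1 mulVf // rho_neq0 // polyC_eq0 S_neq0.
have D2_K y : D2 y -> K y.
  move=> [a [_ [[c [[r Ec] ->]] Ey]]].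
  have cn : rho c%:P != 0 by rewrite rho_neq0 // polyC_eq0 Ec.
  have -> : y = j a * (rho c%:P)^-1 by rewrite -Ey jg mulfK.
  by apply: (subrM sK); [apply: AK; exists a | apply: SK; rewrite Ec; apply: SR_1].
have sk := pin_subr sK.
(* om compares the two motions over A_{s(1+sR)}, in a basis of the image of e. *)
pose Bp : 'M_(m + 1, n + 1) := block_mx B 0 0 1%:M.
pose Cp : 'M_(n + 1, m + 1) := block_mx C 0 0 1%:M.
have BCp : Bp *m Cp = 1%:M.
  by rewrite mulmx_block BC !mulmx0 !mul0mx !mulmx1 !addr0 !add0r (scalar_mx_block m 1).
have CBp : Cp *m Bp = E.
  by rewrite mulmx_block CB !mulmx0 !mul0mx !mulmx1 !addr0 !add0r.
have BEp : Bp *m E = Bp by rewrite -CBp mulmxA BCp mul1mx.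
have ECp : E *m Cp = Cp by rewrite -CBp -mulmxA BCp mulmx1.
have [x1 [y1 [[Ex1 Ey1] [xy1 yx1] [xe1 ye1] _ [lx1 ly1]]]] :=
  straighten ee' XY YX eX Xe eY Ye GH1 vG1 EG1.
have [x2 [y2 [[Ex2 Ey2] [xy2 yx2] [xe2 ye2] ey2 [lx2 ly2]]]] :=
  straighten ee' XY YX eX Xe eY Ye GH2 vG2 EG2.
rewrite -/eF in xy1 xy2 ye1 ye2.
set eF' := map_mx j e' in yx1 yx2 xe1 xe2 ey2.
have EHG : map_mx polyC E *m (H2 *m G1) = (H2 *m G1) *m map_mx polyC E.
  have EH2 : map_mx polyC E *m H2 = H2 *m map_mx polyC E.
    by rewrite -[LHS]mul1mx -(mulmx1C GH2) -mulmxA (mulmxA G2) -EG2 -mulmxA GH2 mulmx1.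
  by rewrite mulmxA EH2 -!mulmxA EG1.
pose om := map_mx polyC Bp *m (H2 *m G1) *m map_mx polyC Cp.
pose om' := map_mx polyC Bp *m (H1 *m G2) *m map_mx polyC Cp.
have HGHG : (H2 *m G1) *m (H1 *m G2) = 1%:M.
  by rewrite mulmxA -(mulmxA H2) GH1 mulmx1 (mulmx1C GH2).
have omom : om *m om' = 1%:M.
  apply: conj_idem EHG _ HGHG _; rewrite -map_mxM ?CBp ?BEp ?BCp ?map_mx1 //.
have s1_K y : imA j (y * rho s1%:P) -> K y.
  by move=> h; apply: (@As_K _ s1); [exists 1%N; rewrite expr1 | eexists; apply: Es1].
have BK i k : K (B i k) by exact: s1_K.
have CK i k : K (C i k) by exact: s1_K.
have plus_in k l (M : 'M[F]_(k, l)) : (forall i q, K (M i q)) ->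
    mxin (pin K) (map_mx polyC (block_mx M 0 0 1%:M : 'M_(k + 1, l + 1))).
  move=> hM; apply: mxin_const => //; apply: mxin_block => //; try exact: mxin0.
  exact: (mxin1 sK).
have s0_K : le (pin (locw (imA j) (rho s0%:P))) (pin K).
  by move=> f hf i; apply: (As_K _ s0) => //; eexists; apply: Es0.
have D2pK : le (pin D2) (pin K) by move=> f hf i; apply: D2_K.
have hom (L M : 'M[{poly F}]_(n + 1)) : mxin (pin K) L -> mxin (pin K) M ->
    mxin (pin K) (map_mx polyC Bp *m (L *m M) *m map_mx polyC Cp).
  move=> hL hM; apply: (mxinM sk); last exact: plus_in.
  by apply: (mxinM sk); [apply: plus_in | apply: (mxinM sk)].
have om0 : ev 0 om = 1%:M.
  have H20 : ev 0 H2 = 1%:M.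
    by have := congr1 (ev 0) GH2; rewrite evM G20 mul1mx ev1.
  by rewrite /om !evM !ev_const G10 H20 !mulmx1 BCp.
have lB : last_row F m *m Bp = last_row F n.
  by rewrite /last_row mul_row_block !mul0mx !mul1mx !add0r.
have lC : last_row F n *m Cp = last_row F m.
  by rewrite /last_row mul_row_block !mul0mx !mul1mx !add0r.
have om1 : ev 1 om = Bp *m ((ev 1 H2 *m map_mx j X) *m (map_mx j Y *m ev 1 G1)) *m Cp.
  have Eg : E *m ev 1 G1 = ev 1 G1 *m E.
    by have := congr1 (ev 1) EG1; rewrite !evM !ev_const.
  rewrite -(mulmxA (ev 1 H2)) (mulmxA (map_mx j X)) -map_mxM XY jE Eg.
  by rewrite /om !evM !ev_const -!mulmxA ECp.
have lom : last_row F m *m ev 1 om = last_row F m.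
  by rewrite om1 !mulmxA lB -(mulmxA _ (ev 1 H2)) lx2 -(mulmxA _ (map_mx j Y)) ly1 lC.
have isoS := Kiso m dm om om' (hom _ _ (mxin_mono D2pK hH2) (mxin_mono s0_K hG1))
   (hom _ _ (mxin_mono s0_K hH1) (mxin_mono D2pK hG2)) omom om0 lom.
(* The discrepancy of the two local isomorphisms, in coordinates. It is the upper left block of the
   end of [om], hence isotopic to 1 over the overlap. *)
pose sg := B *m x2 *m y1 *m C.
have sgE : ulsubmx (ev 1 om) = sg.
  rewrite om1 ul_mul // (ul_mul Bp); last by rewrite mulmxA lx2 ly1.
  by rewrite (ul_mul (ev 1 H2 *m map_mx j X)) // -Ex2 -Ey1 !block_mxKul !mulmxA.
rewrite {}sgE in isoS.
pose tau := B *m x1 *m y2 *m C.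
have sgtau : sg *m tau = 1%:M.
  rewrite /sg /tau -!mulmxA (mulmxA C) CB (mulmxA y1) ye1 (mulmxA y1) yx1 (mulmxA x2) xe2.
  by rewrite (mulmxA x2) xy2 mulmxA -CB mulmxA BC mul1mx BC.
case: isoS => P [Q [hP hQ PQ P0 P1]].
have mSR := SR_monoid s.
have Kpin := mxin_mono (fun f => @pin_mono _ _ _ f Kloc).
have [_ [P' [Q' [[_ [[k [r ->]] ->]] EP EQ]]]] :=
  clear_pair (constA_monoid g mSR) (Kpin _ _ _ hP) (Kpin _ _ _ hQ).
(* s and 1 + s r are comaximal, so the isotopy splits over A_s and A_{1+sr}. *)
pose gg := rho (1 + s * r)%:P.
have ggE : gg = 1 - rho s%:P * - rho r%:P.
  by rewrite /gg mulrN opprK polyCD polyCM rmorphD rmorphM polyC1 rmorph1.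
have iAN : imA j (- rho r%:P) by apply: (subrN sAA).
have Bgg : imA j gg by exact: iAC.
have coefw (L : 'M[{poly F}]_m) L' :
    (j (g (s ^+ k * (1 + s * r))%:P))%:P *: L = map_mx (map_poly j) L' ->
    mxin (pin (locw (imA j) (rho s%:P * gg))) L.
  move=> EL l q i; have := congr1 (fun N : 'M_m => N l q) EL.
  rewrite !mxE; set f := L l q; set p := L' l q => Ef; exists k.+1; rewrite exprMn.
  have -> : f`_i * (rho s%:P ^+ k.+1 * gg ^+ k.+1) =
      (f`_i * (rho s%:P ^+ k * gg)) * (rho s%:P * gg ^+ k) by rewrite !exprS; ring.
  apply: (subrM sAA); last by apply: (subrM sAA) => //; apply: (subrX _ sAA).
  have e1 : rho (s ^+ k * (1 + s * r))%:P = rho s%:P ^+ k * gg.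
    by rewrite /gg polyCM (rmorphM rho) (rmorphXn (polyC : {rmorphism R -> {poly R}})) (rmorphXn rho).
  by exists p`_i; rewrite -coef_map -Ef coefCM jg e1 mulrC.
have Q0 : ev 0 Q = 1%:M by have := congr1 (ev 0) PQ; rewrite evM P0 mul1mx ev1.
have Q1 : ev 1 Q = tau.
  have E1 : sg *m ev 1 Q = 1%:M by rewrite -P1 -evM PQ ev1.
  by rewrite -[LHS]mul1mx -(mulmx1C sgtau) -mulmxA E1 mulmx1.
(* Applied to the inverse path [Q], which ends at [tau]. The order of contact is 2 because [al] - 1
   is later multiplied by [C] and by [B], each of which has a denominator dividing s. *)
have [al [al' [alal nal nal' isoL]]] :=
  @quillen_split F (imA j) _ _ gg sAA (iAC s) iAN ggE m Q P 2 (coefw _ _ EQ) (coefw _ _ EP) (mulmx1C PQ) Q0.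
rewrite {}Q1 in isoL.
pose As := locw (imA j) (rho s%:P).
have sAs : subr As by exact: locw_subr.
have s1_As y : imA j (y * rho s1%:P) -> As y.
  by move=> h; exists 1%N; rewrite expr1; apply: (s_dvd _ _ _ Es1).
have AsB i q : As (B i q) by exact: s1_As.
have AsC i q : As (C i q) by exact: s1_As.
have locs0 : le (locw (imA j) (rho s0%:P)) As.
  move=> y [N hN]; exists N; rewrite Es0 polyCM rmorphM exprMn mulrA.
  by apply: (subrM sAA) => //; apply: (subrX _ sAA).
have jin k' l (N : 'M[A]_(k', l)) : mxin (imA j) (map_mx j N).
  by move=> i q; rewrite mxE; exists (N i q).
have hev0 (L : 'M[{poly F}]_(n + 1)) : mxin (pin (locw (imA j) (rho s0%:P))) L -> mxin As (ev 1 L).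
  move=> hL; apply: mxin_ev => //; first exact: (subr1 sAs).
  by apply: mxin_mono hL => f hf i; apply: locs0.
have hx1 : mxin As x1.
  rewrite Ex1; apply: mxin_ul; apply: (mxinM sAs); first exact: hev0.
  apply: mxin_mono (jin _ _ X); exact: le_locw.
have hy1 : mxin As y1.
  rewrite Ey1; apply: mxin_ul; apply: (mxinM sAs); last exact: hev0.
  apply: mxin_mono (jin _ _ Y); exact: le_locw.
have hx2 : mxin D2 x2.
  rewrite Ex2; apply: mxin_ul; apply: (mxinM sD2); last exact: mxin_mono (jin _ _ X).
  by apply: mxin_ev => //; apply: (subr1 sD2).
have hy2 : mxin D2 y2.
  rewrite Ey2; apply: mxin_ul; apply: (mxinM sD2); first exact: mxin_mono (jin _ _ Y).
  by apply: mxin_ev => //; apply: (subr1 sD2).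
have gg0 : gg != 0 by rewrite /gg rho_neq0 // polyC_eq0.
have ggV : D2 gg^-1.
  exists 1, (g (1 + s * r)%:P); split; first by exists (1 + s * r); split=> //; exists r.
  by rewrite jg rmorph1 mulVf.
have near (L : 'M[F]_m) :
    (forall i q, exists N b, imA j b /\ (L - 1%:M) i q * gg ^+ N = rho s%:P ^+ 2 * b) ->
    mxin D2 (C *m L *m B).
  move=> nL; have -> : C *m L *m B = eF + C *m (L - 1%:M) *m B.
    by rewrite mulmxBr mulmx1 mulmxBl CB addrC subrK.
  apply: mxinD => //; first exact: mxin_mono (jin _ _ e).
  move=> i q; rewrite mxE; apply: subr_sum => // => l _; rewrite mxE mulr_suml.
  apply: subr_sum => // => l' _; have [N [b [hb Eb]]] := nL l' l.
  have -> : C i l' * (L - 1%:M) l' l * B l q =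
      (C i l' * rho s%:P) * (B l q * rho s%:P) * b * gg^-1 ^+ N.
    rewrite -[(L - 1%:M) l' l](mulfK (expf_neq0 N gg0)) Eb exprVn expr2; ring.
  apply: (subrM sD2); last exact: (subrX _ sD2).
  by apply: A_D2; apply: (subrM sAA) => //; apply: (subrM sAA); apply: (s_dvd _ _ _ Es1).
have cap k' l (N : 'M[F]_(k', l)) : mxin D2 N -> mxin As N -> mxin (imA j) N.
  move=> h2 h1 i q; have [a [_ [[c [[r' Ec] ->]] Ea]]] := h2 i q.
  have cE : rho c%:P = 1 - rho s%:P * - rho r'%:P.
    by rewrite Ec mulrN opprK polyCD polyCM rmorphD rmorphM polyC1 rmorph1.
  have iAr : imA j (- rho r'%:P) by apply: (subrN sAA).
  apply: (locw_cap sAA (iAC s) iAr cE (h1 i q)).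
  by exists 1%N; rewrite expr1 -jg; exists a.
have isoAs (L : 'M[F]_m) : isotopic As L -> mxin As L.
  by move=> [L' [_ [hL' _ _ _ <-]]]; apply: mxin_ev => //; apply: (subr1 sAs).
have hb' := isoAs _ isoL.
have bb : (tau *m al') *m (al *m sg) = 1%:M.
  by rewrite mulmxA -(mulmxA tau) (mulmx1C alal) mulmx1 (mulmx1C sgtau).
have hb := isoAs _ (isotopic_inv bb isoL).
(* The corrected isomorphism has one expression over A_{1+sR} and one over A_s, so its entries lie
   in the intersection, which is [A]. *)
have EX : C *m al *m B *m x2 = C *m (al *m sg) *m B *m x1.
  rewrite /sg -!mulmxA; congr (_ *m (_ *m (_ *m _))).
  by rewrite (mulmxA C) CB (mulmxA y1) ye1 yx1 xe2.
have EY : y2 *m C *m al' *m B = y1 *m C *m (tau *m al') *m B.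
  rewrite /tau !mulmxA -(mulmxA y1) CB ye1 yx1 ey2 //.
have [X0 EX0] : exists X0, C *m al *m B *m x2 = map_mx j X0.
  apply: mxin_imA; apply: cap; first by apply: (mxinM sD2) => //; apply: near.
  by rewrite EX; do ![apply: (mxinM sAs) => //].
have [Y0 EY0] : exists Y0, y2 *m C *m al' *m B = map_mx j Y0.
  apply: mxin_imA; apply: cap.
    by rewrite -!mulmxA (mulmxA C); apply: (mxinM sD2) => //; apply: near.
  by rewrite EY; do ![apply: (mxinM sAs) => //].
exists X0, Y0; split; apply: (map_mx_injf j_inj); rewrite /= map_mxM -EX0 -EY0.
  rewrite -!mulmxA (mulmxA x2) xy2 -CB -!mulmxA (mulmxA B C) BC mul1mx.
  by rewrite (mulmxA B C) BC mul1mx (mulmxA al) alal mul1mx.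
rewrite -!mulmxA (mulmxA B C) BC mul1mx (mulmxA al') (mulmx1C alal) mul1mx.
by rewrite (mulmxA C) CB (mulmxA y2) ye2 yx2.
Qed.

End Idempotent.

(** The bases from [free_generic] have constant denominators, which are units here. Both modules are
    thus free over [A], and their ranks are compared over [F]. *)
Lemma cancel_over_field n (e : 'M[A]_n) n' (e' : 'M[A]_n') :
  (forall c : R, c != 0 -> exists b, c * b = 1) -> e *m e = e -> e' *m e' = e' ->
  idem_iso (plus1 e) (plus1 e') -> idem_iso e e'.
Proof.
move=> unitR ee ee' [X [Y [XY YX]]].
have [s [m [B [C [s0 BC CB hB hC]]]]] := free_generic rho_inj jg shape ee.
have [s' [m' [B' [C' [s0' BC' CB' hB' hC']]]]] := free_generic rho_inj jg shape ee'.
have sAA : subr (imA j) by exact: imA_subr.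
have drop y c : c != 0 -> imA j (y * rho c%:P) -> imA j y.
  move=> /unitR [b cb] h.
  have -> : y = y * rho c%:P * rho b%:P by rewrite -mulrA -rmorphM -polyCM cb polyC1 rmorph1 mulr1.
  by apply: (subrM sAA) => //; exists (g b%:P); rewrite jg.
have Em : m = m'.
  rewrite -(split_rank BC CB) -(split_rank BC' CB').
  have rk1 k (f : 'M[F]_k) : \rank (plus1 f) = (\rank f + 1)%N.
    by rewrite /plus1 rank_diag_block_mx mxrank1.
  apply: (@addIn 1); rewrite /= -!rk1 -!map_plus1.
  apply: rank_idem_iso; rewrite -?map_mxM ?plus1_idem //.
  by exists (map_mx j X), (map_mx j Y); rewrite -!map_mxM XY YX.
subst m'.
have [X0 EX] : exists X0, C *m B' = map_mx j X0.
  apply: mxin_imA; apply: (mxinM sAA) => i k; [exact: (drop _ s) | exact: (drop _ s')].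
have [Y0 EY] : exists Y0, C' *m B = map_mx j Y0.
  apply: mxin_imA; apply: (mxinM sAA) => i k; [exact: (drop _ s') | exact: (drop _ s)].
exists X0, Y0; split; apply: (map_mx_injf j_inj); rewrite /= map_mxM -EX -EY.
  by rewrite mulmxA -(mulmxA C) BC' mulmx1.
by rewrite mulmxA -(mulmxA C') BC mulmx1.
Qed.

Theorem cancel_matrix n (e : 'M[A]_n) n' (e' : 'M[A]_n') :
  e *m e = e -> e' *m e' = e' -> (d <= \rank (map_mx j e))%N ->
  idem_iso (plus1 e) (plus1 e') -> idem_iso e e'.
Proof.
move=> ee ee' rk.
have [unitR|nunit] := EM (forall c : R, c != 0 -> exists b, c * b = 1).
  exact: cancel_over_field.
have [w [w0 nw]] : exists w : R, w != 0 /\ ~ exists b, w * b = 1.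
  apply: contrapT => h; apply: nunit => c c0; apply: contrapT => nb; apply: h.
  by exists c.
apply: (cancel_one ee rk _ ee'); last first.
  exists w; split=> // r; apply/eqP => E; apply: nw; exists (- r).
  by rewrite mulrN; apply/eqP; rewrite -subr_eq0 -opprD addrC E oppr0.
(* The nonzero nonunit [w] lies in a prime, which together with the zero ideal makes a chain of
   length 1; hence [d] is at least 2. *)
case: (d) d0 dimR => [|[|//]] // _ dim1; exfalso.
have z0 := idomain_domain R.
have iw := idadd_ideal w (prime_idealW z0).
have [||Q [pQ wQ _]] := @prime_sep R _ (fun x => x = 1) iw.
- by split=> // x y -> ->; rewrite mulr1.
- by move=> _ [_ [c [-> ->]]]; rewrite add0r => E; apply: nw; exists c; rewrite mulrC.
apply: (dim1 (fun x => x = 0) Q); apply: (chainS (N := fun x => x = 0)) => //.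
- by apply: chain0 => // x.
- by move=> x ->; apply: ideal0; apply: prime_idealW.
move=> h; move/eqP: w0; apply; apply: h; apply: wQ; apply: idadd_in; exact: prime_idealW.
Qed.

End Cancel.

(** * From idempotent matrices to projective modules *)

Section Modules.
Variable A : comNzRingType.

Lemma pack_linear (M N : lmodType A) (f : M -> N) : linear f ->
  exists h : {linear M -> N}, h =1 f.
Proof.
move=> lf.
pose h : {linear M -> N} := HB.pack f (GRing.isLinear.Build A M N *:%R f lf).
by exists h.
Qed.

Definition represents (M : lmodType A) n (e : 'M[A]_n) :=
  exists (i : {linear M -> 'rV[A]_n}) (p : {linear 'rV[A]_n -> M}),
    cancel i p /\ forall x, x *m e = i (p x).

Lemma represents_idem (M : lmodType A) n (e : 'M[A]_n) : represents M e -> e *m e = e.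
Proof.
move=> [i [p [ip Ee]]]; apply/row_matrixP => k.
by rewrite row_mul rowE !Ee ip.
Qed.

Lemma fg_projective_represents (M : lmodType A) : fg_projective M ->
  exists n (e : 'M[A]_n), represents M e.
Proof.
move=> [n [i [p ip]]]; exists n, (lin1_mx (i \o p)); exists i, p; split=> // x.
by rewrite mul_rV_lin1.
Qed.

Lemma mod_iso_idem (M N : lmodType A) n (e : 'M[A]_n) n' (e' : 'M[A]_n') :
  represents M e -> represents N e' -> mod_iso M N -> idem_iso e e'.
Proof.
move=> [i [p [ip Ee]]] [i' [p' [ip' Ee']]] [f [f' ff' f'f]].
have lf' : linear f'.
  by move=> a x y; apply: (can_inj ff'); rewrite linearP !f'f.
have [h hE] := pack_linear lf'.
exists (lin1_mx (i' \o f \o p)), (lin1_mx (i \o h \o p')); split.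
  apply/row_matrixP => k; rewrite row_mul !rowE !mul_rV_lin1 /= ip' hE ff'.
  by rewrite Ee.
apply/row_matrixP => k; rewrite row_mul !rowE !mul_rV_lin1 /= ip hE f'f.
by rewrite Ee'.
Qed.

Lemma idem_iso_mod (M N : lmodType A) n (e : 'M[A]_n) n' (e' : 'M[A]_n') :
  represents M e -> represents N e' -> idem_iso e e' -> mod_iso M N.
Proof.
move=> rM rN; have ee := represents_idem rM; have ee' := represents_idem rN.
move=> /(idem_iso_norm ee ee') [X [Y [XY YX [eX Xe] [eY Ye]]]].
case: rM => [i [p [ip Ee]]]; case: rN => [i' [p' [ip' Ee']]].
have [|f fE] := @pack_linear M N (fun m => p' (i m *m X)).
  by move=> a x y; rewrite linearP mulmxDl -scalemxAl linearP.
exists f; exists (fun y => p (i' y *m Y)) => x; rewrite ?fE.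
  by rewrite -Ee' -!mulmxA (mulmxA X) Xe XY Ee ip ip.
by rewrite -Ee -!mulmxA (mulmxA Y) Ye YX Ee' ip' ip'.
Qed.

Lemma represents_sum (M N : lmodType A) n (e : 'M[A]_n) k (f : 'M[A]_k) :
  represents M e -> represents N f ->
  represents (M * N)%type (block_mx e 0 0 f).
Proof.
move=> [i [p [ip Ee]]] [i' [p' [ip' Ef]]].
have [|h hE] := @pack_linear (M * N)%type 'rV[A]_(n + k) (fun x => row_mx (i x.1) (i' x.2)).
  by move=> a x y; rewrite !linearP scale_row_mx add_row_mx.
have [|q qE] := @pack_linear 'rV[A]_(n + k) (M * N)%type (fun x => (p (lsubmx x), p' (rsubmx x))).
  by move=> a x y; rewrite !linearP.
exists h, q; split=> x; rewrite ?qE ?hE /=.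
  by rewrite row_mxKl row_mxKr ip ip'; case: x.
by rewrite -{1}[x]hsubmxK mul_row_block !mulmx0 addr0 add0r Ee Ef.
Qed.

End Modules.

(** * Isomorphism of idempotent matrices and free complements *)

Section IdemIso.
Variable V : comNzRingType.

Lemma idem_iso_sym n n' (e : 'M[V]_n) (e' : 'M[V]_n') : idem_iso e e' -> idem_iso e' e.
Proof. by move=> [X [Y [XY YX]]]; exists Y, X. Qed.

Lemma idem_iso_trans n1 n2 n3 (e1 : 'M[V]_n1) (e2 : 'M[V]_n2) (e3 : 'M[V]_n3) :
  e1 *m e1 = e1 -> e2 *m e2 = e2 -> e3 *m e3 = e3 ->
  idem_iso e1 e2 -> idem_iso e2 e3 -> idem_iso e1 e3.
Proof.
move=> i1 i2 i3 /(idem_iso_norm i1 i2) [X [Y [XY YX [eX Xe] [eY Ye]]]].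
move=> /(idem_iso_norm i2 i3) [X' [Y' [XY' YX' [eX' Xe'] [eY' Ye']]]].
exists (X *m X'), (Y' *m Y); split.
  by rewrite -mulmxA (mulmxA X') XY' mulmxA Xe.
by rewrite -mulmxA (mulmxA Y) YX mulmxA Ye'.
Qed.

Lemma block_idem n k (e : 'M[V]_n) (f : 'M[V]_k) : e *m e = e -> f *m f = f ->
  block_mx e 0 0 f *m block_mx e 0 0 f = block_mx e 0 0 f.
Proof. by move=> ee ff; rewrite mulmx_block ee ff !mulmx0 !mul0mx !addr0 add0r. Qed.

(** Adding 1 - f completes f to a free module, so a common summand may be replaced by a free one. *)
Lemma idem_iso_complement n k (e : 'M[V]_n) (f : 'M[V]_k) : e *m e = e -> f *m f = f ->
  idem_iso (block_mx (block_mx e 0 0 f) 0 0 (1%:M - f)) (block_mx e 0 0 (1%:M : 'M_k)).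
Proof.
move=> ee ff.
have f0 : f *m (1%:M - f) = 0 by rewrite mulmxBr mulmx1 ff subrr.
have f1 : (1%:M - f) *m f = 0 by rewrite mulmxBl mul1mx ff subrr.
have f2 : (1%:M - f) *m (1%:M - f) = 1%:M - f by rewrite mulmxBr mulmx1 f1 subr0.
pose D := block_mx e 0 0 f.
exists (col_mx D (row_mx 0 (1%:M - f))), (row_mx D (col_mx 0 (1%:M - f))); split.
  rewrite mul_col_row block_idem // mul_block_col mul_row_block mul_row_col.
  by rewrite !mul0mx !mulmx0 f0 f1 f2 !addr0 !add0r col_mx0 row_mx0.
rewrite mul_row_col block_idem // mul_col_row !mul0mx !mulmx0 f2 add_block_mx.
by rewrite !addr0 addrC subrK.
Qed.

Lemma idem_iso_add n n' k (e : 'M[V]_n) (e' : 'M[V]_n') (f : 'M[V]_k) :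
  f *m f = f -> idem_iso e e' -> idem_iso (block_mx e 0 0 f) (block_mx e' 0 0 f).
Proof.
move=> ff [X [Y [XY YX]]]; exists (block_mx X 0 0 f), (block_mx Y 0 0 f).
by rewrite !mulmx_block XY YX ff !mulmx0 !mul0mx !addr0 !add0r.
Qed.

Lemma idem_iso_cast n m (E : n = m) (e : 'M[V]_n) : e *m e = e ->
  idem_iso e (castmx (E, E) e).
Proof. by case: m / E => ee; exists e, e; rewrite castmx_id. Qed.

Lemma idem_iso_shift n k (e : 'M[V]_n) : e *m e = e ->
  idem_iso (block_mx e 0 0 (1%:M : 'M_(1 + k))) (block_mx (plus1 e) 0 0 (1%:M : 'M_k)).
Proof.
move=> ee.
have i1 := block_idem (plus1_idem ee) (mul1mx (1%:M : 'M[V]_k)).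
have := idem_iso_cast (esym (addnA n 1 k)) i1; move/idem_iso_sym.
suff -> : castmx (esym (addnA n 1 k), esym (addnA n 1 k)) (block_mx (plus1 e) 0 0 (1%:M : 'M_k))
  = block_mx e 0 0 (1%:M : 'M_(1 + k)) by [].
have := @block_mxA V n 1 k n 1 k e 0 0 0 1%:M 0 0 0 1%:M.
by rewrite /= !row_mx0 !col_mx0 -scalar_mx_block => ->.
Qed.

Definition cancel_plus1 (F : fieldType) (j : V -> F) d :=
  forall n (e : 'M[V]_n) n' (e' : 'M[V]_n'), e *m e = e -> e' *m e' = e' ->
    (d <= \rank (map_mx j e))%N -> idem_iso (plus1 e) (plus1 e') -> idem_iso e e'.

(** The free summands are removed one by one. The intermediate modules have larger rank than e,
    which is why the rank hypothesis is an inequality. *)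
Lemma cancel_plusk (F : fieldType) (j : {rmorphism V -> F}) d k :
  cancel_plus1 j d -> forall n (e : 'M[V]_n) n' (e' : 'M[V]_n'),
    e *m e = e -> e' *m e' = e' -> (d <= \rank (map_mx j e))%N ->
    idem_iso (block_mx e 0 0 (1%:M : 'M_k)) (block_mx e' 0 0 (1%:M : 'M_k)) ->
    idem_iso e e'.
Proof.
move=> C1; elim: k => [|k IH] n e n' e' ee ee' rk.
  move=> [X [Y [XY YX]]]; exists (ulsubmx X), (ulsubmx Y); split.
    have := congr1 ulsubmx XY; rewrite block_mxKul -{1}[X]submxK -{1}[Y]submxK.
    by rewrite mulmx_block block_mxKul [ursubmx X]thinmx0 mul0mx addr0.
  have := congr1 ulsubmx YX; rewrite block_mxKul -{1}[X]submxK -{1}[Y]submxK.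
  by rewrite mulmx_block block_mxKul [ursubmx Y]thinmx0 mul0mx addr0.
have id1 m := mul1mx (1%:M : 'M[V]_m).
move=> iso; apply: C1 => //; apply: IH; rewrite ?plus1_idem //.
  rewrite map_plus1 /plus1 rank_diag_block_mx; exact: leq_trans rk (leq_addr _ _).
have pe := plus1_idem ee; have pe' := plus1_idem ee'.
apply: (idem_iso_trans (e2 := block_mx e 0 0 (1%:M : 'M_(1 + k)))); try exact: block_idem.
  by apply/idem_iso_sym/idem_iso_shift.
apply: (idem_iso_trans (e2 := block_mx e' 0 0 (1%:M : 'M_(1 + k)))); try exact: block_idem.
  exact: iso.
exact: idem_iso_shift.
Qed.

End IdemIso.

Definition preserves_freeness (A : comNzRingType) (F : fieldType) (j : A -> F) :=
  forall m n (M : 'M[A]_(m, n)), (forall c : 'rV_m, c *m M = 0 -> c = 0) ->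
    row_free (map_mx j M).

Lemma cancellative_idem (A : comNzRingType) (F : fieldType) (j : {rmorphism A -> F}) d
    (P : lmodType A) :
  preserves_freeness j -> cancel_plus1 j d -> fg_projective P -> module_rank_eq P d ->
  cancellative P.
Proof.
move=> pf C1 /fg_projective_represents [n [e rP]] [[sq [ssq lin]] _] P' Q.
move=> /fg_projective_represents [n' [e' rP']] /fg_projective_represents [k [f rQ]].
move=> iso; apply: (idem_iso_mod rP rP').
have ee := represents_idem rP; have ee' := represents_idem rP'; have ff := represents_idem rQ.
apply: (cancel_plusk (k := k) C1) => //; last first.
  have ff1 : (1%:M - f) *m (1%:M - f) = 1%:M - f.
    by rewrite mulmxBr mulmx1 mulmxBl mul1mx ff subrr subr0.
  have iso1 := mod_iso_idem (represents_sum rP rQ) (represents_sum rP' rQ) iso.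
  have id1 := mul1mx (1%:M : 'M[A]_k).
  have b1 := block_idem ee ff; have b2 := block_idem ee' ff.
  apply: (idem_iso_trans (e2 := block_mx (block_mx e 0 0 f) 0 0 (1%:M - f)));
    try exact: block_idem.
    by apply/idem_iso_sym/idem_iso_complement.
  apply: (idem_iso_trans (e2 := block_mx (block_mx e' 0 0 f) 0 0 (1%:M - f)));
    try exact: block_idem.
    exact: idem_iso_add.
  exact: idem_iso_complement.
case: rP => i [p [ip Ee]].
(* Its rows are the images of [d] independent elements of [P]; they stay independent over [F] and
   lie in the row space of e, whose rank is thus at least [d]. *)
pose M : 'M[A]_(size sq, n) := \matrix_(l < size sq) i sq`_l.
have Mfree : row_free (map_mx j M).
  apply: pf => c cM; apply/rowP => l; rewrite mxE.
  have h : \sum_(l < size sq) c 0 l *: sq`_l = 0.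
    rewrite -[LHS]ip linear_sum /=; transitivity (p 0); last exact: linear0.
    congr (p _).
    rewrite -[RHS]cM; apply/rowP => q; rewrite summxE mxE; apply: eq_bigr => l' _.
    by rewrite linearZ !mxE.
  exact: (lin (fun l => c 0 l) h l).
have ME : M *m e = M.
  by apply/row_matrixP => l; rewrite row_mul rowK Ee ip.
move: Mfree; rewrite /row_free -ssq => /eqP <-.
by rewrite -{1}ME map_mxM mxrankM_maxr.
Qed.

(** * Rees algebras *)

Lemma pack_rmorphism (B C : comNzRingType) (f : B -> C) :
  (forall x y, f (x + y) = f x + f y) -> (forall x y, f (x * y) = f x * f y) -> f 1 = 1 ->
  exists h : {rmorphism B -> C}, h =1 f.
Proof.
move=> fD fM f1.
have fB : zmod_morphism f.
  by move=> x y; apply: (addIr (f y)); rewrite -fD !subrK.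
have fm : monoid_morphism f by [].
pose h : {rmorphism B -> C} := HB.pack f (GRing.isZmodMorphism.Build B C f fB)
  (GRing.isMonoidMorphism.Build B C f fm).
by exists h.
Qed.

Lemma lift_rmorphism (B A C : comNzRingType) (f : {rmorphism B -> C}) (h : {rmorphism A -> C}) :
  injective h -> (forall b, exists a, h a = f b) ->
  exists k : {rmorphism B -> A}, forall b, h (k b) = f b.
Proof.
move=> h_inj H; have [k kE] := choice H.
have [|||k' k'E] := @pack_rmorphism B A k.
- by move=> x y; apply: h_inj; rewrite rmorphD !kE rmorphD.
- by move=> x y; apply: h_inj; rewrite rmorphM !kE rmorphM.
- by apply: h_inj; rewrite kE !rmorph1.
by exists k' => b; rewrite k'E.
Qed.

Lemma fraction_surj (D : idomainType) (y : {fraction D}) :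
  exists p q, q != 0 /\ y * FracField.tofrac q = FracField.tofrac p.
Proof.
elim/quotW: y => x; exists \n_x, \d_x; split; first exact: denom_ratioP.
unlock FracField.tofrac; rewrite -[LHS]FracField.pi_mul.
apply/eqmodP; rewrite /= FracField.equivfE /FracField.mulf /=.
by rewrite !numden_Ratio ?(oner_neq0, mulr1, mulf_neq0, denom_ratioP) // mulrC.
Qed.

Lemma free_frac (A : comNzRingType) (F : fieldType) (j : {rmorphism A -> F}) :
  injective j -> (forall y, exists a b, j b != 0 /\ y * j b = j a) -> preserves_freeness j.
Proof.
move=> j_inj frac m n M Mfree; rewrite -kermx_eq0; apply/rowV0P => v /sub_kermxP vM.
pose W b := j b != 0.
have mW : is_monoid W.
  split; first by rewrite /W rmorph1 oner_neq0.
  by move=> x y; rewrite /W rmorphM => *; rewrite mulf_neq0.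
have [|w [v0 [Ww Ev]]] := @clear_mx A F j W mW _ _ v.
  by move=> i k; have [a [b [b0 E]]] := frac (v i k); exists a, b.
have v00 : v0 = 0.
  apply: Mfree; apply: (map_mx_injf j_inj); rewrite /= map_mxM -Ev -scalemxAl vM scaler0.
  by rewrite map_mx0.
by apply: (scalerI Ww); rewrite Ev v00 map_mx0 scaler0.
Qed.

Section Shapes.
Variables (R : idomainType) (A : comNzRingType) (F : fieldType).
Variables (rho : {rmorphism {poly R} -> F}) (j : {rmorphism A -> F}).
Hypotheses (rho_inj : injective rho) (j_inj : injective j).
Hypothesis consts : forall c, exists a, j a = rho c%:P.
Hypothesis shape : rees_shape rho j \/ ext_rees_shape rho j.
Hypothesis frac : forall y, exists p q, q != 0 /\ y * rho q = rho p.

(** The variable is sent to xX in the Rees case and to X in the extended case; clearing powers of x,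
    respectively of X, shows that every element of [A] is algebraic over the image. *)
Lemma shape_base : exists g : {rmorphism {poly R} -> A},
  (forall c, j (g c%:P) = rho c%:P) /\ forall x, algebraic_over g x.
Proof.
have imC c : imA j (rho c%:P) by have [a Ea] := consts c; exists a.
case: shape => [[h1 [x [a [x0 Ea]]]]|[h1 [a Ea] _]].
  pose q : {poly R} := x%:P * 'X.
  pose f : {rmorphism {poly R} -> F} := rho \o comp_poly q.
  have fE p : f p = rho (p \Po q) by [].
  have [|g gE] := @lift_rmorphism {poly R} A F f j j_inj.
    move=> p; suff [b Eb] : imA j (f p) by exists b.
    by rewrite fE; apply: imA_comp => //; exists a.
  exists g; split=> [c|y]; first by rewrite gE fE comp_polyC.
  have [p Ep] := h1 y.
  exists (x ^+ size p)%:P, (\poly_(i < size p) (x ^+ (size p - i) * p`_i)); split.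
    move/(congr1 j); rewrite gE fE comp_polyC rmorph0; apply/eqP.
    by rewrite rho_neq0 // polyC_eq0 expf_neq0.
  apply: j_inj; rewrite rmorphM !gE !fE comp_polyC Ep -rmorphM; congr (rho _).
  exact: clear_denominators.
have [|g gE] := @lift_rmorphism {poly R} A F rho j j_inj.
  move=> p; suff [b Eb] : imA j (rho p) by exists b.
  by rewrite -[p]comp_polyXr; apply: imA_comp => //; exists a.
exists g; split=> [c|y]; first exact: gE.
have [N [p Ep]] := h1 y; exists 'X^N, p; split.
  by move/(congr1 j); rewrite gE rmorph0; apply/eqP; rewrite rho_neq0 // expf_neq0 // polyX_eq0.
by apply: j_inj; rewrite rmorphM !gE -Ep rmorphXn mulrC.
Qed.

Lemma shape_cancel d : noetherian R -> dim_lt R d -> (0 < d)%N ->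
  cancel_plus1 j d.
Proof.
move=> nR dimR d0 n e n' e' ee ee' rk; have [g [jg alg]] := shape_base.
exact: (cancel_matrix rho_inj j_inj jg alg shape nR dimR d0).
Qed.

Lemma shape_free : preserves_freeness j.
Proof.
apply: free_frac => // y; have [p [q [q0 E]]] := frac y.
have [g [jg _]] := shape_base; have sAA := imA_subr j.
case: shape => [[h1 [x [a [x0 Ea]]]]|ext]; last first.
  have rA := ext_rees_rho jg ext.
  have [b Eb] := rA p; have [c Ec] := rA q; exists b, c.
  by rewrite -Ec -Eb rho_neq0.
have clr := fun f => rees_clear jg f Ea (esym (mulr1 x)).
have imC c : imA j (rho c%:P) by exact: (imA_const jg).
have [b Eb] : imA j (rho (x ^+ size q)%:P * rho ((x ^+ size p)%:P * p)) by apply: (subrM sAA).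
have [c Ec] : imA j (rho (x ^+ size p)%:P * rho ((x ^+ size q)%:P * q)) by apply: (subrM sAA).
exists b, c; rewrite -Ec -Eb; split.
  by rewrite !rmorphM !mulf_neq0 ?rho_neq0 ?polyC_eq0 ?expf_neq0.
by rewrite !rmorphM -E; ring.
Qed.

End Shapes.

Section Rees.
Variables (R : idomainType) (I : R -> Prop).

Lemma ideal_pow0 n : ideal_pow I n 0.
Proof. by case: n => // n; exists [::]; rewrite big_nil. Qed.

Lemma rees_const c : in_rees I c%:P.
Proof. by move=> [|i]; rewrite coefC //=; apply: (@ideal_pow0 i.+1). Qed.

Lemma rees_linear x : I x -> in_rees I (x%:P * 'X).
Proof.
move=> Ix [|[|i]]; rewrite coefCM coefX /= ?mulr0 ?mulr1 //; last exact: (@ideal_pow0 i.+2).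
exists [:: (x, 1)]; rewrite big_seq1 mulr1; split=> // ab.
by rewrite inE => /eqP->.
Qed.

Lemma rees_zero p : (forall x, I x -> x = 0) -> in_rees I p -> p = (p`_0)%:P.
Proof.
move=> I0 hp; apply/polyP => -[|i]; rewrite coefC //=.
have [s [hs ->]] := hp i.+1; rewrite big_seq big1 // => ab /hs [/I0 -> _].
by rewrite mul0r.
Qed.

Variables (A : comNzRingType) (d : nat).
Hypotheses (nR : noetherian R) (dimR : dim_lt R d) (d0 : (0 < d)%N).
Variables (F : fieldType) (rho : {rmorphism {poly R} -> F}).
Hypotheses (rho_inj : injective rho) (frac : forall y, exists p q, q != 0 /\ y * rho q = rho p).

Lemma poly_cancel : cancel_plus1 rho d.
Proof.
apply: (@shape_cancel R {poly R} F rho rho) => //; try exact: rho_inj.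
- by move=> c; exists c%:P.
- left; split=> [a|]; first by exists a.
  by exists 1, 'X; rewrite oner_neq0 mul1r.
Qed.

(** Serves the case I = 0, where [A] is [R] and contains no xX with x nonzero. Cancellation takes
    place over R[X], and setting X = 0 brings the isomorphism back to constants. *)
Lemma rees_trivial (phi : {rmorphism A -> {poly R}}) : injective phi ->
  (forall a, exists c, phi a = c%:P) -> (forall c, exists a, phi a = c%:P) ->
  preserves_freeness (rho \o phi : {rmorphism A -> F}) /\
  cancel_plus1 (rho \o phi : {rmorphism A -> F}) d.
Proof.
move=> phi_inj phiC Cphi; split.
  move=> m n M Mfree; rewrite map_mx_comp; apply: (free_frac rho_inj) => [y|V VM].
    by have [p [q [q0 E]]] := frac y; exists p, q; rewrite rho_neq0.
  apply/rowP => i; rewrite mxE; apply/polyP => k; rewrite coef0.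
  have H (l : 'I_m) : exists a, phi a = ((V 0 l)`_k)%:P := Cphi _.
  have [c cE] := fin_all_exists H.
  have /rowP/(_ i) : \row_l c l = 0.
    apply: Mfree; apply/rowP => q; apply: phi_inj; rewrite !mxE rmorph_sum rmorph0.
    have := congr1 (fun N : 'rV[{poly R}]_n => (N 0 q)`_k) VM; rewrite !mxE coef0 coef_sum => E.
    rewrite -[RHS]polyC0 -E rmorph_sum; apply: eq_bigr => l _; rewrite !mxE rmorphM cE.
    by have [c' ->] := phiC (M l q); rewrite coefMC rmorphM.
  rewrite !mxE => ci; have := cE i; rewrite ci rmorph0 => /esym/eqP.
  by rewrite polyC_eq0 => /eqP.
move=> n e n' e' ee ee' rk [X [Y [XY YX]]].
have [||||X1 [Y1 [XY1 YX1]]] := @poly_cancel n (map_mx phi e) n' (map_mx phi e').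
- by rewrite -map_mxM ee.
- by rewrite -map_mxM ee'.
- by rewrite -map_mx_comp.
- by exists (map_mx phi X), (map_mx phi Y); rewrite -!map_mxM XY YX !map_plus1.
pose ev0 : {rmorphism {poly R} -> {poly R}} := polyC \o horner_eval 0.
have pull k l (N : 'M[{poly R}]_(k, l)) : exists N0, map_mx ev0 N = map_mx phi N0.
  have H (il : 'I_k * 'I_l) : exists a, phi a = ev0 (N il.1 il.2) := Cphi _.
  have [c cE] := fin_all_exists H; exists (\matrix_(i, q) c (i, q)).
  by apply/matrixP => i q; rewrite !mxE cE.
have ev0_phi k (f : 'M[A]_k) : map_mx ev0 (map_mx phi f) = map_mx phi f.
  apply/matrixP => i q; rewrite !mxE; have [c ->] := phiC (f i q).
  by rewrite /ev0 /= /horner_eval hornerC.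
have [X0 EX] := pull _ _ X1; have [Y0 EY] := pull _ _ Y1.
exists X0, Y0; split; apply: (map_mx_injf phi_inj); rewrite /= map_mxM -EX -EY -map_mxM.
  by rewrite XY1 ev0_phi.
by rewrite YX1 ev0_phi.
Qed.

Lemma rees_cancellative (P : lmodType A) : is_rees_algebra I A ->
  fg_projective P -> module_rank_eq P d -> cancellative P.
Proof.
move=> [phi [phi_inj phiE]] fgP rkP.
pose j : {rmorphism A -> F} := rho \o phi.
have j_inj : injective j by move=> a b /rho_inj /phi_inj.
have Cphi c : exists a, phi a = c%:P by apply/phiE/rees_const.
suff [pf C1] : preserves_freeness j /\ cancel_plus1 j d by exact: cancellative_idem pf C1 fgP rkP.
have [[x [Ix x0]]|I0] := EM (exists x, I x /\ x <> 0); last first.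
  apply: rees_trivial => // a; exists (phi a)`_0; apply: rees_zero.
    by move=> x Ix; apply: contrapT => x0; apply: I0; exists x.
  by apply/phiE; exists a.
have shape : rees_shape rho j \/ ext_rees_shape rho j.
  left; split=> [a|]; first by exists (phi a).
  have [a Ea] : exists a, phi a = x%:P * 'X by apply/phiE/rees_linear.
  by exists x, a; split; [apply/eqP | rewrite -Ea].
have consts c : exists a, j a = rho c%:P by have [a Ea] := Cphi c; exists a; rewrite -Ea.
split; last exact: (shape_cancel rho_inj j_inj consts shape).
apply: (shape_free rho_inj j_inj consts shape frac).
Qed.

Let z : F := rho 'X.
Let z0 : z != 0. Proof. by rewrite rho_neq0 // polyX_eq0. Qed.
Let rhoC : {rmorphism R -> F} := rho \o polyC.
Let comm_zV : commr_rmorph rhoC z^-1. Proof. by move=> a; apply: mulrC. Qed.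
(* Evaluation at X = 1/z, so that 1/t becomes the polynomial variable. *)
Let kappa : {rmorphism {poly R} -> F} := horner_morph comm_zV.

Lemma kappaC c : kappa c%:P = rho c%:P. Proof. exact: horner_morphC. Qed.
Lemma kappaX : kappa 'X = z^-1. Proof. exact: horner_morphX. Qed.

Lemma kappa_rev (p : {poly R}) N : (size p <= N.+1)%N ->
  kappa p * z ^+ N = rho (\poly_(k < N.+1) p`_(N - k)).
Proof.
move=> sp; rewrite -{1}[p](coefK) poly_def rmorph_sum.
rewrite (big_ord_widen _ (fun i => kappa (p`_i *: 'X^i)) sp) big_mkcond /=.
rewrite poly_def rmorph_sum mulr_suml [RHS](reindex_inj rev_ord_inj) /=.
apply: eq_bigr => i _; rewrite subSS subKn; last by rewrite -ltnS.
case: ifP => [_|/negbT].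
  rewrite -!mul_polyC !rmorphM kappaC !rmorphXn kappaX -mulrA; congr (_ * _).
  have iN : (i <= N)%N by rewrite -ltnS.
  have -> : z ^+ N = z ^+ (N - i) * z ^+ i by rewrite -exprD subnK.
  by rewrite mulrCA -exprMn mulVf // expr1n mulr1.
by rewrite -leqNgt => /(nth_default 0) ->; rewrite mul0r scale0r rmorph0.
Qed.

Lemma kappa_inj (p : {poly R}) : kappa p = 0 -> p = 0.
Proof.
move=> k0; have := kappa_rev (leqnSn (size p)); rewrite k0 mul0r -(rmorph0 rho).
move=> /rho_inj/esym E; apply/polyP => i; rewrite coef0.
have [ip|pi] := ltnP i (size p); last by rewrite nth_default.
have := congr1 (fun q : {poly R} => q`_(size p - i)) E.
by rewrite coef_poly coef0 ltnS leq_subr subKn // ltnW.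
Qed.

Lemma ext_rees_cancellative (P : lmodType A) : is_ext_rees_algebra I A ->
  fg_projective P -> module_rank_eq P d -> cancellative P.
Proof.
move=> [L [iota [u [psi [[iota_inj uX Lsurj] psi_inj psiE]]]]] fgP rkP.
have uXn n : u ^+ n * iota 'X^n = 1 by rewrite rmorphXn -exprMn uX expr1n.
have kXn n : kappa 'X^n = (z ^+ n)^-1 by rewrite rmorphXn kappaX exprVn.
have zn n : z ^+ n != 0 by rewrite expf_neq0.
have H (x : L) : exists pn : {poly R} * nat, x * iota 'X^(pn.2) = iota pn.1.
  by have [p [n ->]] := Lsurj x; exists (p, n); rewrite /= -mulrA uXn mulr1.
have [f fE] := choice H.
(* The embedding of R[t, 1/t] in [F] with t sent to 1/z: if x t^n = p(t), then x goes to p(1/z)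
   z^n. *)
pose l0 x : F := kappa (f x).1 * z ^+ (f x).2.
have l0E x p n : x * iota 'X^n = iota p -> l0 x = kappa p * z ^+ n.
  move=> E; have : (f x).1 * 'X^n = p * 'X^((f x).2).
    by apply: iota_inj; rewrite !rmorphM -fE -E mulrAC.
  by move/(congr1 kappa)/eqP; rewrite !rmorphM !kXn eqr_div // => /eqP.
have [|||l lE] := @pack_rmorphism L F l0.
- move=> x y.
  rewrite (l0E _ ((f x).1 * 'X^((f y).2) + (f y).1 * 'X^((f x).2)) ((f x).2 + (f y).2)%N).
    by rewrite /l0 rmorphD !rmorphM !kXn exprD; field; rewrite !zn.
  by rewrite exprD rmorphD !rmorphM -!fE; ring.
- move=> x y; rewrite (l0E _ ((f x).1 * (f y).1) ((f x).2 + (f y).2)%N).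
    by rewrite /l0 rmorphM exprD mulrACA.
  by rewrite exprD !rmorphM -!fE; ring.
- by rewrite (l0E 1 1 0%N) ?rmorph1 ?mulr1.
have liota p : l (iota p) = kappa p by rewrite lE (l0E _ p 0%N) ?rmorph1 ?mulr1.
have lu : l u = z by rewrite lE (l0E _ 1 1%N) ?rmorph1 ?mul1r.
have l_inj x : l x = 0 -> x = 0.
  rewrite lE => /eqP; rewrite mulf_eq0 (negPf (zn _)) orbF => /eqP /kappa_inj f0.
  by rewrite -[x]mulr1 -(uXn (f x).2) mulrCA fE f0 rmorph0 mulr0.
pose j : {rmorphism A -> F} := l \o psi.
have j_inj : injective j.
  move=> a b E; apply: psi_inj; apply/eqP; rewrite -subr_eq0; apply/eqP; apply: l_inj.
  by move/eqP: E; rewrite -subr_eq0 -!rmorphB => /eqP.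
pose mk p q : L := iota p + u * (map_poly (fun c => iota c%:P) q).[u].
have lmk p q : l (mk p q) = kappa p + z * rho q.
  rewrite /mk rmorphD rmorphM liota lu; congr (_ + _ * _).
  rewrite -[map_poly _ q]/(map_poly (iota \o polyC) q) -horner_map lu -map_poly_comp /=.
  have -> : map_poly (l \o (iota \o polyC)) q = map_poly rhoC q.
    by apply: eq_map_poly => c; rewrite /= liota kappaC.
  by rewrite -[q in RHS]comp_polyXr /comp_poly -horner_map -map_poly_comp.
have jP a : exists p q, in_rees I p /\ j a = kappa p + z * rho q.
  have [p [q [hp E]]] : exists p q, in_rees I p /\ psi a = mk p q by apply/psiE; exists a.
  by exists p, q; split=> //; rewrite -lmk -E.
have Pj p q : in_rees I p -> exists a, j a = kappa p + z * rho q.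
  move=> hp; have [a Ea] : exists a, psi a = mk p q by apply/psiE; exists p, q.
  by exists a; rewrite -lmk -Ea.
have consts c : exists a, j a = rho c%:P.
  by have [a Ea] := Pj _ 0 (rees_const c); exists a; rewrite Ea kappaC rmorph0 mulr0 addr0.
have jz : exists a, j a = z.
  have [a Ea] := Pj _ 1 (rees_const 0); exists a.
  by rewrite Ea kappaC !rmorph0 add0r rmorph1 mulr1.
(* A nonzero x in [I] gives xt, which becomes x/z: the extended shape. If I = 0 the algebra is
   R[1/t], a polynomial ring in z, which has the Rees shape with x = 1. *)
have shape : rees_shape rho j \/ ext_rees_shape rho j.
  have [[x [Ix x0]]|I0] := EM (exists x, I x /\ x <> 0); [right|left].
    split=> //.
      move=> a; have [p [q [_ ->]]] := jP a.
      exists (size p), (\poly_(k < (size p).+1) p`_(size p - k) + 'X * q * 'X^(size p)).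
      by rewrite rmorphD mulrDl (kappa_rev (leqnSn _)) !rmorphM rmorphXn.
    have [a Ea] := Pj _ 0 (rees_linear Ix); exists x, a; split; first exact/eqP.
    by rewrite Ea rmorph0 mulr0 addr0 rmorphM kappaC kappaX mulfVK.
  split=> [a|]; last first.
    by have [a Ea] := jz; exists 1, a; rewrite oner_neq0 mul1r.
  have [p [q [hp ->]]] := jP a; exists ((p`_0)%:P + 'X * q).
  rewrite {1}(rees_zero _ hp) ?kappaC ?rmorphD ?rmorphM //.
  by move=> x Ix; apply: contrapT => x0; apply: I0; exists x.
apply: (cancellative_idem _ _ fgP rkP).
  apply: (shape_free rho_inj j_inj consts shape frac).
exact: (shape_cancel rho_inj j_inj consts shape).
Qed.

End Rees.

Theorem theorem1p2 (d : nat) (R : idomainType) (I : R -> Prop)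
  (A : comNzRingType) (P : lmodType A) :
  (1 <= d)%N -> noetherian R -> krull_dim_eq R d.-1 -> is_ideal I ->
  (is_rees_algebra I A \/ is_ext_rees_algebra I A) ->
  fg_projective P -> module_rank_eq P d -> cancellative P.
Proof.
move=> d0 nR [_ dimR'] iI alg.
have dimR : dim_lt R d.
  by move=> Z Q /pch_chain [C [hC _]]; apply: dimR'; exists C; rewrite prednK.
pose rho : {rmorphism {poly R} -> {fraction {poly R}}} := @FracField.tofrac {poly R}.
have rho_inj : injective rho by move=> p q /eqP; rewrite tofrac_eq => /eqP.
case: alg => alg fgP rkP.
  exact: (rees_cancellative nR dimR d0 rho_inj (@fraction_surj _) alg fgP rkP).
exact: (ext_rees_cancellative nR dimR d0 rho_inj (@fraction_surj _) alg fgP rkP).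
Qed.
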